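(* Let $\gamma>0$ and $\ell=\pi$. Fix $m>0$. The set of positive steady states with mean value $m$ of the equation $$H_t+\gamma\,\mathrm{div}\bigl(H^3\nabla(\Delta H+H)\bigr)=0,\qquad t>0,\ \vartheta,\zeta\in\mathbb T,$$ in $H^4_{\mathrm{ev}}(\mathbb T^2)$ is the three-dimensional manifold $$\mathcal M(m)=\bigl\{m+a_{-1}e^{-i\vartheta}+a_1e^{i\vartheta}+b\cos(\zeta)\ :\ a_{\pm1}\in\mathbb C,\ b\in\mathbb R,\ a_{-1}=\overline{a_1},\ |a_{-1}|+|a_1|+|b|<m\bigr\}.$$
   Context: $\mathbb T=\mathbb R/2\pi\mathbb Z$; $\mathrm{div},\nabla,\Delta$ are the usual operators in $(\vartheta,\zeta)\in\mathbb T^2$. $H^4_{\mathrm{ev}}(\mathbb T^2)$ is the space of real-valued functions in $H^4(\mathbb T^2)$ that are even in $\zeta$. The mean value of $H$ is $\frac1{4\pi^2}\int_{\mathbb T^2}H\,d\vartheta\,d\zeta$. The equation is the rimming-flow equation $h_t+h_\theta+\gamma\,\mathrm{div}(h^3\nabla(\Delta h+h))=\delta(h^3\cos\theta)_\theta$ with $\delta=0$, written in the rotating coordinate $\vartheta=\theta-t$; its steady states correspond to ($2\pi$-time-periodic) travelling waves of the original equation. *)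

(* Defs.v *)
From HB Require Import structures.
From mathcomp Require Import all_boot all_order all_algebra complex.
From mathcomp Require Import all_classical all_reals all_analysis.
Set Implicit Arguments.
Unset Strict Implicit.
Unset Printing Implicit Defensive.
Import Order.TTheory GRing.Theory Num.Theory.
Import numFieldNormedType.Exports.
Local Open Scope classical_set_scope.
Local Open Scope ring_scope.
Local Open Scope complex_scope.

(* Functions on the torus T^2 = (R / 2 pi Z)^2 are functions of
   z = (theta, zeta) : R * R.  Only the values on one period cell matter for
   L^2 functions; continuous functions are required to be 2 pi-periodic. *)

Definition periodic2 (R : realType) (f : R * R -> R) : Prop :=
  forall x y : R, f (x + 2 * pi, y) = f (x, y) /\ f (x, y + 2 * pi) = f (x, y).

Definition cell (R : realType) : set (measurableTypeR R * measurableTypeR R) :=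
  `[0, 2 * pi]%classic `*` `[0, 2 * pi]%classic.
Arguments cell : clear implicits.

Definition leb2 (R : realType)
    : {measure set (measurableTypeR R * measurableTypeR R) -> \bar R} :=
  (lebesgue_measure \x lebesgue_measure)%E.
Arguments leb2 : clear implicits.

Definition tint (R : realType) (f : R * R -> R) : R :=
  Rintegral (leb2 R) (cell R) f.

Definition mean (R : realType) (f : R * R -> R) : R := (4 * pi ^+ 2)^-1 * tint f.

Definition L2T (R : realType) (f : R * R -> R) : Prop :=
  measurable_fun (cell R) f /\
  (leb2 R).-integrable (cell R) (EFin \o (fun z => f z ^+ 2)).

Definition dtheta (R : realType) (f : R * R -> R) : R * R -> R :=
  fun z => 'D_((1, 0) : R * R) f z.
Definition dzeta (R : realType) (f : R * R -> R) : R * R -> R :=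
  fun z => 'D_((0, 1) : R * R) f z.

Fixpoint Ck2 (R : realType) (k : nat) (f : R * R -> R) : Prop :=
  continuous f /\
  if k is k'.+1 then
    [/\ forall z, derivable f z ((1, 0) : R * R),
        forall z, derivable f z ((0, 1) : R * R),
        Ck2 k' (dtheta f) & Ck2 k' (dzeta f)]
  else True.

(* C^oo(T^2) *)
Definition test (R : realType) (phi : R * R -> R) : Prop :=
  periodic2 phi /\ forall k, Ck2 k phi.

(* g in L^2(T^2) is the weak derivative d^(i+j) f / dtheta^i dzeta^j on T^2. *)
Definition is_wD (R : realType) (i j : nat) (f g : R * R -> R) : Prop :=
  L2T g /\
  forall phi, test phi ->
    tint (fun z => f z * iter i (@dtheta R) (iter j (@dzeta R) phi) z) =
    (-1) ^+ (i + j) * tint (fun z => g z * phi z).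

(* A weak derivative in L^2 is unique up to a null set of the cell; wD selects
   one (and is only used where one exists). *)
Definition wD (R : realType) (i j : nat) (f : R * R -> R) : R * R -> R :=
  xget (fun=> 0) [set g | is_wD i j f g].

(* H^4(T^2): every class has exactly one continuous representative (Sobolev
   embedding in dimension 2), and is identified with it. *)
Definition H4T (R : realType) : set (R * R -> R) :=
  [set f | [/\ continuous f, periodic2 f &
     forall i j, (i + j <= 4)%N -> exists g, is_wD i j f g]].

Definition H4ev (R : realType) : set (R * R -> R) :=
  [set f | H4T f /\ forall x y : R, f (x, - y) = f (x, y)].

Definition H4norm (R : realType) (f : R * R -> R) : R :=
  Num.sqrt (\sum_(i < 5) \sum_(j < 5 | (i + j <= 4)%N)
    tint (fun z => wD i j f z ^+ 2)).

Definition laplace (R : realType) (f : R * R -> R) : R * R -> R :=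
  fun z => wD 2 0 f z + wD 0 2 f z.

(* g in L^2(T^2) is the (weak) divergence of (F1, F2) on T^2. *)
Definition is_div (R : realType) (F1 F2 g : R * R -> R) : Prop :=
  L2T g /\
  forall phi, test phi ->
    tint (fun z => F1 z * dtheta phi z + F2 z * dzeta phi z) =
    - tint (fun z => g z * phi z).

(* H_t + gamma div (H^3 grad (Delta H + H)) = 0 for H independent of t, as an
   equation in L^2(T^2). *)
Definition steady (R : realType) (gamma : R) (H : R * R -> R) : Prop :=
  let p := fun z => laplace H z + H z in
  exists2 g : R * R -> R,
    is_div (fun z => H z ^+ 3 * wD 1 0 p z) (fun z => H z ^+ 3 * wD 0 1 p z) g &
    {ae leb2 R, forall z, cell R z -> gamma * g z = 0}.

Definition positive_steady_states (R : realType) (gamma m : R)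
    : set (R * R -> R) :=
  [set H | [/\ H4ev H, forall z, 0 < H z, mean H = m & steady gamma H]].

Definition expi (R : realType) (t : R) : R[i] := cos t +i* sin t.

(* Normc.normc is the R-valued modulus. *)
Definition Mset (R : realType) (m : R) : set (R * R -> R) :=
  [set H | exists (am a1 : R[i]) (b : R),
     [/\ am = a1^*,
         Normc.normc am + Normc.normc a1 + `|b| < m &
         forall theta zeta : R,
           (H (theta, zeta))%:C =
             m%:C + am * expi (- theta) + a1 * expi theta + (b * cos zeta)%:C]].

(* phi : U -> H4ev has at u the partial derivative psi in the i-th coordinate,
   in the norm of H^4. *)
Definition is_partial (R : realType) (d : nat) (phi : 'rV[R]_d -> R * R -> R)
    (i : 'I_d) (u : 'rV[R]_d) (psi : R * R -> R) : Prop :=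
  H4norm (fun z => s^-1 * (phi (u + s *: delta_mx 0 i) z - phi u z) - psi z)
    @[s --> (0 : R)^'] --> (0 : R).

(* phi is of class C^k from the open set U to the Hilbert space H4ev. *)
Fixpoint CkH4 (R : realType) (d k : nat) (U : set 'rV[R]_d)
    (phi : 'rV[R]_d -> R * R -> R) : Prop :=
  [/\ forall u, U u -> H4ev (phi u),
      forall u, U u ->
        H4norm (fun z => phi v z - phi u z) @[v --> u] --> (0 : R) &
      if k is k'.+1 then
        forall i : 'I_d, exists psi : 'rV[R]_d -> R * R -> R,
          (forall u, U u -> is_partial phi i u (psi u)) /\ CkH4 k' U psi
      else True].

(* M is an embedded d-dimensional C^oo submanifold of H4ev: near each of its
   points, M is parametrised by an injective C^oo immersion phi of an open set
   of R^d that is an open map into M, i.e. a homeomorphism onto an open subset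
   of M. *)
Definition H4submanifold (R : realType) (d : nat) (M : set (R * R -> R))
    : Prop :=
  M `<=` H4ev (R := R) /\
  forall H, M H -> exists (U : set 'rV[R]_d) (phi : 'rV[R]_d -> R * R -> R),
    [/\ open U /\ (exists2 u, U u & phi u = H),
        forall u, U u -> M (phi u),
        forall u v, U u -> U v -> phi u = phi v -> u = v,
        forall k, CkH4 k U phi &
        (forall u, U u -> forall psi : 'I_d -> R * R -> R,
           (forall i, H4ev (psi i) /\ is_partial phi i u (psi i)) ->
           forall c : 'I_d -> R,
             (forall z, \sum_(i < d) c i * psi i z = 0) ->
             forall i, c i = 0) /\
        (forall u, U u -> forall e : R, 0 < e -> exists2 r : R, 0 < r &
           forall G, M G -> H4norm (fun z => G z - phi u z) < r ->
             exists v, [/\ U v, ball u e v & phi v = G])].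

(* Main.v *)
Require Import Defs.
From mathcomp Require Import all_boot all_order all_algebra complex.
From mathcomp Require Import all_classical all_reals all_analysis.
From mathcomp Require Import measurable_realfun ring lra zify.
Set Implicit Arguments.
Unset Strict Implicit.
Unset Printing Implicit Defensive.
Import Order.TTheory GRing.Theory Num.Theory.
Import numFieldNormedType.Exports.
Local Open Scope classical_set_scope.
Local Open Scope ring_scope.

(** Let H be a positive steady state and p = Delta H + H, so that
    div (H^3 grad p) = 0.  Testing this equation against p itself would give
    int H^3 |grad p|^2 = 0, hence grad p = 0 because H is bounded below by a
    positive constant.  The Laplacian multiplies the Fourier mode of frequency
    (j, k) by -(j^2 + k^2), so p being constant kills every mode of H with
    j^2 + k^2 different from 0 and 1.  What is left is
    m + al cos theta + be sin theta + b cos zeta + e sin zeta, and evenness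
    in zeta gives e = 0.  The minimum of this function, for e = 0, is
    m - sqrt (al^2 + be^2) - |b|; with a_1 = (al - i be) / 2 its positivity is
    the inequality |a_{-1}| + |a_1| + |b| < m.  Conversely Delta H + H is the
    constant m for every such H.

    The function p only has weak derivatives and is not a test function, so
    the energy argument needs an approximation (lemma [grad_orthogonal]).  Take
    test functions phi that nearly minimise the integral of
    |grad p - grad phi|^2.  By near-minimality grad p - grad phi is almost
    orthogonal to gradients of test functions, hence to each trigonometric
    monomial, since a nonconstant monomial is a multiple of its own Laplacian;
    thus it converges weakly to 0 against continuous fields.  By the
    parallelogram identity the fields grad phi are Cauchy in L^2.  Together
    with the steady equation these two facts force grad phi to 0 in L^2, so
    grad p is orthogonal to all continuous fields.

    Two density results support this.  Continuous periodic functions are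
    uniform limits of trigonometric polynomials (lemma [trig_dense]); the proof
    averages translates of the Fejer kernel over equally spaced nodes, so that
    only finite sums occur.  And an L^2 function orthogonal to all continuous
    periodic functions vanishes almost everywhere (lemma [orth_continuous_L2],
    by a pi-lambda argument).  The latter makes weak derivatives unique up to
    null sets, so that the H^4 norm of a test function can be computed with
    its classical derivatives.  Symmetry of second derivatives is obtained from
    the former: both orders agree on monomials, hence weakly, hence everywhere.

    Finally the parametrisation (al, be, b) |-> H is affine, injective and maps
    an open subset of R^3 onto the whole set, so it serves as a global chart.
    It is smooth because it is affine, and its inverse is continuous because
    the H^4 norm dominates the L^2 norm, in which 1, cos theta, sin theta and
    cos zeta are orthogonal. *)

(** * The Fejer kernel and its averages over equally spaced nodes *)

Section Fejer.
Variable R : realType.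
Implicit Types (x t A B : R) (n m N : nat).

Definition dircos n t : R := \sum_(k < n) cos (k%:R * t).
Definition dirsin n t : R := \sum_(k < n) sin (k%:R * t).
(** The squared modulus of the Dirichlet sum of the e^(ikt), k < n, over n. *)
Definition fejer n t : R := n%:R^-1 * (dircos n t ^+ 2 + dirsin n t ^+ 2).

Lemma fejer_ge0 n t : 0 <= fejer n t.
Proof. by rewrite mulr_ge0 ?invr_ge0 ?ler0n// addr_ge0 ?sqr_ge0. Qed.

(** Real and imaginary parts of (1 - e^(it)) (1 + ... + e^(i(n-1)t)) =
    1 - e^(int). *)
Lemma dirichlet_telescope n t :
  (1 - cos t) * dircos n t + sin t * dirsin n t = 1 - cos (n%:R * t) /\
  (1 - cos t) * dirsin n t - sin t * dircos n t = - sin (n%:R * t).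
Proof.
elim: n => [|n [IH1 IH2]].
  by rewrite /dircos /dirsin !big_ord0 mul0r cos0 sin0; split; ring.
rewrite /dircos /dirsin !big_ord_recr/= -/(dircos n t) -/(dirsin n t).
have -> : n.+1%:R * t = n%:R * t + t by rewrite -natr1; ring.
rewrite cosD sinD.
split; [move: IH1 => /eqP|move: IH2 => /eqP]; rewrite -subr_eq0 => /eqP IH;
  apply/eqP; rewrite -subr_eq0; apply/eqP; rewrite -[RHS]IH; ring.
Qed.

(** Taking squared moduli in the telescoped sum, the product equals
    (1 - cos (n t)) / n.  This replaces an estimate of the kernel away
    from 0. *)
Lemma fejer_tail n t : (0 < n)%N -> fejer n t * (1 - cos t) <= 2 / n%:R.
Proof.
move=> n0; have nR : 0 < n%:R :> R by rewrite ltr0n.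
have [E1 E2] := dirichlet_telescope n t.
have ct := cos2Dsin2 t; have cn := cos2Dsin2 (n%:R * t).
have H : (dircos n t ^+ 2 + dirsin n t ^+ 2) * (1 - cos t) = 1 - cos (n%:R * t).
  set C := dircos n t in E1 E2 *; set S := dirsin n t in E1 E2 *.
  set c := cos t in E1 E2 ct *; set s := sin t in E1 E2 ct *.
  have : (C ^+ 2 + S ^+ 2) * ((1 - c) ^+ 2 + s ^+ 2) =
     (1 - cos (n%:R * t)) ^+ 2 + sin (n%:R * t) ^+ 2.
    by rewrite -(sqrrN (sin (n%:R * t))) -E2 -E1; ring.
  have -> : (1 - c) ^+ 2 + s ^+ 2 = 2 * (1 - c).
    by move: ct; rewrite !expr2 => ct; lra.
  have -> : (1 - cos (n%:R * t)) ^+ 2 + sin (n%:R * t) ^+ 2 =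
     2 * (1 - cos (n%:R * t)) by move: cn; rewrite !expr2 => cn; lra.
  by move=> E; lra.
rewrite /fejer -mulrA H mulrC ler_pM2r ?invr_gt0//.
by have := cos_geN1 (n%:R * t); lra.
Qed.

(** Multiplying by 2 sin (B / 2) makes the sum telescope. *)
Lemma sum_cos_arith N A B :
  (\sum_(i < N) cos (A - i%:R * B)) * (2 * sin (B / 2)) =
  sin (A + B / 2) - sin (A - N%:R * B + B / 2).
Proof.
elim: N => [|N IH]; first by rewrite big_ord0 !mul0r subr0 subrr.
rewrite big_ord_recr/= mulrDl IH.
have -> : A - N.+1%:R * B + B / 2 = (A - N%:R * B) - B / 2.
  by rewrite -natr1; field.
by rewrite !(sinD (A - N%:R * B)) sinN cosN; ring.
Qed.

Lemma cos_nat2pi n x : cos (x + n%:R * (2 * pi)) = cos x.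
Proof.
by rewrite mulr_natl mulr_natl; apply: periodicn; exact: cosD2pi.
Qed.
Lemma sin_nat2pi n x : sin (x + n%:R * (2 * pi)) = sin x.
Proof.
by rewrite mulr_natl mulr_natl; apply: periodicn; exact: sinD2pi.
Qed.

Definition node N i : R := i%:R * (2 * pi / N%:R).

Lemma sum_cos_node N m x : (0 < m < N)%N ->
  \sum_(i < N) cos (m%:R * (x - node N i)) = 0.
Proof.
move=> /andP[m0 mN]; have N1 : (0 < N)%N by rewrite (leq_trans _ mN).
have N0 : 0 < N%:R :> R by rewrite ltr0n.
pose B : R := m%:R * (2 * pi / N%:R).
have := sum_cos_arith N (m%:R * x) B.
have -> : m%:R * x - N%:R * B + B / 2 = m%:R * x + B / 2 - m%:R * (2 * pi).
  by rewrite /B; field; rewrite gt_eqF.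
rewrite -(sin_nat2pi m (_ - _)) subrK subrr => /eqP.
rewrite mulf_eq0 mulf_eq0 (_ : (2 == 0 :> R) = false) /=; last by lra.
rewrite (_ : sin (B / 2) == 0 = false) ?orbF; last first.
  apply/negbTE; rewrite gt_eqF// sin_gt0_pi//.
  have -> : B / 2 = pi * (m%:R / N%:R) by rewrite /B; field; rewrite gt_eqF.
  rewrite mulr_gt0 ?pi_gt0 ?divr_gt0 ?ltr0n//=.
  by rewrite gtr_pMr ?pi_gt0// ltr_pdivrMr// mul1r ltr_nat.
by move/eqP => E; rewrite -[RHS]E; apply: eq_bigr => i _; rewrite /B /node;
  congr cos; ring.
Qed.

Lemma sum_coscos_node N (k l : 'I_N) x :
  \sum_(i < N) (cos (k%:R * (x - node N i)) * cos (l%:R * (x - node N i)) +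
                sin (k%:R * (x - node N i)) * sin (l%:R * (x - node N i))) =
  N%:R * (k == l)%:R.
Proof.
wlog kl : k l / (k <= l)%N.
  move=> H; have [kl|/ltnW lk] := leqP k l; first exact: H.
  by rewrite eq_sym -(H l k lk); apply: eq_bigr => i _; ring.
have [->|/eqP nkl] := eqVneq k l.
  under eq_bigr do rewrite -!expr2 cos2Dsin2.
  by rewrite sumr_const card_ord mulr1.
rewrite mulr0 -[RHS](@sum_cos_node N (l - k)%N x).
  by apply: eq_bigr => i _; rewrite natrB// mulrBl cosB; ring.
rewrite subn_gt0 ltn_neqAle kl andbT (leq_ltn_trans (leq_subr _ _) (ltn_ord l)) andbT.
by apply/eqP => /val_inj.
Qed.

(** The kernel only contains frequencies below N in absolute value, and those
    other than 0 average out over N equally spaced nodes. *)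
Lemma sum_fejer_node N x : (0 < N)%N -> \sum_(i < N) fejer N (x - node N i) = N%:R.
Proof.
move=> N0; have NR : N%:R != 0 :> R by rewrite pnatr_eq0 -lt0n.
rewrite /fejer -mulr_sumr.
under eq_bigr do rewrite /dircos /dirsin !expr2 !big_distrlr/= -big_split/=.
under eq_bigr do under eq_bigr do rewrite -big_split/=.
rewrite exchange_big/=; under eq_bigr do rewrite exchange_big/=.
under eq_bigr do under eq_bigr do rewrite sum_coscos_node.
rewrite (eq_bigr (fun=> N%:R));
  first by rewrite sumr_const card_ord -(mulr_natr N%:R); field.
move=> k _; rewrite (bigD1 k)//= eqxx mulr1 big1 ?addr0// => l lk.
by rewrite eq_sym (negbTE lk) mulr0.
Qed.

(** Phase shifts in the monomials cover both cosines and sines, and make the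
    class stable under translation and differentiation. *)
Inductive trig1 : (R -> R) -> Prop :=
| trig1_0 : trig1 (fun=> 0)
| trig1_S c (j : nat) s f : trig1 f -> trig1 (fun x => c * cos (j%:R * x + s) + f x).

Lemma trig1D f g : trig1 f -> trig1 g -> trig1 (fun x => f x + g x).
Proof.
move=> tf tg; elim: tf => [|c j s {}f _ IH].
  by rewrite (_ : (fun _ => _) = g)//; apply/funext => x; rewrite add0r.
rewrite (_ : (fun _ => _) = fun x => c * cos (j%:R * x + s) + (f x + g x));
  first exact: trig1_S.
by apply/funext => x; rewrite addrA.
Qed.

Lemma trig1_sum n (f : 'I_n -> R -> R) : (forall i, trig1 (f i)) ->
  trig1 (fun x => \sum_(i < n) f i x).
Proof.
elim: n f => [|n IH] f tf.
  by rewrite (_ : (fun _ => _) = fun=> 0); [exact: trig1_0|apply/funext => x;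
    rewrite big_ord0].
rewrite (_ : (fun _ => _) = fun x =>
  (\sum_(i < n) f (widen_ord (leqnSn n) i) x) + f ord_max x).
  by apply: trig1D => //; apply: IH.
by apply/funext => x; rewrite big_ord_recr.
Qed.

Lemma trig1_mon c j s : trig1 (fun x => c * cos (j%:R * x + s)).
Proof.
by rewrite (_ : (fun _ => _) = fun x => c * cos (j%:R * x + s) + 0);
  [exact/trig1_S/trig1_0|apply/funext => x; rewrite addr0].
Qed.

Lemma trig1Z a f : trig1 f -> trig1 (fun x => a * f x).
Proof.
elim=> [|c j s {}f _ IH].
  by rewrite (_ : (fun _ => _) = fun=> 0); [exact: trig1_0|apply/funext => x;
    rewrite mulr0].
rewrite (_ : (fun _ => _) = fun x => (a * c) * cos (j%:R * x + s) + a * f x);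
  first exact: trig1_S.
by apply/funext => x; rewrite mulrDr mulrA.
Qed.

Lemma trig1_fejer n y : trig1 (fun x => fejer n (x - y)).
Proof.
rewrite /fejer; apply: trig1Z.
rewrite (_ : (fun _ => _) = fun x =>
  \sum_(k < n) \sum_(l < n) cos ((k%:R - l%:R) * (x - y))).
  apply: trig1_sum => k; apply: trig1_sum => l.
  have [kl|/ltnW lk] := leqP k l.
    rewrite (_ : (fun _ => _) = fun x =>
      1 * cos ((l - k)%N%:R * x + - ((l%:R - k%:R) * y))).
      exact: trig1_mon.
    by apply/funext => x; rewrite mul1r natrB// -cosN; congr cos; ring.
  rewrite (_ : (fun _ => _) = fun x =>
    1 * cos ((k - l)%N%:R * x + - ((k%:R - l%:R) * y))).
    exact: trig1_mon.
  by apply/funext => x; rewrite mul1r natrB//; congr cos; ring.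
apply/funext => x; rewrite /dircos /dirsin !expr2 !big_distrlr/= -big_split/=.
apply: eq_bigr => k _; rewrite -big_split/=; apply: eq_bigr => l _.
by rewrite mulrBl cosB.
Qed.

Definition trigmon (j k : nat) (s t : R) : R * R -> R :=
  fun z => cos (j%:R * z.1 + s) * cos (k%:R * z.2 + t).

Inductive trigpoly : (R * R -> R) -> Prop :=
| trigpoly_0 : trigpoly (fun=> 0)
| trigpoly_S c j k s t f : trigpoly f ->
  trigpoly (fun z => c * trigmon j k s t z + f z).

Lemma trigpolyD f g : trigpoly f -> trigpoly g -> trigpoly (fun z => f z + g z).
Proof.
move=> tf tg; elim: tf => [|c j k s t {}f _ IH].
  by rewrite (_ : (fun _ => _) = g)//; apply/funext => x; rewrite add0r.
rewrite (_ : (fun _ => _) = fun z => c * trigmon j k s t z + (f z + g z));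
  first exact: trigpoly_S.
by apply/funext => x; rewrite addrA.
Qed.

Lemma trigpoly_sum n (f : 'I_n -> R * R -> R) : (forall i, trigpoly (f i)) ->
  trigpoly (fun z => \sum_(i < n) f i z).
Proof.
elim: n f => [|n IH] f tf.
  by rewrite (_ : (fun _ => _) = fun=> 0); [exact: trigpoly_0|apply/funext => x;
    rewrite big_ord0].
rewrite (_ : (fun _ => _) = fun z =>
  (\sum_(i < n) f (widen_ord (leqnSn n) i) z) + f ord_max z).
  by apply: trigpolyD => //; apply: IH.
by apply/funext => x; rewrite big_ord_recr.
Qed.

Lemma trigpolyZ a f : trigpoly f -> trigpoly (fun z => a * f z).
Proof.
elim=> [|c j k s t {}f _ IH].
  by rewrite (_ : (fun _ => _) = fun=> 0); [exact: trigpoly_0|apply/funext => x;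
    rewrite mulr0].
rewrite (_ : (fun _ => _) = fun z => (a * c) * trigmon j k s t z + a * f z);
  first exact: trigpoly_S.
by apply/funext => x; rewrite mulrDr mulrA.
Qed.

Lemma trigpoly_tensor f g : trig1 f -> trig1 g -> trigpoly (fun z => f z.1 * g z.2).
Proof.
move=> tf tg; elim: tf => [|c j s {}f _ IH].
  by rewrite (_ : (fun _ => _) = fun=> 0); [exact: trigpoly_0|apply/funext => x;
    rewrite mul0r].
rewrite (_ : (fun _ => _) = fun z =>
  cos (j%:R * z.1 + s) * (c * g z.2) + f z.1 * g z.2); last first.
  by apply/funext => x; ring.
apply: trigpolyD => // {IH}; elim: tg => [|d k t {}g _ IH].
  by rewrite (_ : (fun _ => _) = fun=> 0); [exact: trigpoly_0|apply/funext => x;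
    rewrite !mulr0].
rewrite (_ : (fun _ => _) = fun z =>
  (c * d) * trigmon j k s t z + cos (j%:R * z.1 + s) * (c * g z.2)).
  exact: trigpoly_S.
by apply/funext => z; rewrite /trigmon; ring.
Qed.

End Fejer.

(** * Uniform density of trigonometric polynomials *)

Section Density.
Variable R : realType.
Implicit Types (h : R * R -> R).

(** Differences of points of the cell lie in [-2 pi, 2 pi]; there cos x = 1
    only at multiples of the period. *)
Lemma cos_eq1 (x : R) : - (2 * pi) <= x <= 2 * pi -> cos x = 1 ->
  [\/ x = 0, x = 2 * pi | x = - (2 * pi)].
Proof.
have p0 := pi_gt0 R.
wlog x0 : x / 0 <= x => [H|/andP[_ x2] c1].
  have [x0|x0] := leP 0 x; first exact: H.
  move=> /andP[xa xb] cx.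
  have [] := H (- x) _ _ _; rewrite ?cosN//; try (by move=> E; (constructor 1;
    lra) || (constructor 2; lra) || (constructor 3; lra)).
    lra.
  by apply/andP; lra.
have [xpi|/ltW pix] := leP x pi.
  constructor 1; apply: cos_inj; rewrite ?in_itv/= ?x0 ?xpi ?lexx ?pi_ge0//.
  by rewrite cos0.
constructor 2; have : 2 * pi - x = 0; last by move=> E; lra.
apply: cos_inj; rewrite ?in_itv/= ?lexx ?pi_ge0//; first by apply/andP; lra.
rewrite cos0 -[RHS]c1 -[RHS]cosN addrC mulr_natl.
exact: cosD2pi.
Qed.

Lemma compact_cell : compact (cell R : set (R * R)).
Proof. by apply: compact_setX; exact: segment_compact. Qed.

Lemma periodic2_congr h (a b c d : R) : periodic2 h ->
  - (2 * pi) <= a - b <= 2 * pi -> cos (a - b) = 1 ->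
  - (2 * pi) <= c - d <= 2 * pi -> cos (c - d) = 1 -> h (a, c) = h (b, d).
Proof.
move=> ph ab cab cd ccd.
have -> : h (a, c) = h (b, c).
  have [E|E|E] := cos_eq1 ab cab.
  - by congr (h (_, _)); lra.
  - by rewrite -(ph b c).1; congr (h (_, _)); lra.
  - by rewrite -(ph a c).1; congr (h (_, _)); lra.
have [E|E|E] := cos_eq1 cd ccd.
- by congr (h (_, _)); lra.
- by rewrite -(ph b d).2; congr (h (_, _)); lra.
- by rewrite -(ph b c).2; congr (h (_, _)); lra.
Qed.

Lemma cellP (z : R * R) : cell R z <-> 0 <= z.1 <= 2 * pi /\ 0 <= z.2 <= 2 * pi.
Proof. by case: z => x y; rewrite /cell /=; split=> -[]/=; rewrite ?in_itv/= => A B;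
  split; rewrite ?in_itv. Qed.

Lemma continuous_cosB1 : continuous (fun p : (R * R) * (R * R) =>
  cos (p.1.1 - p.2.1) : R).
Proof.
move=> p; apply: (@continuous_comp _ _ _ (fun p : (R * R) * (R * R) =>
  p.1.1 - p.2.1) (@cos R) p); last exact: continuous_cos.
apply: cvgB.
  exact: (@continuous_comp _ _ _ (fst : (R * R) * (R * R) ->
    R * R) fst p cvg_fst cvg_fst).
exact: (@continuous_comp _ _ _ (snd : (R * R) * (R * R) ->
  R * R) fst p cvg_snd cvg_fst).
Qed.
Lemma continuous_cosB2 : continuous (fun p : (R * R) * (R * R) =>
  cos (p.1.2 - p.2.2) : R).
Proof.
move=> p; apply: (@continuous_comp _ _ _ (fun p : (R * R) * (R * R) =>
  p.1.2 - p.2.2) (@cos R) p); last exact: continuous_cos.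
apply: cvgB.
  exact: (@continuous_comp _ _ _ (fst : (R * R) * (R * R) ->
    R * R) snd p cvg_fst cvg_snd).
exact: (@continuous_comp _ _ _ (snd : (R * R) * (R * R) ->
  R * R) snd p cvg_snd cvg_snd).
Qed.

(** A modulus of continuity expressed by a trigonometric polynomial, as in
    Korovkin's theorem: where h varies by at least e the polynomial
    2 - cos - cos is bounded below, because it vanishes only between points
    that are equal modulo the periods. *)
Lemma continuity_modulus h e : continuous h -> periodic2 h -> 0 < e ->
  exists2 C : R, 0 <= C &
  forall z w, cell R z -> cell R w ->
    `|h z - h w| <= e + C * ((1 - cos (z.1 - w.1)) + (1 - cos (z.2 - w.2))).
Proof.
move=> ch ph e0.
pose d (p : (R * R) * (R * R)) : R := `|h p.1 - h p.2|.
pose q (p : (R * R) * (R * R)) : R := (1 - cos (p.1.1 - p.2.1)) + (1 - cos (p.1.2 -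
  p.2.2)).
have q0 p : 0 <= q p.
  by have := cos_le1 (p.1.1 - p.2.1); have := cos_le1 (p.1.2 - p.2.2); rewrite /q; lra.
have cd : continuous d.
  move=> p; apply: (@continuous_comp _ _ _ (fun p => h p.1 - h p.2) Num.norm);
    last exact: norm_continuous.
  by apply: continuousB; (apply: continuous_comp; last exact: ch);
    [exact: cvg_fst|exact: cvg_snd].
have cq : continuous q.
  move=> p; rewrite /q; apply: cvgD; apply: cvgB; try exact: cvg_cst.
    exact: continuous_cosB1.
  exact: continuous_cosB2.
(* The compact set of pairs of points between which h varies by at least e. *)
pose K := (cell R `*` cell R : set ((R * R) * (R * R))) `&` [set p | e <= d p].
have cK : compact K.
  apply: compact_closedI; first by apply: compact_setX; exact: compact_cell.
  exact: (closed_comp (fun p _ => cd p) (@closed_ge _ e)).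
have [K0|/set0P/negP/negPn/eqP K0] := pselect (K !=set0); last first.
  exists 0 => // z w cz cw; rewrite mul0r addr0 leNgt; apply/negP => /ltW H.
  by have : K (z, w) by []; rewrite K0.
have [a Ka amax] := compact_EVT_max K0 cK (continuous_subspaceT cd).
have [b Kb bmin] := compact_EVT_min K0 cK (continuous_subspaceT cq).
have qb : 0 < q b.
  rewrite lt_neqAle q0 andbT eq_sym; apply/eqP => qb.
  move: Kb; rewrite inE => -[[/cellP[b1 b2] /cellP[b3 b4]]] /=.
  rewrite leNgt => /negP; apply; suff -> : d b = 0 by [].
  have c1 := cos_le1 (b.1.1 - b.2.1); have c2 := cos_le1 (b.1.2 - b.2.2).
  rewrite /d; apply/eqP; rewrite normr_eq0 subr_eq0; apply/eqP.
  move: b1 b2 b3 b4 qb c1 c2 {bmin}; rewrite /q; case: b => -[x y] [u v]/=.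
  move=> /andP[? ?] /andP[? ?] /andP[? ?] /andP[? ?] ? ? ?.
  by apply: (periodic2_congr ph); try (apply/andP); lra.
have Ka' : K a by rewrite inE in Ka.
have da : 0 <= d a by rewrite (le_trans (ltW e0))//; case: Ka'.
exists (d a / q b); first by rewrite divr_ge0// ltW.
move=> z w cz cw; have [H|/ltW H] := leP `|h z - h w| e.
  apply: (le_trans H); rewrite lerDl mulr_ge0// ?divr_ge0 ?(ltW qb)//.
have Kzw : (z, w) \in K by rewrite inE.
apply: (@le_trans _ _ (d a)); first exact: (amax _ Kzw).
apply: (@le_trans _ _ (d a / q b * q (z, w))); last by rewrite lerDr ltW.
rewrite -mulrA ler_peMr// mulrC ler_pdivlMr// mul1r.
exact: (bmin _ Kzw).
Qed.

Lemma node_cell N (i : 'I_N) : 0 <= node R N i <= 2 * pi.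
Proof.
have N0 : (0 < N)%N by case: i => i; apply: leq_trans.
have p0 := pi_gt0 R.
rewrite /node mulr_ge0 ?ler0n ?divr_ge0 ?mulr_ge0 ?(ltW p0) ?ler0n//=.
rewrite mulrCA ger_pMr ?mulr_gt0// ler_pdivrMr ?ltr0n// mul1r ler_nat.
by case: i => i /= /ltnW.
Qed.

(** T is the average of the values of h at the N^2 nodes, weighted by translates
    of the Fejer kernel.  The weights have mean 1, so the error is the average of
    |h z - h w|, which [continuity_modulus] and [fejer_tail] bound by
    e / 2 + 4 C / N. *)
Lemma trig_dense h e : continuous h -> periodic2 h -> 0 < e ->
  exists2 T, trigpoly T & forall z, cell R z -> `|h z - T z| <= e.
Proof.
move=> ch ph e0; have e2 : 0 < e / 2 by rewrite divr_gt0.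
have [C C0 hC] := continuity_modulus ch ph e2.
(* Large enough for the contribution 4 C / N of the tails to be below e / 2. *)
pose N := (Num.bound (8 * C / e)).+1.
have NR : 0 < N%:R :> R by rewrite ltr0n.
have NC : 4 * C / N%:R <= e / 2.
  rewrite ler_pdivrMr//; have : 8 * C / e <= N%:R.
    rewrite ltW// (lt_le_trans (archi_boundP _))//.
      by rewrite divr_ge0 ?mulr_ge0// ltW.
    by rewrite ler_nat.
  by rewrite ler_pdivrMr//; lra.
have [F [tF sF F0 FN]] : exists F : R -> 'I_N -> R, [/\ forall i, trig1 (F ^~ i),
    forall x, \sum_(i < N) F x i = N%:R, forall x i, 0 <= F x i &
    forall x i, F x i * (1 - cos (x - node R N i)) <= 2 / N%:R].
  exists (fun x i => fejer N (x - node R N i)); split=> *.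
  - exact: trig1_fejer.
  - exact: sum_fejer_node.
  - exact: fejer_ge0.
  - exact: fejer_tail.
pose T := fun z : R * R => \sum_(i < N) \sum_(j < N)
   (N%:R^-2 * h (node R N i, node R N j)) * (F z.1 i * F z.2 j).
exists T.
  apply: trigpoly_sum => i; apply: trigpoly_sum => j; apply: trigpolyZ.
  by apply: (@trigpoly_tensor _ (F ^~ i) (F ^~ j)).
move=> z cz.
have sFF : \sum_(i < N) \sum_(j < N) F z.1 i * F z.2 j = N%:R ^+ 2.
  by rewrite -big_distrlr/= !sF.
have hT : h z - T z = \sum_(i < N) \sum_(j < N)
   (N%:R^-2 * (h z - h (node R N i, node R N j))) * (F z.1 i * F z.2 j).
  have hz : h z = N%:R^-2 * (\sum_(i < N) \sum_(j < N) F z.1 i * F z.2 j) * h z.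
    by rewrite sFF mulVf ?mul1r// expf_neq0// gt_eqF.
  rewrite {1}hz /T mulr_sumr mulr_suml -sumrB; apply: eq_bigr => i _.
  rewrite mulr_sumr mulr_suml -sumrB; apply: eq_bigr => j _.
  set V := N%:R ^- 2; ring.
rewrite {}hT; have N20 : 0 <= N%:R^-2 :> R by rewrite invr_ge0 exprn_ge0// ltW.
have -> : e = N%:R^-2 * (e / 2 * N%:R ^+ 2 + C * (2 / N%:R * N%:R ^+ 2 + 2 / N%:R *
  N%:R ^+ 2))
     + (e / 2 - 4 * C / N%:R).
  by field; rewrite gt_eqF.
rewrite -[leLHS]addr0 lerD ?subr_ge0//.
apply: (@le_trans _ _ (N%:R^-2 * (\sum_(i < N) \sum_(j < N) (e / 2 * (F z.1 i * F z.2
  j) +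
   C * (2 / N%:R * F z.2 j + 2 / N%:R * F z.1 i))))).
  rewrite mulr_sumr; apply: (le_trans (ler_norm_sum _ _ _)); apply: ler_sum => i _.
  rewrite mulr_sumr; apply: (le_trans (ler_norm_sum _ _ _)); apply: ler_sum => j _.
  rewrite normrM normrM (ger0_norm N20) (ger0_norm (mulr_ge0 (F0 _ _) (F0 _ _)))
    -[leLHS]mulrA.
  apply: ler_wpM2l => //.
  have ci : cell R (node R N i, node R N j) by apply/cellP; split; exact: node_cell.
  apply: le_trans (ler_wpM2r _ (hC _ _ cz ci)) _; first by rewrite mulr_ge0.
  rewrite /= mulrDl lerD2l -[leLHS]mulrA ler_wpM2l// [leLHS]mulrDl lerD//.
    rewrite mulrA [_ * F z.1 i]mulrC ler_wpM2r//; exact: FN.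
  rewrite mulrCA [_ * F z.2 j]mulrC [leRHS]mulrC ler_wpM2l//; exact: FN.
rewrite ler_wpM2l//.
rewrite (eq_bigr (fun i => (e / 2 * N%:R) * F z.1 i +
    (C * (2 / N%:R * N%:R) + (C * (2 / N%:R) * N%:R) * F z.1 i))); last first.
  move=> i _; rewrite big_split/= -mulr_sumr -mulr_sumr -mulr_sumr big_split/=
    -mulr_sumr.
  by rewrite !sF sumr_const card_ord -mulr_natr; ring.
rewrite big_split/= -mulr_sumr big_split/= -mulr_sumr sF sumr_const card_ord
  -mulr_sumr sF.
rewrite -(mulr_natr (2 / N%:R * N%:R)) le_eqVlt; apply/orP; left; apply/eqP.
by ring.
Qed.

End Density.

(** * Classical calculus of test functions *)

Section TestFunctions.
Variable R : realType.
Implicit Types (f g : R * R -> R).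
Let e1 : R * R := (1, 0).
Let e2 : R * R := (0, 1).

Lemma is_derive_theta f (x y df : R) :
  is_derive (x, y) e1 f df <-> is_derive x 1 (fun u => f (u, y)) df.
Proof.
have E : (fun h : R => h^-1 *: ((f \o shift (x, y)) (h *: e1) - f (x, y))) =
         (fun h : R => h^-1 *: (((fun u => f (u, y)) \o shift x) (h *: 1) - f (x, y))).
  apply/funext => h /=; congr (_ *: (f _ - _)).
  by rewrite /e1; congr pair; rewrite /= ?scaler0 ?add0r.
split => -[d1 d2]; split.
- by move: d1; rewrite /derivable E.
- by move: d2; rewrite /derive E.
- by rewrite /derivable E.
- by rewrite /derive E.
Qed.

Lemma is_derive_zeta f (x y df : R) :
  is_derive (x, y) e2 f df <-> is_derive y 1 (fun u => f (x, u)) df.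
Proof.
have E : (fun h : R => h^-1 *: ((f \o shift (x, y)) (h *: e2) - f (x, y))) =
         (fun h : R => h^-1 *: (((fun u => f (x, u)) \o shift y) (h *: 1) - f (x, y))).
  apply/funext => h /=; congr (_ *: (f _ - _)).
  by rewrite /e2; congr pair; rewrite /= ?scaler0 ?add0r.
split => -[d1 d2]; split.
- by move: d1; rewrite /derivable E.
- by move: d2; rewrite /derive E.
- by rewrite /derivable E.
- by rewrite /derive E.
Qed.

Lemma trigmon_continuous j k s t : continuous (@trigmon R j k s t).
Proof.
move=> z; rewrite /trigmon; apply: cvgM.
  apply: (@continuous_comp _ _ _ (fun z : R * R => j%:R * z.1 + s) (@cos R) z);
    last exact: continuous_cos.
  by apply: cvgD; [apply: cvgM; [exact: cvg_cst|exact: cvg_fst]|exact: cvg_cst].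
apply: (@continuous_comp _ _ _ (fun z : R * R => k%:R * z.2 + t) (@cos R) z);
  last exact: continuous_cos.
by apply: cvgD; [apply: cvgM; [exact: cvg_cst|exact: cvg_snd]|exact: cvg_cst].
Qed.

Lemma trigmon_periodic j k s t : periodic2 (@trigmon R j k s t).
Proof.
move=> x y; rewrite /trigmon/=; split; congr (_ * _).
  by rewrite -[RHS](cos_nat2pi j); congr cos; ring.
by rewrite -[RHS](cos_nat2pi k); congr cos; ring.
Qed.

(** Differentiating a cosine shifts its phase by pi / 2, so that monomials are
    stable under differentiation. *)
Lemma is_derive_cos_affine (a s x : R) :
  is_derive x 1 (fun u => cos (a * u + s)) (a * cos (a * x + (s + pi / 2))).
Proof.
have H : is_derive x 1 (fun u : R => a * u + s) a.
  have -> : (fun u : R => a * u + s) = (fun u => a *: id u) + cst s by apply/funext.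
  apply: is_derive_eq; rewrite addr0; exact: mulr1.
have := @is_derive1_comp _ (@cos R) (fun u => a * u + s) x _ _ (is_derive_cos _) H.
by move=> D; rewrite addrA cosDpihalf mulrC.
Qed.

Lemma is_derive_trigmon_theta j k s t z :
  is_derive z e1 (@trigmon R j k s t) (j%:R * trigmon j k (s + pi / 2) t z).
Proof.
case: z => x y; apply/is_derive_theta; rewrite /trigmon/=.
have D := is_derive_cos_affine j%:R s x.
have -> : (fun u => cos (j%:R * u + s) * cos (k%:R * y + t)) =
  (cos (k%:R * y + t)) \*: (fun u => cos (j%:R * u + s)).
  by apply/funext => u; rewrite /= mulrC.
rewrite mulrA [_ * cos (k%:R * y + t)]mulrC.
exact: (@is_deriveZ _ _ _ _ (cos (k%:R * y + t)) _ _ _ D).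
Qed.

Lemma is_derive_trigmon_zeta j k s t z :
  is_derive z e2 (@trigmon R j k s t) (k%:R * trigmon j k s (t + pi / 2) z).
Proof.
case: z => x y; apply/is_derive_zeta; rewrite /trigmon/=.
have D := is_derive_cos_affine k%:R t y.
have -> : (fun u => cos (j%:R * x + s) * cos (k%:R * u + t)) =
  (cos (j%:R * x + s)) \*: (fun u => cos (k%:R * u + t)).
  by apply/funext => u.
by rewrite mulrCA; exact: (@is_deriveZ _ _ _ _ (cos (j%:R * x + s)) _ _ _ D).
Qed.

Lemma dtheta_trigmon j k s t :
  dtheta (@trigmon R j k s t) = (fun z => j%:R * trigmon j k (s + pi / 2) t z).
Proof. by apply/funext => z; have [_] := is_derive_trigmon_theta j k s t z. Qed.

Lemma dzeta_trigmon j k s t :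
  dzeta (@trigmon R j k s t) = (fun z => k%:R * trigmon j k s (t + pi / 2) z).
Proof. by apply/funext => z; have [_] := is_derive_trigmon_zeta j k s t z. Qed.

Lemma dthetaD f g : (forall z, derivable f z e1) -> (forall z, derivable g z e1) ->
  dtheta (fun z => f z + g z) = (fun z => dtheta f z + dtheta g z).
Proof. by move=> df dg; apply/funext => z; rewrite /dtheta -deriveD. Qed.
Lemma dzetaD f g : (forall z, derivable f z e2) -> (forall z, derivable g z e2) ->
  dzeta (fun z => f z + g z) = (fun z => dzeta f z + dzeta g z).
Proof. by move=> df dg; apply/funext => z; rewrite /dzeta -deriveD. Qed.
Lemma dthetaZ (c : R) f : (forall z, derivable f z e1) ->
  dtheta (fun z => c * f z) = (fun z => c * dtheta f z).
Proof. by move=> df; apply/funext => z; rewrite /dtheta -[RHS]deriveZ. Qed.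
Lemma dzetaZ (c : R) f : (forall z, derivable f z e2) ->
  dzeta (fun z => c * f z) = (fun z => c * dzeta f z).
Proof. by move=> df; apply/funext => z; rewrite /dzeta -[RHS]deriveZ. Qed.

Lemma dtheta_cst (c : R) : dtheta (fun _ : R * R => c) = (fun=> 0).
Proof. by apply/funext => z; rewrite /dtheta derive_cst. Qed.
Lemma dzeta_cst (c : R) : dzeta (fun _ : R * R => c) = (fun=> 0).
Proof. by apply/funext => z; rewrite /dzeta derive_cst. Qed.

Lemma Ck2D n f g : Ck2 n f -> Ck2 n g -> Ck2 n (fun z => f z + g z).
Proof.
elim: n f g => [|n IH] f g /=.
  by move=> [cf _] [cg _]; split=> // z; apply: cvgD; [exact: cf|exact: cg].
move=> [cf [f1 f2 f3 f4]] [cg [g1 g2 g3 g4]]; split.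
  by move=> z; apply: cvgD; [exact: cf|exact: cg].
split.
- by move=> z; apply: derivableD; [exact: f1|exact: g1].
- by move=> z; apply: derivableD; [exact: f2|exact: g2].
- by rewrite (dthetaD f1 g1); exact: IH.
- by rewrite (dzetaD f2 g2); exact: IH.
Qed.

Lemma Ck2Z n (c : R) f : Ck2 n f -> Ck2 n (fun z => c * f z).
Proof.
elim: n f => [|n IH] f /=.
  by move=> [cf _]; split=> // z; apply: cvgM; [exact: cvg_cst|exact: cf].
move=> [cf [f1 f2 f3 f4]]; split.
  by move=> z; apply: cvgM; [exact: cvg_cst|exact: cf].
split.
- by move=> z; apply: derivableZ; exact: f1.
- by move=> z; apply: derivableZ; exact: f2.
- by rewrite (dthetaZ c f1); exact: IH.
- by rewrite (dzetaZ c f2); exact: IH.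
Qed.

Lemma Ck2_trigmon n j k s t : Ck2 n (@trigmon R j k s t).
Proof.
elim: n s t => [|n IH] s t /=; split => //; try exact: trigmon_continuous.
split.
- by move=> z; have [] := is_derive_trigmon_theta j k s t z.
- by move=> z; have [] := is_derive_trigmon_zeta j k s t z.
- by rewrite dtheta_trigmon; apply: Ck2Z; exact: IH.
- by rewrite dzeta_trigmon; apply: Ck2Z; exact: IH.
Qed.

Lemma periodic2D f g : periodic2 f -> periodic2 g -> periodic2 (fun z => f z + g z).
Proof. by move=> pf pg x y; rewrite (pf x y).1 (pf x y).2 (pg x y).1 (pg x y).2. Qed.
Lemma periodic2M f g : periodic2 f -> periodic2 g -> periodic2 (fun z => f z * g z).
Proof. by move=> pf pg x y; rewrite (pf x y).1 (pf x y).2 (pg x y).1 (pg x y).2. Qed.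
Lemma periodic2Z (c : R) f : periodic2 f -> periodic2 (fun z => c * f z).
Proof. by move=> pf x y; rewrite (pf x y).1 (pf x y).2. Qed.

Lemma testD f g : test f -> test g -> test (fun z => f z + g z).
Proof. by move=> [pf cf] [pg cg]; split; [exact: periodic2D|move=> n; exact: Ck2D]. Qed.
Lemma testZ (c : R) f : test f -> test (fun z => c * f z).
Proof. by move=> [pf cf]; split; [exact: periodic2Z|move=> n; exact: Ck2Z]. Qed.
Lemma test_trigmon j k s t : test (@trigmon R j k s t).
Proof. by split; [exact: trigmon_periodic|move=> n; exact: Ck2_trigmon]. Qed.

Lemma test_cst (c : R) : test (fun=> c).
Proof.
have := testZ c (test_trigmon 0 0 0 0); congr test; apply/funext => z.
by rewrite /trigmon !mul0r !addr0 cos0 !mulr1.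
Qed.

Lemma trigpoly_test f : trigpoly f -> test f.
Proof.
elim=> [|c j k s t {}f _ IH]; first exact: test_cst.
exact: (testD (testZ c (test_trigmon j k s t)) IH).
Qed.

Lemma test_continuous f : test f -> continuous f.
Proof. by move=> [_ /(_ 0)] []. Qed.
Lemma test_derivable_theta f z : test f -> derivable f z e1.
Proof. by move=> [_ /(_ 1)] [_ []]. Qed.
Lemma test_derivable_zeta f z : test f -> derivable f z e2.
Proof. by move=> [_ /(_ 1)] [_ []]. Qed.

(** The difference quotients of a periodic function are periodic. *)
Lemma test_dtheta f : test f -> test (dtheta f).
Proof.
move=> [pf cf]; split; last by move=> n; have [_ []] := cf n.+1.
have E (a b : R) : (forall z, f (z + (a, b)) = f z) ->
  forall z, dtheta f (z + (a, b)) = dtheta f z.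
  move=> H z; rewrite /dtheta /derive.
  suff -> : (fun h : R => h^-1 *: ((f \o shift (z + (a, b))) (h *: e1) - f (z + (a,
    b)))) =
    (fun h : R => h^-1 *: ((f \o shift z) (h *: e1) - f z)) by [].
  by apply/funext => h /=; rewrite addrA !H.
move=> x y; split.
  have := E (2 * pi) 0 _ (x, y); rewrite /= (_ : (x, y) + (2 * pi, 0) = (x + 2 * pi,
    y)); last first.
    by congr pair; rewrite /= addr0.
  apply=> -[u v]; rewrite -[RHS](pf u v).1; congr f.
  by congr pair; rewrite /= addr0.
have := E 0 (2 * pi) _ (x, y); rewrite /= (_ : (x, y) + (0, 2 * pi) = (x,
  y + 2 * pi)); last first.
  by congr pair; rewrite /= addr0.
apply=> -[u v]; rewrite -[RHS](pf u v).2; congr f.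
by congr pair; rewrite /= addr0.
Qed.

Lemma test_dzeta f : test f -> test (dzeta f).
Proof.
move=> [pf cf]; split; last by move=> n; have [_ []] := cf n.+1.
have E (a b : R) : (forall z, f (z + (a, b)) = f z) ->
  forall z, dzeta f (z + (a, b)) = dzeta f z.
  move=> H z; rewrite /dzeta /derive.
  suff -> : (fun h : R => h^-1 *: ((f \o shift (z + (a, b))) (h *: e2) - f (z + (a,
    b)))) =
    (fun h : R => h^-1 *: ((f \o shift z) (h *: e2) - f z)) by [].
  by apply/funext => h /=; rewrite addrA !H.
move=> x y; split.
  have := E (2 * pi) 0 _ (x, y); rewrite /= (_ : (x, y) + (2 * pi, 0) = (x + 2 * pi,
    y)); last first.
    by congr pair; rewrite /= addr0.
  apply=> -[u v]; rewrite -[RHS](pf u v).1; congr f.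
  by congr pair; rewrite /= addr0.
have := E 0 (2 * pi) _ (x, y); rewrite /= (_ : (x, y) + (0, 2 * pi) = (x,
  y + 2 * pi)); last first.
  by congr pair; rewrite /= addr0.
apply=> -[u v]; rewrite -[RHS](pf u v).2; congr f.
by congr pair; rewrite /= addr0.
Qed.

Lemma test_iter_dzeta_dtheta i j f : test f ->
  test (iter i (@dtheta R) (iter j (@dzeta R) f)).
Proof.
move=> tf; have H : test (iter j (@dzeta R) f) by elim: j => [//|j IH];
  exact: test_dzeta.
by elim: i => [//|i IH]; exact: test_dtheta.
Qed.

Lemma test_iter_dtheta_dzeta i j f : test f ->
  test (iter j (@dzeta R) (iter i (@dtheta R) f)).
Proof.
move=> tf; have H : test (iter i (@dtheta R) f) by elim: i => [//|i IH];
  exact: test_dtheta.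
by elim: j => [//|j IH]; exact: test_dzeta.
Qed.

End TestFunctions.

(** * Integration over the period cell *)

Section Integral.
Variable R : realType.
Implicit Types (f g : R * R -> R).
Notation mu := (leb2 R).
Notation T2 := (measurableTypeR R * measurableTypeR R)%type.

Definition tintegrable f := mu.-integrable (cell R) (EFin \o f).

Lemma measurable_cell : measurable (cell R).
Proof. by apply: measurableX; exact: measurable_itv. Qed.
#[local] Hint Resolve measurable_cell : core.

Lemma leb2_cell : mu (cell R) = ((2 * pi) ^+ 2)%:E.
Proof.
have p0 : 0 < 2 * pi :> R by rewrite mulr_gt0// pi_gt0.
pose I : set (measurableTypeR R) := `[0, 2 * pi]%classic.
transitivity (lebesgue_measure I * lebesgue_measure I)%E.
  by apply: product_measure1E; exact: measurable_itv.
by rewrite /I lebesgue_measure_itv/= lte_fin p0 oppr0 adde0 -EFinM expr2.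
Qed.

Lemma trigmon_measurable j k s t : measurable_fun (cell R) (@trigmon R j k s t).
Proof.
apply: measurable_funS (@measurableT _ T2) _ _ => //.
apply: measurable_funM.
  apply: (@measurableT_comp _ _ _ _ _ _ (fun x : R => cos (j%:R * x + s))).
    apply: continuous_measurable_fun => x.
    apply: (@continuous_comp _ _ _ (fun x : R => j%:R * x + s) (@cos R) x);
      last exact: continuous_cos.
    by apply: cvgD; [apply: cvgM; [exact: cvg_cst|exact: cvg_id]|exact: cvg_cst].
  exact: measurable_fst.
apply: (@measurableT_comp _ _ _ _ _ _ (fun x : R => cos (k%:R * x + t))).
  apply: continuous_measurable_fun => x.
  apply: (@continuous_comp _ _ _ (fun x : R => k%:R * x + t) (@cos R) x);
    last exact: continuous_cos.
  by apply: cvgD; [apply: cvgM; [exact: cvg_cst|exact: cvg_id]|exact: cvg_cst].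
exact: measurable_snd.
Qed.

Lemma trigpoly_measurable f : trigpoly f -> measurable_fun (cell R) f.
Proof.
elim=> [|c j k s t {}f _ IH]; first exact: measurable_cst.
apply: measurable_funD => //; apply: measurable_funM; first exact: measurable_cst.
exact: trigmon_measurable.
Qed.

(** Uniform limits of trigonometric polynomials are limits of sums of products of
    measurable functions of one variable. *)
Lemma continuous_periodic_measurable f : continuous f -> periodic2 f ->
  measurable_fun (cell R) f.
Proof.
move=> cf pf.
have H n : exists T, trigpoly T /\ forall z, cell R z -> `|f z - T z| <= n.+1%:R^-1.
  by have [T tT Tf] := @trig_dense R f n.+1%:R^-1 cf pf ltac:(by rewrite invr_gt0);
    exists T.
pose T n := sval (cid (H n)).
have tT n : trigpoly (T n) by rewrite /T; case: cid => ? [].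
have fT n z : cell R z -> `|f z - T n z| <= n.+1%:R^-1.
  by rewrite /T; case: cid => ? [] /= _; apply.
apply: (@measurable_fun_cvg _ _ _ _ T) => [n|z cz]; first exact: trigpoly_measurable.
apply/cvgrPdist_le => e e0; near=> n.
rewrite (le_trans (fT n z cz))// ltW//.
near: n; exact: (near_infty_natSinv_lt (PosNum e0)).
Unshelve. all: by end_near. Qed.

Lemma continuous_cell_bounded f : continuous f ->
  exists2 M : R, 0 < M & forall z, cell R z -> `|f z| <= M.
Proof.
move=> cf.
have /ex_strict_bound_gt0[M M0 hM] : bounded_set (f @` (cell R : set (R * R))).
  apply: compact_bounded; apply: continuous_compact; last exact: compact_cell.
  exact: continuous_subspaceT.
by exists M => // z cz; rewrite ltW// hM//; exists z.
Qed.

Lemma tintegrable_bounded f M : measurable_fun (cell R) f -> (forall z, cell R z ->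
  `|f z| <= M) -> tintegrable f.
Proof.
move=> mf fM; apply: measurable_bounded_integrable => //.
  by rewrite leb2_cell ltry.
exists M; split; first exact: num_real.
by move=> x Mx z cz; exact: (le_trans (fM z cz) (ltW Mx)).
Qed.

Lemma tintegrable_continuous f : continuous f -> periodic2 f -> tintegrable f.
Proof.
move=> cf pf; have [M _ fM] := continuous_cell_bounded cf.
by apply: tintegrable_bounded fM; exact: continuous_periodic_measurable.
Qed.

Lemma tintegrable_measurable f : tintegrable f -> measurable_fun (cell R) f.
Proof. by move=> /measurable_int/measurable_EFinP. Qed.

Lemma tintegrableD f g : tintegrable f -> tintegrable g ->
  tintegrable (fun z => f z + g z).
Proof. by move=> fi gi; apply: (@integrableD _ _ _ mu _ measurable_cell (EFin \o f)
  (EFin \o g)). Qed.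
Lemma tintegrableZ (c : R) f : tintegrable f -> tintegrable (fun z => c * f z).
Proof. by move=> fi; apply: (@integrableZl _ _ _ mu _ measurable_cell c (EFin \o f)).
  Qed.
Lemma tintD f g : tintegrable f -> tintegrable g ->
  tint (fun z => f z + g z) = tint f + tint g.
Proof. by move=> fi gi; apply: RintegralD. Qed.
Lemma tintZ (c : R) f : tintegrable f -> tint (fun z => c * f z) = c * tint f.
Proof. by move=> fi; apply: RintegralZl. Qed.
Lemma tint_ge0 f : (forall z, cell R z -> 0 <= f z) -> 0 <= tint f.
Proof. exact: Rintegral_ge0. Qed.
Lemma le_tint f g : tintegrable f -> tintegrable g -> (forall z, cell R z ->
  f z <= g z) -> tint f <= tint g.
Proof. exact: le_Rintegral. Qed.
Lemma eq_tint f g : (forall z, cell R z -> f z = g z) -> tint f = tint g.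
Proof. by move=> fg; apply: eq_Rintegral => z; rewrite inE; exact: fg. Qed.
Lemma tint_cst (c : R) : tint (fun=> c) = c * (2 * pi) ^+ 2.
Proof. by rewrite /tint Rintegral_cst// leb2_cell. Qed.
Lemma le_tintegrable f g : measurable_fun (cell R) f -> tintegrable g ->
  (forall z, cell R z -> `|f z| <= g z) -> tintegrable f.
Proof.
move=> mf gi fg; apply: le_integrable gi => //; first exact/measurable_EFinP.
by move=> z cz /=; rewrite lee_fin (le_trans (fg z cz))// ler_norm.
Qed.

Lemma L2T_tintegrableM f g : L2T f -> L2T g -> tintegrable (fun z => f z * g z).
Proof.
move=> [mf f2] [mg g2]; apply: (@le_tintegrable _ (fun z => f z ^+ 2 + g z ^+ 2)).
- exact: measurable_funM.
- exact: tintegrableD.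
- move=> z _; rewrite ler_norml; have := sqr_ge0 (f z + g z);
  have := sqr_ge0 (f z - g z).
  have := sqr_ge0 (f z); have := sqr_ge0 (g z).
  by rewrite sqrrB sqrrD => *; apply/andP; lra.
Qed.

Lemma L2T_continuous f : continuous f -> periodic2 f -> L2T f.
Proof.
move=> cf pf; split; first exact: continuous_periodic_measurable.
apply: tintegrable_continuous; last exact: periodic2M.
by move=> z; apply: cvgM; exact: cf.
Qed.

Lemma L2TD f g : L2T f -> L2T g -> L2T (fun z => f z + g z).
Proof.
move=> f2 g2; split; first by apply: measurable_funD; [exact: f2.1|exact: g2.1].
have := tintegrableD (tintegrableD f2.2 g2.2) (tintegrableZ 2 (L2T_tintegrableM f2 g2)).
by congr (mu.-integrable _ _); apply/funext => z /=; congr EFin; ring.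
Qed.

Lemma L2TZ (c : R) f : L2T f -> L2T (fun z => c * f z).
Proof.
move=> f2; split; first by apply: measurable_funM; [exact: measurable_cst|exact: f2.1].
have := tintegrableZ (c ^+ 2) f2.2.
by congr (mu.-integrable _ _); apply/funext => z /=; congr EFin; ring.
Qed.

Lemma L2T_continuousM h f : continuous h -> periodic2 h -> L2T f ->
  L2T (fun z => h z * f z).
Proof.
move=> ch ph f2; have mhf : measurable_fun (cell R) (fun z => h z * f z).
  by apply: measurable_funM; [exact: continuous_periodic_measurable|exact: f2.1].
split => //; have [M M0 hM] := continuous_cell_bounded ch.
apply: (@le_tintegrable _ (fun z => M ^+ 2 * f z ^+ 2)).
- by apply: measurable_funM.
- exact: tintegrableZ f2.2.
- move=> z cz; rewrite ger0_norm ?sqr_ge0// exprMn ler_wpM2r ?sqr_ge0//.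
  by rewrite -(ger0_norm (sqr_ge0 (h z))) normrX ler_sqr ?nnegrE ?hM// ltW.
Qed.

Lemma L2T_tintegrable f : L2T f -> tintegrable f.
Proof.
move=> f2; have := L2T_tintegrableM f2 (L2T_continuous (@test_continuous _ _
  (@test_cst R 1)) (@test_cst R 1).1).
by congr tintegrable; apply/funext => z; rewrite mulr1.
Qed.

(** Cauchy-Schwarz, from the nonnegativity of the integral of (s f + t g)^2. *)
Lemma tint_CS f g : L2T f -> L2T g ->
  tint (fun z => f z * g z) ^+ 2 <= tint (fun z => f z ^+ 2) * tint (fun z => g z ^+ 2).
Proof.
move=> f2 g2; set a := tint (fun z => f z ^+ 2); set b := tint _; set c := tint _.
have H (s t : R) : 0 <= s ^+ 2 * a + 2 * s * t * b + t ^+ 2 * c.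
  have fg := L2T_tintegrableM f2 g2.
  rewrite -(tintZ (s ^+ 2) f2.2) -(tintZ (2 * s * t) fg) -(tintZ (t ^+ 2) g2.2).
  rewrite -(tintD (tintegrableZ _ f2.2) (tintegrableZ _ fg)).
  rewrite -(tintD (tintegrableD (tintegrableZ _ f2.2) (tintegrableZ _ fg))
    (tintegrableZ _ g2.2)).
  apply: tint_ge0 => z _; rewrite [leRHS](_ : _ = (s * f z + t * g z) ^+ 2)
    ?sqr_ge0//; ring.
have a0 : 0 <= a by apply: tint_ge0 => z _; exact: sqr_ge0.
have c0 : 0 <= c by apply: tint_ge0 => z _; exact: sqr_ge0.
have [cz|cp] := eqVneq c 0.
  have [->|bn] := eqVneq b 0; first by rewrite expr0n/= mulr_ge0.
  have := H 1 (- (a + 1) / (2 * b)).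
  have -> : 1 ^+ 2 * a + 2 * 1 * (- (a + 1) / (2 * b)) * b = -1 by field.
  by rewrite cz mulr0 addr0 ler0N1.
have cpos : 0 < c by rewrite lt_neqAle eq_sym cp.
have := H c (- b).
have -> : c ^+ 2 * a + 2 * c * - b * b + (- b) ^+ 2 * c = c * (a * c - b ^+ 2) by ring.
by rewrite pmulr_rge0// subr_ge0.
Qed.

End Integral.

(** * Fubini, integration by parts and orthogonality to monomials *)

Section Parts.
Variable R : realType.
Implicit Types (f g : R * R -> R).
Notation mu := (leb2 R).
Notation lm := (@lebesgue_measure R).
Let e1 : R * R := (1, 0).
Let e2 : R * R := (0, 1).
Let I : set (measurableTypeR R) := `[0, 2 * pi]%classic.

(** The fundamental theorem of calculus over one period. *)
Lemma integral_deriv0 (F G : R -> R) : continuous G ->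
  (forall x : R, is_derive x 1 F (G x)) ->
  F (2 * pi) = F 0 -> (\int[lm]_(x in I) (G x)%:E = 0)%E.
Proof.
move=> cG dF F0.
have p0 : 0 < 2 * pi :> R by rewrite mulr_gt0// pi_gt0.
have cF : continuous F.
  by move=> x; apply/differentiable_continuous/derivable1_diffP; case: (dF x).
rewrite (@continuous_FTC2 R G F 0 (2 * pi))//.
- by rewrite F0 subee.
- exact: continuous_subspaceT.
- split.
  + by move=> x _; case: (dF x).
  + by apply: cvg_at_right_filter; exact: cF.
  + by apply: cvg_at_left_filter; exact: cF.
- by move=> x _; rewrite derive1E; case: (dF x).
Qed.

(** Fubini: it is enough that the integrals along horizontal slices vanish. *)
Lemma tint_slice1 g : tintegrable g ->
  (forall y : R, (\int[lm]_(x in I) (g (x, y))%:E = 0)%E) -> tint g = 0.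
Proof.
move=> ig g0; rewrite /tint /Rintegral integral_mkcond.
have := (integrable_mkcond _ (@measurable_cell R)).1 ig => ig'.
rewrite -(integral21_prod_meas1 ig') integral0_eq// => y _.
rewrite /fubini_G; have [yI|yI] := boolP (y \in I).
  rewrite -[RHS](g0 y) [RHS]integral_mkcond; apply: eq_integral => x _.
  rewrite !patchE; congr (if _ then _ else _); apply/idP/idP; rewrite !inE.
    by case.
  by move=> xI; split => //; rewrite inE in yI.
rewrite integral0_eq// => x _; rewrite patchE ifF//.
by apply/negbTE; apply: contra yI; rewrite !inE => -[].
Qed.

Lemma tint_slice2 g : tintegrable g ->
  (forall x : R, (\int[lm]_(y in I) (g (x, y))%:E = 0)%E) -> tint g = 0.
Proof.
move=> ig g0; rewrite /tint /Rintegral integral_mkcond.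
have := (integrable_mkcond _ (@measurable_cell R)).1 ig => ig'.
rewrite -(integral12_prod_meas1 ig') integral0_eq// => x _.
rewrite /fubini_F; have [xI|xI] := boolP (x \in I).
  rewrite -[RHS](g0 x) [RHS]integral_mkcond; apply: eq_integral => y _.
  rewrite !patchE; congr (if _ then _ else _); apply/idP/idP; rewrite !inE.
    by case.
  by move=> yI; split => //; rewrite inE in xI.
rewrite integral0_eq// => y _; rewrite patchE ifF//.
by apply/negbTE; apply: contra xI; rewrite !inE => -[].
Qed.

Lemma continuous_slice1 g (y : R) : continuous g -> continuous (fun x => g (x, y)).
Proof.
move=> cg x; apply: (@continuous_comp _ _ _ (fun x => (x, y)) g x); last exact: cg.
exact: (@cvg_pair _ _ _ (nbhs x) (nbhs x) (nbhs y) _ _ _ id (cst y) (@cvg_id _ _)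
  (@cvg_cst _ _ _ _ _)).
Qed.
Lemma continuous_slice2 g (x : R) : continuous g -> continuous (fun y => g (x, y)).
Proof.
move=> cg y; apply: (@continuous_comp _ _ _ (fun y => (x, y)) g y); last exact: cg.
exact: (@cvg_pair _ _ _ (nbhs y) (nbhs x) (nbhs y) _ _ _ (cst x) id (@cvg_cst _ _ _ _
  _) (@cvg_id _ _)).
Qed.

Lemma tint_dtheta f g : periodic2 f -> continuous g -> periodic2 g ->
  (forall z, is_derive z e1 f (g z)) -> tint g = 0.
Proof.
move=> pf cg pg df; apply: tint_slice1; first exact: tintegrable_continuous.
move=> y; apply: (@integral_deriv0 (fun x => f (x, y))).
- exact: continuous_slice1.
- by move=> x; apply/is_derive_theta; exact: df.
- by rewrite -(pf 0 y).1 add0r.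
Qed.

Lemma tint_dzeta f g : periodic2 f -> continuous g -> periodic2 g ->
  (forall z, is_derive z e2 f (g z)) -> tint g = 0.
Proof.
move=> pf cg pg df; apply: tint_slice2; first exact: tintegrable_continuous.
move=> x; apply: (@integral_deriv0 (fun y => f (x, y))).
- exact: continuous_slice2.
- by move=> y; apply/is_derive_zeta; exact: df.
- by rewrite -(pf x 0).2 add0r.
Qed.

Lemma continuousM2 f g : continuous f -> continuous g ->
  continuous (fun z => f z * g z).
Proof. by move=> cf cg z; apply: cvgM; [exact: cf|exact: cg]. Qed.
Lemma continuousD2 f g : continuous f -> continuous g ->
  continuous (fun z => f z + g z).
Proof. by move=> cf cg z; apply: cvgD; [exact: cf|exact: cg]. Qed.
Lemma tintegrable_testM f g : test f -> test g -> tintegrable (fun z => f z * g z).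
Proof.
move=> tf tg; apply: tintegrable_continuous; first by apply: continuousM2;
  exact: test_continuous.
by apply: periodic2M; [exact: tf.1|exact: tg.1].
Qed.

Lemma parts_theta f g : test f -> test g ->
  tint (fun z => dtheta f z * g z) = - tint (fun z => f z * dtheta g z).
Proof.
move=> tf tg; have tdf := test_dtheta tf; have tdg := test_dtheta tg.
apply/eqP; rewrite -addr_eq0 -tintD;
  [|exact: tintegrable_testM|exact: tintegrable_testM].
apply/eqP; apply: (@tint_dtheta (fun z => f z * g z)).
- by apply: periodic2M; [exact: tf.1|exact: tg.1].
- by apply: continuousD2; apply: continuousM2; exact: test_continuous.
- by apply: periodic2D; apply: periodic2M;
  first [exact: tf.1|exact: tg.1|exact: tdf.1|exact: tdg.1].
- move=> z; have df := derivableP (test_derivable_theta (z := z) tf);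
  have dg := derivableP (test_derivable_theta (z := z) tg).
  have D := is_deriveM df dg.
  rewrite (_ : dtheta f z * g z + _ = f z *: dtheta g z + g z *: dtheta f z);
    first exact: D.
  by rewrite addrC [_ * g z]mulrC.
Qed.

Lemma parts_zeta f g : test f -> test g ->
  tint (fun z => dzeta f z * g z) = - tint (fun z => f z * dzeta g z).
Proof.
move=> tf tg; have tdf := test_dzeta tf; have tdg := test_dzeta tg.
apply/eqP; rewrite -addr_eq0 -tintD;
  [|exact: tintegrable_testM|exact: tintegrable_testM].
apply/eqP; apply: (@tint_dzeta (fun z => f z * g z)).
- by apply: periodic2M; [exact: tf.1|exact: tg.1].
- by apply: continuousD2; apply: continuousM2; exact: test_continuous.
- by apply: periodic2D; apply: periodic2M;
  first [exact: tf.1|exact: tg.1|exact: tdf.1|exact: tdg.1].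
- move=> z; have df := derivableP (test_derivable_zeta (z := z) tf);
  have dg := derivableP (test_derivable_zeta (z := z) tg).
  have D := is_deriveM df dg.
  rewrite (_ : dzeta f z * g z + _ = f z *: dzeta g z + g z *: dzeta f z);
    first exact: D.
  by rewrite addrC [_ * g z]mulrC.
Qed.

Lemma tint_norm_le f : tintegrable f -> `|tint f| <= tint (fun z => `|f z|).
Proof. exact: (le_normr_Rintegral (@measurable_cell R)). Qed.

Lemma tintegrable_norm f : tintegrable f -> tintegrable (fun z => `|f z|).
Proof.
move=> fi; apply: (le_integrable (@measurable_cell R) _ _ fi).
  by apply/measurable_EFinP; apply: (measurableT_comp (@normr_measurable _ setT));
    exact: tintegrable_measurable.
by move=> z _ /=; rewrite normr_id.
Qed.

Lemma orth_trigmon_trigpoly g T : L2T g -> trigpoly T ->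
  (forall j k s t, tint (fun z => g z * trigmon j k s t z) = 0) ->
  tint (fun z => g z * T z) = 0.
Proof.
move=> g2 tT H; elim: tT => [|c j k s t {}T tT IH].
  by rewrite (@eq_tint _ _ (fun=> 0)) ?tint_cst ?mul0r// => z _; rewrite mulr0.
have L2 f : test f -> L2T f by move=> tf; apply: L2T_continuous;
  [exact: test_continuous|exact: tf.1].
have i1 := L2T_tintegrableM g2 (L2 _ (test_trigmon j k s t)).
rewrite (@eq_tint _ _ (fun z => c * (g z * trigmon j k s t z) + g z * T z)); last first.
  by move=> z _; ring.
rewrite tintD ?IH ?tintZ ?H ?mulr0 ?addr0//; first exact: tintegrableZ.
exact: L2T_tintegrableM g2 (L2 _ (trigpoly_test tT)).
Qed.

(** One approximation T serves for all f at once. *)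
Lemma trig_approx_pairing h e : continuous h -> periodic2 h -> 0 < e ->
  exists T, [/\ trigpoly T, (forall z, cell R z -> `|h z - T z| <= e) &
   forall f, L2T f -> `|tint (fun z => f z * h z) - tint (fun z =>
     f z * T z)| <= e * tint (fun z => `|f z|)].
Proof.
move=> ch ph e0; have [T tT hT] := trig_dense ch ph e0; exists T; split => // f f2.
have tT' := trigpoly_test tT.
have i1 := L2T_tintegrableM f2 (L2T_continuous ch ph).
have i2 := L2T_tintegrableM f2 (L2T_continuous (test_continuous tT') tT'.1).
have i3 : tintegrable (fun z => f z * h z + -1 * (f z * T z)) by apply: tintegrableD
  => //; exact: tintegrableZ.
rewrite -[- tint _]mulN1r -tintZ// -tintD//; last exact: tintegrableZ.
apply: (le_trans (tint_norm_le i3)).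
have fi := tintegrable_norm (L2T_tintegrable f2).
rewrite -tintZ//; apply: le_tint; [exact: tintegrable_norm|exact: tintegrableZ|].
move=> z cz; rewrite (_ : _ + _ = (h z - T z) * f z); last by ring.
by rewrite normrM ler_wpM2r// hT.
Qed.

(** The form in which all limiting arguments below are concluded. *)
Lemma eq0_small (x K : R) : (forall e, 0 < e -> `|x| <= e * K) -> x = 0.
Proof.
move=> H; apply/eqP; rewrite -normr_le0 leNgt; apply/negP => x0.
have K0 : 0 < K.
  by have := H 1 ltr01; rewrite mul1r; exact: lt_le_trans.
have := H (`|x| / (2 * K)) ltac:(by rewrite divr_gt0// mulr_gt0).
have -> : `|x| / (2 * K) * K = `|x| / 2 by field; rewrite gt_eqF.
by move=> E; lra.
Qed.

(** Orthogonality to the monomials passes to trigonometric polynomials by linearity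
    and to continuous functions by uniform approximation. *)
Lemma orth_trigmon_continuous g h : L2T g ->
  (forall j k s t, tint (fun z => g z * trigmon j k s t z) = 0) ->
  continuous h -> periodic2 h -> tint (fun z => g z * h z) = 0.
Proof.
move=> g2 H ch ph; apply: (@eq0_small _ (tint (fun z => `|g z|))) => e e0.
have [T [tT _ /(_ g g2)]] := trig_approx_pairing ch ph e0.
by rewrite (orth_trigmon_trigpoly g2 tT H) subr0.
Qed.

(** Around a point where f does not vanish, f^2 is bounded below on a rectangle of
    positive measure contained in the cell. *)
Lemma continuous_sqr0 f : continuous f -> periodic2 f -> tint (fun z => f z ^+ 2) = 0 ->
  forall z, cell R z -> f z = 0.
Proof.
move=> cf pf f0 z /cellP[/andP[z1 z1'] /andP[z2 z2']]; apply/eqP/negPn/negP => fz.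
have p0 := pi_gt0 R.
pose c := `|f z| / 2; have c0 : 0 < c by rewrite divr_gt0// normr_gt0.
have [r /= r0 fr] : exists2 r, 0 < r & forall w, ball z r w -> `|f z - f w| < c.
  have /cvgrPdist_lt/(_ c c0) := cf z.
  by rewrite -nbhs_ballE => -[r r0 H]; exists r.
(* Truncated to ]0, 2 pi[, so that the rectangle stays in the cell even when z
   lies on its boundary. *)
pose J (x : R) : set (measurableTypeR R) := `]Num.max (x - r) 0,
  Num.min (x + r) (2 * pi)[%classic.
have mJ x : measurable (J x) by exact: measurable_itv.
pose l (x : R) := Num.min (x + r) (2 * pi) - Num.max (x - r) 0.
have l0 x : 0 <= x <= 2 * pi -> 0 < l x.
  by move=> /andP[x0 x1]; rewrite /l subr_gt0 lt_min !gt_max; lra.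
have lJ x : 0 <= x <= 2 * pi -> lm (J x) = (l x)%:E.
  by move=> /l0; rewrite /l subr_gt0 => H;
    rewrite /J lebesgue_measure_itv/= lte_fin H EFinB.
pose D := J z.1 `*` J z.2.
have mD : measurable D by exact: measurableX.
have DJ w : D w -> [/\ cell R w & ball z r w].
  move=> [] /=; rewrite /J /= !in_itv/= !lt_min !gt_max.
  move=> /andP[/andP[a1 a2] /andP[a3 a4]] /andP[/andP[b1 b2] /andP[b3 b4]]; split.
    by apply/cellP; split; apply/andP; split; exact: ltW.
  by split; rewrite -ball_normE /= ltr_norml; apply/andP; lra.
have muD : mu D = (l z.1 * l z.2)%:E.
  transitivity (lm (J z.1) * lm (J z.2))%E; first by apply: product_measure1E.
  by rewrite !lJ ?EFinM//; apply/andP.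
have iD : tintegrable (\1_D : R * R -> R).
  apply: (@tintegrable_bounded _ _ 1); first exact: measurable_indic.
  by move=> w _; rewrite indicE; case: (w \in D); rewrite ?normr1 ?normr0.
have tD : tint (\1_D : R * R -> R) = l z.1 * l z.2.
  rewrite /tint /Rintegral integral_indic//; last exact: measurable_cell.
  rewrite (_ : D `&` cell R = D); last by apply/setIidPl => w /DJ[].
  by rewrite -[RHS]/(fine (l z.1 * l z.2)%:E) -muD.
have : 0 < c ^+ 2 * tint (\1_D : R * R -> R).
  by rewrite tD mulr_gt0 ?exprn_gt0// mulr_gt0// l0// ?z1 ?z2.
rewrite -tintZ// ltNge => /negP; apply; rewrite -f0; apply: le_tint.
- exact: tintegrableZ.
- by apply: tintegrable_continuous; [exact: continuousM2|exact: periodic2M].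
- move=> w _; rewrite indicE; have [/[!inE] /DJ[_ /fr H]|_] := boolP (w \in D);
  last by rewrite mulr0 sqr_ge0.
  rewrite mulr1 -(ger0_norm (sqr_ge0 (f w))) normrX ler_sqr ?nnegrE ?(ltW c0)//.
  have : `|f z| <= `|f z - f w| + `|f w| by rewrite -{1}(subrK (f w) (f z)) ler_normD.
  by move: H; rewrite /c; lra.
Qed.

End Parts.

(** * Square-integrable functions orthogonal to continuous functions *)

Section Uniqueness.
Variable R : realType.
Notation mu := (leb2 R).
Notation lm := (@lebesgue_measure R).
Notation T1 := (measurableTypeR R).
Notation T2 := (measurableTypeR R * measurableTypeR R)%type.

Lemma cos_nincr (x y : R) : 0 <= x -> x <= y -> y <= pi -> cos y <= cos x.
Proof.
move=> x0 xy ypi; rewrite leNgt; apply/negP => H.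
have := @ltr_cos R y x; rewrite !in_itv/= x0 ypi (le_trans xy ypi) (le_trans x0 xy).
by move=> /(_ isT isT); rewrite H => /esym/lt_geF; rewrite xy.
Qed.

(** Indicators of the half-lines ]a, +oo[ are limits, inside one period, of functions
    of a continuous periodic s: up to its end points such a trace on the period is
    an arc of the circle. *)
Lemma arc_above (a : R) : exists s : R ->
  R, [/\ continuous s, forall x, s (x + 2 * pi) = s x &
  forall x, 0 < x < 2 * pi -> (0 < s x) = (a < x)].
Proof.
have p0 := pi_gt0 R.
have [a0|a0] := ltP a 0.
  exists (fun=> 1); split => // [x|x /andP[x0 _]]; first exact: cvg_cst.
  by rewrite ltr01 (lt_trans a0).
have [a2|a2] := leP (2 * pi) a.
  exists (fun=> 0); split => // [x|x /andP[_ x2]]; first exact: cvg_cst.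
  by rewrite ltxx; apply/esym/negbTE; rewrite -leNgt (le_trans (ltW x2)).
(* Centre and radius of the arc ]a, 2 pi[. *)
pose c := pi + a / 2; pose r := pi - a / 2.
exists (fun x => cos (x - c) - cos r); split => [x|x|x /andP[x0 x2]].
- apply: cvgB; last exact: cvg_cst.
  apply: (@continuous_comp _ _ _ (fun x : R => x - c) (@cos R) x);
    last exact: continuous_cos.
  by apply: cvgB; [exact: cvg_id|exact: cvg_cst].
- by rewrite -[in RHS](cos_nat2pi 1) mul1r; congr (cos _ - _); ring.
- rewrite subr_gt0; have [lt_axpy|le_xa] := ltP a x.
    rewrite -(cos_norm (x - c)); apply/idP.
    have H : `|x - c| < r by rewrite ltr_norml /r /c; apply/andP; lra.
    rewrite (@ltr_cos R) ?in_itv/= ?normr_ge0//=; last by rewrite /r; apply/andP; lra.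
    by rewrite (le_trans (ltW H))// /r; lra.
  apply/negbTE; rewrite -leNgt -cosN opprB.
  have [cx|cx] := leP (c - x) pi; first by apply: cos_nincr => //; rewrite /r /c; lra.
  rewrite -(cosN (c - x)) -(cos_nat2pi 1) mul1r; apply: cos_nincr; move: cx;
    rewrite /r /c; lra.
Qed.

(** Periodicity does not separate opposite sides of the closed cell; removing the
    boundary, a null set, avoids this. *)
Definition ocell : set T2 := `]0, 2 * pi[%classic `*` `]0, 2 * pi[%classic.

Lemma measurable_ocell : measurable ocell.
Proof. by apply: measurableX; exact: measurable_itv. Qed.

Lemma ocell_cell : ocell `<=` cell R.
Proof.
by move=> z [] /=; rewrite !in_itv/= => /andP[? ?] /andP[? ?]; apply/cellP; split;
  apply/andP; split; exact: ltW.
Qed.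

Lemma leb2_ocell : mu ocell = ((2 * pi) ^+ 2)%:E.
Proof.
have p0 : 0 < 2 * pi :> R by rewrite mulr_gt0// pi_gt0.
pose I : set T1 := `]0, 2 * pi[%classic.
transitivity (lebesgue_measure I * lebesgue_measure I)%E.
  by apply: product_measure1E; exact: measurable_itv.
by rewrite /I lebesgue_measure_itv/= lte_fin p0 oppr0 adde0 -EFinM expr2.
Qed.

Lemma integral_ocell (f : T2 -> \bar R) : mu.-integrable (cell R) f ->
  (\int[mu]_(z in cell R) f z = \int[mu]_(z in ocell) f z)%E.
Proof.
move=> fi; have mc := @measurable_cell R; have mo := measurable_ocell.
have co : cell R `&` ocell = ocell by apply/setIidPr; exact: ocell_cell.
have N0 : mu (cell R `\` ocell) = 0%E.
  have lt : (mu (cell R) < +oo)%E by rewrite leb2_cell ltry.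
  have -> : (mu (cell R `\` ocell) = mu (cell R) - mu (cell R `&` ocell))%E :=
    measureD mc mo lt.
  by rewrite co leb2_ocell leb2_cell subee.
by rewrite (negligible_integral _ mc fi N0) ?setDD ?co//; exact: measurableD.
Qed.

Section ZeroSets.
Variable d : R * R -> R.
Hypothesis di : tintegrable d.
Hypothesis dh : forall h, continuous h -> periodic2 h -> L2T (fun z => d z * h z).
Hypothesis dh0 : forall h, continuous h -> periodic2 h -> tint (fun z => d z * h z) = 0.

Let Z (S : set T2) := (\int[mu]_(z in ocell `&` S) (d z)%:E = 0)%E.

Let iS (S : set T2) : measurable S -> mu.-integrable (ocell `&` S) (EFin \o d).
Proof.
move=> mS; apply: (integrableS (@measurable_cell R) _ _ di);
  last by move=> z [/ocell_cell].
by apply: measurableI => //; exact: measurable_ocell.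
Qed.

Let ZD (S S' : set T2) : measurable S -> measurable S' -> S' `<=` S -> Z S -> Z S' ->
  Z (S `\` S').
Proof.
move=> mS mS' SS' ZS ZS'; have mo := measurable_ocell.
have E : ocell `&` S = (ocell `&` S') `|` (ocell `&` (S `\` S')).
  by rewrite -setIUr setDUK.
have := ZS; rewrite /Z E integral_setU.
- by rewrite ZS' add0e.
- exact: measurableI.
- by apply: measurableI => //; exact: measurableD.
- by rewrite -E; exact: measurable_int (iS mS).
- by apply/disj_setPS => z [[_ s1] [_ [_ s2]]].
Qed.

Let Zbig (F : (set T2)^nat) : (forall n, measurable (F n)) -> trivIset setT F ->
  (forall n, Z (F n)) -> Z (\bigcup_n F n).
Proof.
move=> mF tF ZF; have mo := measurable_ocell.
rewrite /Z setI_bigcupr integral_bigcup.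
- by apply: eseries0 => n _ _; exact: ZF.
- apply/trivIsetP => i j _ _ ij; have /trivIsetP/(_ i j I I ij) := tF.
  by rewrite setIACA setIid => ->; rewrite setI0.
- by move=> k; exact: measurableI.
- by rewrite -setI_bigcupr; apply: iS; exact: bigcup_measurable.
Qed.

(** Continuous functions with values in [0, 1] that increase to the indicator of the
    set where s is positive. *)
Let ramp (s : R -> R) n x := Num.min 1 (n%:R * Num.max 0 (s x)).

Let continuous_ramp s n : continuous s -> continuous (ramp s n).
Proof.
move=> cs x.
have cm : {for x, continuous (fun x => Num.max 0 (s x))}.
  exact: (@continuous_max _ _ (cst 0) s x (@cvg_cst _ _ _ _ _) (cs x)).
apply: (@continuous_min _ _ (cst 1) (fun x =>
  n%:R * Num.max 0 (s x)) x (@cvg_cst _ _ _ _ _)).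
by apply: cvgM; [exact: cvg_cst|exact: cm].
Qed.

Let ramp_bound s n x : 0 <= ramp s n x <= 1.
Proof.
rewrite /ramp le_min ler01 ge_min lexx mulr_ge0 ?ler0n// le_max lexx//.
Qed.

Let ramp_cvg s x : ramp s n x @[n --> \oo] --> ((0 < s x)%R%:R : R).
Proof.
have [s0|s0] := ltP 0 (s x).
  apply: cvg_near_cst; near=> n; rewrite /ramp; apply/min_idPl.
  rewrite max_r ?ltW//; have : (s x)^-1 < n%:R.
    by near: n; exact: nbhs_infty_gtr.
  by rewrite -[_^-1]mul1r ltr_pdivrMr.
apply: cvg_near_cst; near=> n; rewrite /ramp max_l// mulr0 min_r//.
Unshelve. all: by end_near. Qed.

(** Dominated convergence along products of two ramps. *)
Let Zray (a b : R) : Z (`]a, +oo[%classic `*` `]b, +oo[%classic).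
Proof.
have [s [cs ps sa]] := arc_above a; have [t [ct pt tb]] := arc_above b.
pose h n (z : R * R) := ramp s n z.1 * ramp t n z.2.
have ch n : continuous (h n).
  move=> z; apply: cvgM.
    apply: (@continuous_comp _ _ _ fst (ramp s n) z); first exact: cvg_fst.
    exact: continuous_ramp.
  apply: (@continuous_comp _ _ _ snd (ramp t n) z); first exact: cvg_snd.
  exact: continuous_ramp.
have ph n : periodic2 (h n) by move=> x y; rewrite /h /ramp/= ps pt.
have mo := measurable_ocell.
pose S : set T2 := `]a, +oo[%classic `*` `]b, +oo[%classic.
have mS : measurable S by apply: measurableX; exact: measurable_itv.
have hS z : ocell z -> (\1_S z : R) = (0 < s z.1)%R%:R * (0 < t z.2)%R%:R.
  move=> [] /=; rewrite !in_itv/= => z1 z2; rewrite sa// tb// indicE -natrM mulnb;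
    congr (_%:R).
  by congr nat_of_bool; apply/idP/idP; rewrite inE /S /= !in_itv/= !andbT;
    [move=> [-> ->]|move=> /andP].
have mod0 : measurable_fun ocell d.
  exact: (measurable_funS (@measurable_cell R) ocell_cell (tintegrable_measurable di)).
have [] := @dominated_convergence _ _ _ mu ocell mo (fun n z => (d z * h n z)%:E)
  (fun z => (d z * \1_S z)%:E) (fun z => `|d z|%:E).
- move=> n; apply/measurable_EFinP; apply: measurable_funM => //.
  exact: (measurable_funS (@measurable_cell R) ocell_cell
    (continuous_periodic_measurable (ch n) (ph n))).
- by apply/measurable_EFinP; apply: measurable_funM => //; exact: measurable_indic.
- apply/aeW => z oz; apply: cvg_EFin; first by apply: nearW.
  apply: cvgM; first exact: cvg_cst.
  by rewrite hS//; apply: cvgM; exact: ramp_cvg.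
- exact: (integrableS (@measurable_cell R) mo ocell_cell (tintegrable_norm di)).
- apply/aeW => z n oz /=; rewrite lee_fin normrM ler_piMr//.
  have /andP[a0 a1] := ramp_bound s n z.1; have /andP[b0 b1] := ramp_bound t n z.2.
  by rewrite /h normrM !ger0_norm// mulr_ile1.
move=> _ _; set u := (X in X @ \oo --> _ -> _).
have -> : u = fun=> 0%E.
  apply/funext => n; rewrite /u/= -integral_ocell;
    last exact: L2T_tintegrable (dh (ch n) (ph n)).
  have := dh0 (ch n) (ph n); rewrite /tint /Rintegral => H.
  rewrite -[LHS]fineK ?H//; apply: integrable_fin_num; first exact: measurable_cell.
  exact: L2T_tintegrable (dh (ch n) (ph n)).
move=> /(cvg_unique _ (@cvg_cst _ _ _ _ _)) => /(_ _) E.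
rewrite /Z -/S integral_mkcondr [LHS](_ : _ = \int[mu]_(z in ocell) (d z * \1_S
  z)%:E)%E ?E//.
apply: eq_integral => z _; rewrite patchE indicE.
by case: (z \in S); rewrite ?mulr1 ?mulr0.
Qed.

Let G := @RGenOInfty.G R.
Let GE : @measurable _ T1 = <<s G >>.
Proof. exact: RGenOInfty.measurableE. Qed.
Let GI : setI_closed G.
Proof.
move=> _ _ [a ->] [b ->]; exists (Num.max a b); apply/seteqP; split => x /=;
  rewrite !in_itv/= !andbT gt_max; first by move=> [-> ->].
by move=> /andP.
Qed.
(** On the open cell a half-line starting at 0 cannot be told from the whole line. *)
Let ZT1 (B : set T1) : (forall a, Z (`]a, +oo[%classic `*` B)) -> Z (setT `*` B).
Proof.
move=> /(_ 0); rewrite /Z; congr (integral _ _ _ = _); apply/seteqP;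
  split => z -[oz] [z1 z2].
  by split.
by split=> //; split => //=; case: oz => /=; rewrite !in_itv/= => /andP[-> _].
Qed.
Let ZT2 (A : set T1) : (forall a, Z (A `*` `]a, +oo[%classic)) -> Z (A `*` setT).
Proof.
move=> /(_ 0); rewrite /Z; congr (integral _ _ _ = _); apply/seteqP;
  split => z -[oz] [z1 z2].
  by split.
by split=> //; split => //=; case: oz => /= _; rewrite !in_itv/= => /andP[-> _].
Qed.

(** Half-lines form a pi-system that generates the Borel sets of the line.  They are
    replaced by arbitrary measurable sets in one variable, then in the other. *)
Let Zrect1 (A : set T1) (b : R) : measurable A -> Z (A `*` `]b, +oo[%classic).
Proof.
pose B : set T1 := `]b, +oo[%classic; have mB : measurable B by exact: measurable_itv.
move=> mA; have ZT : Z (setT `*` B) by apply: ZT1 => a; exact: Zray.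
apply: (@dynkin_induction _ T1 G (fun A => Z (A `*` B)) GE GI ZT); last by rewrite -GE.
- by move=> _ [a ->]; exact: Zray.
- move=> S mS ZS; rewrite (_ : _ `*` _ = (setT `*` B) `\` (S `*` B)).
    apply: ZD => //; [exact: measurableX|exact: measurableX|].
    by move=> z [_ ?]; split.
  apply/seteqP; split => z /=; first by move=> [? ?]; split => // -[].
  by move=> [[_ z2] nz]; split => // Sz; apply: nz.
- move=> F mF tF ZF; rewrite (_ : _ `*` _ = \bigcup_n (F n `*` B)); last first.
    by apply/seteqP; split => z; [move=> [[n _ Fn] Bz];
      exists n|move=> [n _ [Fn Bz]]; split => //; exists n].
  apply: Zbig => //.
    by move=> n; exact: measurableX.
  apply/trivIsetP => i j _ _ ij; have /trivIsetP/(_ i j I I ij) := tF.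
  by rewrite -setXI => ->; rewrite set0X.
Qed.

Let Zrect (A B : set T1) : measurable A -> measurable B -> Z (A `*` B).
Proof.
move=> mA mB; have ZT : Z (A `*` setT) by apply: ZT2 => a; exact: Zrect1.
apply: (@dynkin_induction _ T1 G (fun B => Z (A `*` B)) GE GI ZT); last by rewrite -GE.
- by move=> _ [a ->]; exact: Zrect1.
- move=> S mS ZS; rewrite (_ : _ `*` _ = (A `*` setT) `\` (A `*` S)).
    apply: ZD => //; [exact: measurableX|exact: measurableX|].
    by move=> z [? _]; split.
  apply/seteqP; split => z /=; first by move=> [? ?]; split => // -[].
  by move=> [[z1 _] nz]; split => // Sz; apply: nz.
- move=> F mF tF ZF; rewrite (_ : _ `*` _ = \bigcup_n (A `*` F n)); last first.
    by apply/seteqP; split => z; [move=> [Az [n _ Fn]];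
      exists n|move=> [n _ [Az Fn]]; split => //; exists n].
  apply: Zbig => //.
    by move=> n; exact: measurableX.
  apply/trivIsetP => i j _ _ ij; have /trivIsetP/(_ i j I I ij) := tF.
  by rewrite -setXI => ->; rewrite setX0.
Qed.

Lemma integral_ocell_eq0 (S : set T2) : measurable S ->
  (\int[mu]_(z in ocell `&` S) (d z)%:E = 0)%E.
Proof.
move=> mS.
apply: (@dynkin_induction _ T2 [set A `*` B | A in measurable & B in measurable] Z).
- exact: measurable_prod_measurableType.
- move=> _ _ [A mA] [B mB] <- [A' mA'] [B' mB'] <-; rewrite -setXI.
  by exists (A `&` A'); [exact: measurableI|exists (B `&` B') => //;
    exact: measurableI].
- by rewrite -setXTT; apply: Zrect.
- by move=> _ [A mA] [B mB] <-; exact: Zrect.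
- move=> S' mS' ZS'; rewrite -setTD; apply: ZD => //.
  by rewrite -setXTT; apply: Zrect.
- by move=> F mF tF ZF; exact: Zbig.
- by rewrite -measurable_prod_measurableType.
Qed.

End ZeroSets.

(** By [integral_ocell_eq0] the integral of d over every measurable part of the open
    cell is 0, so that d vanishes almost everywhere. *)
Lemma orth_continuous_L2 (d : R * R -> R) : L2T d ->
  (forall h, continuous h -> periodic2 h -> tint (fun z => d z * h z) = 0) ->
  tint (fun z => d z ^+ 2) = 0.
Proof.
move=> d2 dh0; have di := L2T_tintegrable d2; have mo := measurable_ocell.
have dh h : continuous h -> periodic2 h -> L2T (fun z => d z * h z).
  move=> ch ph; have := L2T_continuousM ch ph d2.
  by congr L2T; apply/funext => z; rewrite mulrC.
have od : mu.-integrable ocell (EFin \o d).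
  exact: (integrableS (@measurable_cell R) mo ocell_cell di).
have ae0 : ae_eq mu ocell (EFin \o d) (cst 0%E).
  apply: integral_ae_eq => // E Eo mE.
  rewrite integral_cst// mul0e -[in LHS](setIidr Eo).
  exact: integral_ocell_eq0.
have d2i := d2.2.
rewrite /tint /Rintegral integral_ocell// (@ae_eq_integral _ _ _ mu ocell (cst 0%E)).
- by rewrite integral_cst// mul0e.
- exact: mo.
- exact: measurable_int (integrableS (@measurable_cell R) mo ocell_cell d2i).
- exact: measurable_cst.
- by apply: filterS ae0 => z H oz /=; have [->] := H oz; rewrite expr0n.
Qed.

End Uniqueness.

(** * Inner products and weak derivatives *)

Section Weak.
Variable R : realType.
Implicit Types (f g h phi psi : R * R -> R).

Lemma periodic2_int f (n m : int) (x y : R) : periodic2 f ->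
  f (x + n%:~R * (2 * pi), y + m%:~R * (2 * pi)) = f (x, y).
Proof.
move=> pf.
have X (k : nat) u v : f (u + k%:R * (2 * pi), v) = f (u, v).
  elim: k => [|k IH]; first by rewrite mul0r addr0.
  by rewrite -IH -[RHS](pf _ v).1; congr (f (_, _)); rewrite -natr1; ring.
have Y (k : nat) u v : f (u, v + k%:R * (2 * pi)) = f (u, v).
  elim: k => [|k IH]; first by rewrite mul0r addr0.
  by rewrite -IH -[RHS](pf u _).2; congr (f (_, _)); rewrite -natr1; ring.
have X' (k : int) u v : f (u + k%:~R * (2 * pi), v) = f (u, v).
  case: k => k; first exact: X.
  by rewrite NegzE -[LHS](X k.+1); congr (f (_, _)); rewrite mulrNz; ring.
rewrite X'; case: m => k; first exact: Y.
by rewrite NegzE -[LHS](Y k.+1); congr (f (_, _)); rewrite mulrNz; ring.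
Qed.

(** The representative in the cell is obtained by subtracting integer multiples of
    2 pi from both coordinates. *)
Lemma periodic2_reduce f (z : R * R) : periodic2 f -> exists2 w, cell R w & f z = f w.
Proof.
move=> pf; have p0 : 0 < 2 * pi :> R by rewrite mulr_gt0// pi_gt0.
pose q (x : R) := x + (- Num.floor (x / (2 * pi)))%:~R * (2 * pi).
have qP x : 0 <= q x <= 2 * pi.
  have := floor_itv (x / (2 * pi)).
  rewrite /q mulrNz intrD => /andP[].
  by rewrite ler_pdivlMr// ltr_pdivrMr// mulrDl mul1r => a b; apply/andP; lra.
exists (q z.1, q z.2); first by apply/cellP; split; exact: qP.
by rewrite /q periodic2_int//; case: z.
Qed.

Lemma periodic2_eq0 f : periodic2 f -> (forall z, cell R z -> f z = 0) -> f = fun=> 0.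
Proof. by move=> pf f0; apply/funext => z;
  have [w /f0 cw ->] := periodic2_reduce z pf. Qed.

Lemma L2T_test f : test f -> L2T f.
Proof. by move=> tf; apply: L2T_continuous; [exact: test_continuous|exact: tf.1]. Qed.

Definition ip f g := tint (fun z => f z * g z).
Definition axpy f (c : R) g : R * R -> R := fun z => f z + c * g z.

Lemma ipC f g : ip f g = ip g f.
Proof. by apply: eq_tint => z _; rewrite mulrC. Qed.
Lemma ip_ge0 f : 0 <= ip f f.
Proof. by apply: tint_ge0 => z _; rewrite -expr2 sqr_ge0. Qed.
Lemma L2T_axpy f c g : L2T f -> L2T g -> L2T (axpy f c g).
Proof. by move=> f2 g2; apply: L2TD => //; exact: L2TZ. Qed.
Lemma ip_axpyl f c g h : L2T f -> L2T g -> L2T h ->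
  ip (axpy f c g) h = ip f h + c * ip g h.
Proof.
move=> f2 g2 h2; have fh := L2T_tintegrableM f2 h2; have gh := L2T_tintegrableM g2 h2.
by rewrite /ip -tintZ// -tintD//; [apply: eq_tint => z _; rewrite /axpy;
  ring|exact: tintegrableZ].
Qed.
Lemma ip_axpyr f c g h : L2T f -> L2T g -> L2T h ->
  ip h (axpy f c g) = ip h f + c * ip h g.
Proof. by move=> f2 g2 h2; rewrite ipC ip_axpyl// !(ipC h). Qed.
Lemma ipZl (c : R) f g : L2T f -> L2T g -> ip (fun z => c * f z) g = c * ip f g.
Proof. by move=> f2 g2; rewrite /ip -tintZ; [apply: eq_tint => z _;
  ring|exact: L2T_tintegrableM]. Qed.
Lemma ipZr (c : R) f g : L2T f -> L2T g -> ip g (fun z => c * f z) = c * ip g f.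
Proof. by move=> f2 g2; rewrite ipC ipZl// ipC. Qed.
Lemma ip_CS f g : L2T f -> L2T g -> ip f g ^+ 2 <= ip f f * ip g g.
Proof. by move=> f2 g2; have := tint_CS f2 g2. Qed.

Lemma ip_dtheta f g : test f -> test g -> ip (dtheta f) g = - ip f (dtheta g).
Proof. exact: parts_theta. Qed.
Lemma ip_dzeta f g : test f -> test g -> ip (dzeta f) g = - ip f (dzeta g).
Proof. exact: parts_zeta. Qed.

Lemma test_axpy f c g : test f -> test g -> test (axpy f c g).
Proof. by move=> tf tg; apply: testD => //; exact: testZ. Qed.
Lemma dtheta_axpy f c g : test f -> test g ->
  dtheta (axpy f c g) = axpy (dtheta f) c (dtheta g).
Proof.
move=> tf tg; rewrite /axpy dthetaD ?dthetaZ// => z; try exact: test_derivable_theta.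
by apply: test_derivable_theta; exact: testZ.
Qed.
Lemma dzeta_axpy f c g : test f -> test g ->
  dzeta (axpy f c g) = axpy (dzeta f) c (dzeta g).
Proof.
move=> tf tg; rewrite /axpy dzetaD ?dzetaZ// => z; try exact: test_derivable_zeta.
by apply: test_derivable_zeta; exact: testZ.
Qed.

Lemma trigmon_comm j k s t :
  dtheta (dzeta (@trigmon R j k s t)) = dzeta (dtheta (trigmon j k s t)).
Proof.
rewrite dzeta_trigmon dtheta_trigmon dthetaZ => [|z];
  last exact: test_derivable_theta (test_trigmon _ _ _ _).
rewrite dzetaZ => [|z]; last exact: test_derivable_zeta (test_trigmon _ _ _ _).
by rewrite dtheta_trigmon dzeta_trigmon; apply/funext => z; ring.
Qed.

(** By density f is orthogonal to itself. *)
Lemma orth_trigmon_eq0 f : continuous f -> periodic2 f ->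
  (forall j k s t, ip f (trigmon j k s t) = 0) -> f = fun=> 0.
Proof.
move=> cf pf H; apply: (periodic2_eq0 pf); apply: (continuous_sqr0 cf pf).
exact: (orth_trigmon_continuous (L2T_continuous cf pf) H cf pf).
Qed.

(** Symmetry of second derivatives.  Integrating by parts twice against a monomial,
    for which the symmetry is explicit, shows that the difference of the two sides
    is orthogonal to all monomials. *)
Lemma dtheta_dzeta f : test f -> dtheta (dzeta f) = dzeta (dtheta f).
Proof.
move=> tf; have t1 := test_dtheta (test_dzeta tf);
  have t2 := test_dzeta (test_dtheta tf).
have tF := test_axpy (-1) t1 t2.
suff /funeqP F0 : axpy (dtheta (dzeta f)) (-1) (dzeta (dtheta f)) = fun=> 0.
  by apply/funext => z; have := F0 z; rewrite /axpy mulN1r => /eqP;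
    rewrite subr_eq0 => /eqP.
apply: orth_trigmon_eq0 => [||j k s t]; [exact: test_continuous|exact: tF.1|].
have tM := test_trigmon j k s t; have tM1 := test_dtheta tM; have tM2 := test_dzeta tM.
rewrite ip_axpyl; [|exact: L2T_test..].
have E1 := etrans (ip_dtheta (test_dzeta tf) tM)
  (etrans (congr1 -%R (ip_dzeta tf tM1)) (opprK _)).
have E2 := etrans (ip_dzeta (test_dtheta tf) tM)
  (etrans (congr1 -%R (ip_dtheta tf tM2)) (opprK _)).
apply: etrans (congr2 (fun a b => a + -1 * b) E1 E2) _.
by rewrite trigmon_comm; ring.
Qed.

Lemma ip_iter_dtheta i f g : test f -> test g ->
  ip f (iter i (@dtheta R) g) = (-1) ^+ i * ip (iter i (@dtheta R) f) g.
Proof.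
elim: i f => [|i IH] f tf tg; first by rewrite mul1r.
rewrite iterS iterSr exprS -mulrA -IH//; last exact: test_dtheta.
by rewrite (ip_dtheta tf) ?mulN1r ?opprK//; exact: (test_iter_dzeta_dtheta i 0 tg).
Qed.
Lemma ip_iter_dzeta i f g : test f -> test g ->
  ip f (iter i (@dzeta R) g) = (-1) ^+ i * ip (iter i (@dzeta R) f) g.
Proof.
elim: i f => [|i IH] f tf tg; first by rewrite mul1r.
rewrite iterS iterSr exprS -mulrA -IH//; last exact: test_dzeta.
by rewrite (ip_dzeta tf) ?mulN1r ?opprK//; exact: (test_iter_dzeta_dtheta 0 i tg).
Qed.

(** The order of differentiation is the one produced by moving first the theta
    derivatives and then the zeta derivatives off the test function in [is_wD]. *)
Definition strongD (i j : nat) f := iter j (@dzeta R) (iter i (@dtheta R) f).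

Lemma test_strongD i j f : test f -> test (strongD i j f).
Proof. exact: test_iter_dtheta_dzeta. Qed.

Lemma test_is_wD i j f : test f -> is_wD i j f (strongD i j f).
Proof.
move=> tf; split; first by apply: L2T_test; exact: test_strongD.
move=> phi tphi; rewrite -/(ip f _) -/(ip (strongD i j f) phi).
rewrite ip_iter_dtheta ?ip_iter_dzeta//; try exact: (test_iter_dzeta_dtheta i 0 tf);
  try exact: (test_iter_dzeta_dtheta 0 j tphi).
by rewrite exprD mulrA.
Qed.

Lemma wD_spec i j f : (exists g, is_wD i j f g) -> is_wD i j f (wD i j f).
Proof. by move=> H; rewrite /wD; have := xgetPex (fun=> 0) H. Qed.

(** Two weak derivatives have the same integrals against monomials; see
    [orth_continuous_L2]. *)
Lemma is_wD_unique i j f g1 g2 : is_wD i j f g1 -> is_wD i j f g2 ->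
  ip (axpy g1 (-1) g2) (axpy g1 (-1) g2) = 0.
Proof.
move=> [l1 w1] [l2 w2]; have l12 := L2T_axpy (-1) l1 l2.
apply: orth_continuous_L2 => // h ch ph;
  apply: (orth_trigmon_continuous l12) => // a b s t.
have tM := test_trigmon a b s t; rewrite -/(ip _ _) ip_axpyl//; last exact: L2T_test.
have := w1 _ tM; rewrite w2// => /mulfI E; rewrite /ip E ?signr_eq0//; ring.
Qed.

(** [wD] selects an arbitrary representative, but it differs from g by a function of
    norm 0. *)
Lemma tint_wD_sq i j f g : is_wD i j f g -> tint (fun z => wD i j f z ^+ 2) = ip g g.
Proof.
move=> wg; have ww : is_wD i j f (wD i j f) by apply: wD_spec; exists g.
have lw := ww.1; have lg := wg.1; have u0 := is_wD_unique ww wg.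
have l0 := L2T_axpy (-1) lw lg.
have := ip_CS l0 lg; rewrite u0 mul0r =>
  /(conj (sqr_ge0 (ip (axpy (wD i j f) (-1) g) g))) /andP.
rewrite -eq_le eq_sym sqrf_eq0 => /eqP v0.
rewrite -[LHS]/(ip (wD i j f) (wD i j f)).
move: u0 v0; rewrite ip_axpyl// ip_axpyl// !ip_axpyr// (ipC g (wD i j f)); lra.
Qed.

End Weak.

(** * The energy argument *)

Section Energy.
Variable R : realType.
Implicit Types (f g h phi psi : R * R -> R).

(** The discriminant inequality, at t = b / c; when c = 0 a value of t that makes the
    polynomial equal to -1 excludes b <> 0. *)
Lemma quad_bound (b c e : R) : 0 <= c ->
  (forall t, 0 <= t ^+ 2 * c - 2 * t * b + e) -> b ^+ 2 <= e * c.
Proof.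
move=> c0 H; have [cz|cp] := eqVneq c 0.
  have [->|bn] := eqVneq b 0; first by rewrite cz expr0n mulr0.
  have := H ((e + 1) / (2 * b)); rewrite cz mulr0 add0r.
  have -> : - (2 * ((e + 1) / (2 * b)) * b) + e = -1 by field.
  by rewrite ler0N1.
have cpos : 0 < c by rewrite lt_neqAle eq_sym cp.
have := H (b / c).
have -> : (b / c) ^+ 2 * c - 2 * (b / c) * b + e = (e * c - b ^+ 2) / c by field.
by rewrite pmulr_lge0 ?invr_gt0// subr_ge0.
Qed.

(* D1 and D2 stand for the partial derivatives.  The argument only uses their
   linearity, integration by parts and their action on monomials. *)
Variables (D1 D2 : (R * R -> R) -> (R * R -> R)).
Hypotheses (D1E : D1 = @dtheta R) (D2E : D2 = @dzeta R).
(* (w1, w2) is the weak gradient of p, and K is the weight H^3. *)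
Variables (K p w1 w2 : R * R -> R).
Hypotheses (cK : continuous K) (pK : periodic2 K) (K0 : forall z, cell R z -> 0 < K z).
Hypotheses (p2 : L2T p) (w12 : L2T w1) (w22 : L2T w2).
Hypothesis pw1 : forall phi, test phi -> ip p (D1 phi) = - ip w1 phi.
Hypothesis pw2 : forall phi, test phi -> ip p (D2 phi) = - ip w2 phi.
Hypothesis Kw : forall phi, test phi ->
  ip (fun z => K z * w1 z) (D1 phi) + ip (fun z => K z * w2 z) (D2 phi) = 0.

Let test_D1 f : test f -> test (D1 f). Proof. by rewrite D1E; exact: test_dtheta. Qed.
Let test_D2 f : test f -> test (D2 f). Proof. by rewrite D2E; exact: test_dzeta. Qed.
Let D1_axpy f c g : test f -> test g -> D1 (axpy f c g) = axpy (D1 f) c (D1 g).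
Proof. by rewrite D1E; exact: dtheta_axpy. Qed.
Let D2_axpy f c g : test f -> test g -> D2 (axpy f c g) = axpy (D2 f) c (D2 g).
Proof. by rewrite D2E; exact: dzeta_axpy. Qed.
Let ip_D1 f g : test f -> test g -> ip (D1 f) g = - ip f (D1 g).
Proof. by rewrite D1E; exact: ip_dtheta. Qed.
Let ip_D2 f g : test f -> test g -> ip (D2 f) g = - ip f (D2 g).
Proof. by rewrite D2E; exact: ip_dzeta. Qed.
Let D1_trigmonZ c j k s t : D1 (fun z => c * trigmon j k s t z) = fun z =>
  (c * j%:R) * trigmon j k (s + pi / 2) t z.
Proof.
rewrite D1E dthetaZ => [|z]; last exact: test_derivable_theta (test_trigmon _ _ _ _).
by rewrite dtheta_trigmon; apply/funext => z; rewrite mulrA.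
Qed.
Let D2_trigmonZ c j k s t : D2 (fun z => c * trigmon j k s t z) = fun z =>
  (c * k%:R) * trigmon j k s (t + pi / 2) z.
Proof.
rewrite D2E dzetaZ => [|z]; last exact: test_derivable_zeta (test_trigmon _ _ _ _).
by rewrite dzeta_trigmon; apply/funext => z; rewrite mulrA.
Qed.
Let D1_trigmon j k s t : D1 (trigmon j k s t) = fun z =>
  j%:R * trigmon j k (s + pi / 2) t z.
Proof. by rewrite D1E dtheta_trigmon. Qed.
Let D2_trigmon j k s t : D2 (trigmon j k s t) = fun z =>
  k%:R * trigmon j k s (t + pi / 2) z.
Proof. by rewrite D2E dzeta_trigmon. Qed.

Let v1 phi := axpy w1 (-1) (D1 phi).
Let v2 phi := axpy w2 (-1) (D2 phi).
Let J phi := ip (v1 phi) (v1 phi) + ip (v2 phi) (v2 phi).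
Let G psi := ip (D1 psi) (D1 psi) + ip (D2 psi) (D2 psi).

Let L1 phi : test phi -> L2T (D1 phi).
Proof. by move=> tf; apply: L2T_test; exact: test_D1. Qed.
Let L2 phi : test phi -> L2T (D2 phi).
Proof. by move=> tf; apply: L2T_test; exact: test_D2. Qed.
Let Lv1 phi : test phi -> L2T (v1 phi).
Proof. by move=> tf; apply: L2T_axpy => //; exact: L1. Qed.
Let Lv2 phi : test phi -> L2T (v2 phi).
Proof. by move=> tf; apply: L2T_axpy => //; exact: L2. Qed.

Let J0 phi : 0 <= J phi. Proof. by rewrite addr_ge0// ip_ge0. Qed.
Let G0 phi : 0 <= G phi. Proof. by rewrite addr_ge0// ip_ge0. Qed.

Lemma ip0r f : ip f (fun=> 0) = 0.
Proof. by rewrite /ip (@eq_tint _ _ (fun=> 0)) ?tint_cst ?mul0r// => z _;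
  rewrite mulr0. Qed.

Lemma ip_axpy2 f c g : L2T f -> L2T g ->
  ip (axpy f c g) (axpy f c g) = ip f f + 2 * c * ip f g + c ^+ 2 * ip g g.
Proof.
move=> f2 g2; rewrite ip_axpyl ?ip_axpyr//; last exact: L2T_axpy.
by rewrite (ipC g f); ring.
Qed.

Let v1_axpy phi t psi : test phi -> test psi ->
  v1 (axpy phi t psi) = axpy (v1 phi) (- t) (D1 psi).
Proof. by move=> tp ts; rewrite /v1 D1_axpy//; apply/funext => z; rewrite /axpy;
  ring. Qed.
Let v2_axpy phi t psi : test phi -> test psi ->
  v2 (axpy phi t psi) = axpy (v2 phi) (- t) (D2 psi).
Proof. by move=> tp ts; rewrite /v2 D2_axpy//; apply/funext => z; rewrite /axpy;
  ring. Qed.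

Let J_axpy phi t psi : test phi -> test psi ->
  J (axpy phi t psi) = J phi - 2 * t * (ip (v1 phi) (D1 psi) + ip (v2 phi) (D2 psi))
    + t ^+ 2 * G psi.
Proof.
move=> tp ts; rewrite /J v1_axpy// v2_axpy// ip_axpy2; [|exact: Lv1|exact: L1].
by rewrite (ip_axpy2 _ (Lv2 tp) (L2 ts)) /G; ring.
Qed.

Let dist := inf [set J phi | phi in @test R].
Let dist_le phi : test phi -> dist <= J phi.
Proof.
move=> tp; apply: ge_inf; last by exists phi.
by exists 0 => _ [f _ <-]; exact: J0.
Qed.
Let near_min (e : R) phi := test phi /\ J phi <= dist + e.
Let near_minP (e : R) : 0 < e -> exists phi, near_min e phi.
Proof.
move=> e0; have : has_inf [set J phi | phi in @test R].
  split; first by exists (J (fun=> 0)), (fun=> 0) => //; exact: test_cst.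
  by exists 0 => _ [f _ <-]; exact: J0.
move=> /(inf_adherent e0)[_ [f tf <-] Jf]; exists f; split => //; exact: ltW.
Qed.

(** J cannot decrease by more than e along the line through phi in direction psi. *)
Let euler e phi psi : near_min e phi -> test psi ->
  (ip (v1 phi) (D1 psi) + ip (v2 phi) (D2 psi)) ^+ 2 <= e * G psi.
Proof.
move=> [tp Jp] ts; apply: quad_bound => [|t]; first exact: G0.
have := dist_le (test_axpy t tp ts); rewrite J_axpy//; lra.
Qed.

Let weak_v1 phi psi : test phi -> test psi ->
  ip (v1 phi) psi = - ip (axpy p (-1) phi) (D1 psi).
Proof.
move=> tp ts; rewrite (ip_axpyl _ w12 (L1 tp) (L2T_test ts)).
rewrite (ip_axpyl _ p2 (L2T_test tp) (L1 ts)) pw1// (ip_D1 tp ts); ring.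
Qed.
Let weak_v2 phi psi : test phi -> test psi ->
  ip (v2 phi) psi = - ip (axpy p (-1) phi) (D2 psi).
Proof.
move=> tp ts; rewrite (ip_axpyl _ w22 (L2 tp) (L2T_test ts)).
rewrite (ip_axpyl _ p2 (L2T_test tp) (L2 ts)) pw2// (ip_D2 tp ts); ring.
Qed.

(** Eigenfunctions of the Laplacian for -lam, in weak form. *)
Let eig (lam : R) psi := test psi /\
  forall f, L2T f -> ip f (D1 (D1 psi)) + ip f (D2 (D2 psi)) = - lam * ip f psi.

(** Write psi as -1 / lam times its Laplacian and apply [euler]. *)
Let eig_small lam psi : 0 < lam -> eig lam psi -> exists2 C, 0 <= C &
  forall e phi, near_min e phi -> ip (axpy p (-1) phi) psi ^+ 2 <= e * C.
Proof.
move=> lam0 [ts E]; exists (lam^-1 ^+ 2 * G psi);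
  first by rewrite mulr_ge0 ?sqr_ge0 ?G0.
move=> e phi nm; have tp := nm.1; have := euler nm ts.
rewrite weak_v1//; last exact: test_D1.
rewrite weak_v2//; last exact: test_D2.
rewrite -opprD sqrrN E; last by apply: L2T_axpy => //; exact: L2T_test.
move=> H; have := ler_wpM2l (sqr_ge0 (lam^-1)) H.
rewrite -exprMn mulrA mulrN mulVf ?gt_eqF// mulN1r sqrrN => /le_trans; apply.
by rewrite mulrCA.
Qed.

Let eig_trigmon j k s t (c : R) :
  eig (j%:R ^+ 2 + k%:R ^+ 2) (fun z => c * trigmon j k s t z).
Proof.
have tM := test_trigmon j k s t; split; first exact: testZ.
move=> f f2.
have shift2 (u : R) : u + pi / 2 + pi / 2 = u + pi by field.
have cpi (a : R) : cos (a + pi) = - cos a by exact: cosDpi.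
have E1 : D1 (D1 (fun z => c * trigmon j k s t z)) = fun z =>
  - (c * j%:R ^+ 2) * trigmon j k s t z.
  by rewrite D1_trigmonZ D1_trigmonZ; apply/funext => z;
    rewrite /trigmon shift2 addrA cpi; ring.
have E2 : D2 (D2 (fun z => c * trigmon j k s t z)) = fun z =>
  - (c * k%:R ^+ 2) * trigmon j k s t z.
  by rewrite D2_trigmonZ D2_trigmonZ; apply/funext => z;
    rewrite /trigmon shift2 addrA cpi; ring.
rewrite E1 E2 !ipZr//; try exact: L2T_test; ring.
Qed.

(** The residual grad p - grad phi of near-minimisers tends to 0 against h. *)
Let small_on h := exists2 C, 0 <= C & forall e phi, near_min e phi ->
  ip (v1 phi) h ^+ 2 <= e * C /\ ip (v2 phi) h ^+ 2 <= e * C.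

Let near_min_ge0 e phi : near_min e phi -> 0 <= e.
Proof. by move=> [tp Jp]; have := dist_le tp; lra. Qed.

(** The residual against a monomial M is, by parts, that of p - phi against a
    derivative of M, which is an eigenfunction; the derivatives of a constant M
    vanish. *)
Let small_trigmon j k s t : small_on (trigmon j k s t).
Proof.
have tM := test_trigmon j k s t.
pose lam : R := j%:R ^+ 2 + k%:R ^+ 2.
have [l0|l0] := ltP 0 lam; last first.
  have j0 : j%:R = 0 :> R by apply/eqP; rewrite -sqrf_eq0 eq_le sqr_ge0 andbT;
    have := sqr_ge0 (k%:R : R); rewrite /lam in l0; lra.
  have k0 : k%:R = 0 :> R by apply/eqP; rewrite -sqrf_eq0 eq_le sqr_ge0 andbT;
    have := sqr_ge0 (j%:R : R); rewrite /lam in l0; lra.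
  exists 0 => // e phi [tp _]; rewrite weak_v1// weak_v2// D1_trigmon D2_trigmon j0 k0.
  have l2 : L2T (axpy p (-1) phi) by apply: L2T_axpy => //; exact: L2T_test.
  by rewrite !ipZr ?mul0r ?oppr0 ?expr0n ?mulr0//;
    exact: L2T_test (test_trigmon _ _ _ _).
have [C1 C10 H1] := eig_small l0 (eig_trigmon j k (s + pi / 2) t j%:R).
have [C2 C20 H2] := eig_small l0 (eig_trigmon j k s (t + pi / 2) k%:R).
exists (C1 + C2) => [|e phi nm]; first exact: addr_ge0.
have tp := nm.1; have e0 := near_min_ge0 nm.
rewrite weak_v1// weak_v2// !sqrrN D1_trigmon D2_trigmon mulrDr.
split; first by apply: (le_trans (H1 _ _ nm)); rewrite lerDl mulr_ge0.
by apply: (le_trans (H2 _ _ nm)); rewrite lerDr mulr_ge0.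
Qed.

Let small_trigpoly h : trigpoly h -> small_on h.
Proof.
elim=> [|c j k s t {}h th [C2 C20 H2]].
  by exists 0 => // e phi [tp _]; rewrite !ip0r expr0n mulr0.
have [C1 C10 H1] := small_trigmon j k s t.
have lM := L2T_test (test_trigmon j k s t); have lh := L2T_test (trigpoly_test th).
have -> : (fun z => c * trigmon j k s t z + h z) = axpy h c (trigmon j k s t).
  by apply/funext => z; rewrite /axpy addrC.
exists (2 * (C2 + c ^+ 2 * C1)) => [|e phi nm].
  by rewrite mulr_ge0// addr_ge0// mulr_ge0// sqr_ge0.
have tp := nm.1; have [a1 a2] := H1 _ _ nm; have [b1 b2] := H2 _ _ nm.
have X (a b A B : R) : a ^+ 2 <= e * A -> b ^+ 2 <= e * B ->
  (b + c * a) ^+ 2 <= e * (2 * (B + c ^+ 2 * A)).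
  move=> ha hb; have := ler_wpM2l (sqr_ge0 c) ha; have := sqr_ge0 (b - c * a).
  rewrite sqrrB sqrrD exprMn => *; lra.
by rewrite !ip_axpyr//; [split; exact: X|exact: Lv2|exact: Lv1].
Qed.

(** The residuals are bounded in L^2, hence in L^1, so that the approximation of h by
    a trigonometric polynomial costs little, uniformly in phi. *)
Let small_cont h eta : continuous h -> periodic2 h -> 0 < eta -> exists2 e, 0 < e &
  forall phi, near_min e phi -> `|ip (v1 phi) h| <= eta /\ `|ip (v2 phi) h| <= eta.
Proof.
move=> ch ph eta0.
pose A := dist + 1 + (2 * pi) ^+ 2.
have A0 : 0 < A.
  have : 0 <= dist.
    by apply: lb_le_inf; [exists (J (fun=> 0)), (fun=> 0) => //;
      exact: test_cst|move=> _ [f _ <-]; exact: J0].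
  by have := sqr_ge0 (2 * pi : R); rewrite /A; lra.
have d0 : 0 < eta / 2 / A by rewrite !divr_gt0.
have [T [tT _ hT]] := trig_approx_pairing ch ph d0.
have [C C0 HC] := small_trigpoly tT.
(* e <= 1 bounds the residuals by A; the second bound makes e C at most
   (eta / 2)^2. *)
pose e := Num.min 1 (eta ^+ 2 / 4 / (C + 1)).
have e0 : 0 < e by rewrite lt_min ltr01 !divr_gt0 ?exprn_gt0//; lra.
have e1 : e <= 1 by rewrite ge_min lexx.
have eC : e * C <= (eta / 2) ^+ 2.
  have : e <= eta ^+ 2 / 4 / (C + 1) by rewrite ge_min lexx orbT.
  rewrite ler_pdivlMr; last by lra.
  have : (eta / 2) ^+ 2 = eta ^+ 2 / 4 by field.
  by move=> ->; lra.
exists e => // phi nm; have tp := nm.1; have [c1 c2] := HC _ _ nm.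
have X f : L2T f -> ip f f <= J phi -> ip f T ^+ 2 <= e * C -> `|ip f h| <= eta.
  move=> f2 fJ fT.
  have T1 : `|ip f T| <= eta / 2.
    by rewrite -ler_sqr ?nnegrE ?divr_ge0 ?(ltW eta0)// real_normK ?num_real//
      (le_trans fT).
  have N : tint (fun z => `|f z|) <= A.
    have : tint (fun z => `|f z|) <= tint (fun z => f z ^+ 2 + 1).
      apply: le_tint; [exact: tintegrable_norm (L2T_tintegrable f2)|apply:
        tintegrableD; [exact: f2.2|]|].
        exact: L2T_tintegrable (L2T_test (@test_cst R 1)).
      move=> z _; rewrite -real_normK ?num_real//; have := sqr_ge0 (`|f z| - 1).
      by have := normr_ge0 (f z); rewrite sqrrB1; lra.
    rewrite tintD; [|exact: f2.2|exact: L2T_tintegrable (L2T_test (@test_cst R 1))].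
    rewrite tint_cst mul1r; have := nm.2; rewrite /ip in fJ; rewrite /A.
    by move=> a b; apply: (le_trans b); rewrite lerD2r;
      apply: le_trans (le_trans fJ a) _; lra.
  have := hT _ f2; rewrite -/(ip f h) -/(ip f T) => D.
  have D' : `|ip f h - ip f T| <= eta / 2.
    apply: (le_trans D); rewrite -[leRHS](@divfK _ A) ?gt_eqF//.
    by rewrite ler_wpM2l// ltW.
  have : `|ip f h| <= `|ip f h - ip f T| + `|ip f T| by rewrite -{1}(subrK (ip f T)
    (ip f h)) ler_normD.
  by lra.
by split; apply: X => //; [exact: Lv1|rewrite lerDl ip_ge0|exact: Lv2|rewrite lerDr
  ip_ge0].
Qed.

(** The parallelogram identity applied to the residuals of phi and psi, whose midpoint
    cannot be better than the infimum. *)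
Let G_diff e phi psi : near_min e phi -> near_min e psi ->
  G (axpy phi (-1) psi) <= 4 * e.
Proof.
move=> [tp Jp] [ts Js].
have h2 := dist_le (test_axpy (1/2) tp (test_axpy (-1) ts tp)).
have J1 := J_axpy 1 tp (test_axpy (-1) ts tp).
have J2 := J_axpy (1/2) tp (test_axpy (-1) ts tp).
have E : axpy phi 1 (axpy psi (-1) phi) = psi by apply/funext => z; rewrite /axpy; ring.
rewrite E in J1.
have GE : G (axpy psi (-1) phi) = G (axpy phi (-1) psi).
  rewrite /G !D1_axpy// !D2_axpy// !ip_axpy2; try exact: L1; try exact: L2.
  by rewrite (ipC (D1 psi)) (ipC (D2 psi)); ring.
rewrite GE in J1 J2; rewrite J2 in h2.
by move: J1 h2 Jp Js; lra.
Qed.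

Let LK f : L2T f -> L2T (fun z => K z * f z).
Proof. exact: L2T_continuousM. Qed.

Let CK f : test f -> continuous (fun z => K z * f z).
Proof. by move=> tf; apply: continuousM2 => //; exact: test_continuous. Qed.
Let PK f : test f -> periodic2 (fun z => K z * f z).
Proof. by move=> tf; apply: periodic2M => //; exact: tf.1. Qed.

(** Integrate K X^2 <= 2 K X Y + B (X - Y)^2, whose two sides differ by
    K Y^2 + (B - K) (X - Y)^2. *)
Let Kquad X Y B : L2T X -> L2T Y -> (forall z, cell R z -> K z <= B) ->
  ip (fun z => K z * X z) X <=
  2 * ip (fun z => K z * X z) Y + B * ip (axpy X (-1) Y) (axpy X (-1) Y).
Proof.
move=> x2 y2 KB; have xy2 := L2T_axpy (-1) x2 y2; have kx2 := LK x2.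
have i1 := L2T_tintegrableM kx2 y2; have i2 := L2T_tintegrableM kx2 x2;
  have i3 := L2T_tintegrableM xy2 xy2.
have E := tintD (tintegrableD (tintegrableZ 2 i1) (tintegrableZ B i3)) (tintegrableZ
  (-1) i2).
rewrite (tintD (tintegrableZ 2 i1) (tintegrableZ B i3)) (tintZ 2 i1) (tintZ B i3)
  (tintZ (-1) i2) in E.
rewrite -subr_ge0 -[X in _ - X]mul1r -mulNr /ip -E.
apply: tint_ge0 => z cz; have k0 := K0 cz; have kb := KB z cz.
rewrite /axpy; set x := X z; set y := Y z.
rewrite [leRHS](_ : _ = K z * y ^+ 2 + (B - K z) * (x - y) ^+ 2); last by ring.
by rewrite addr_ge0// mulr_ge0 ?sqr_ge0 ?subr_ge0// ltW.
Qed.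

(** Compare phi with a near-minimiser psi that is chosen after phi, so that the
    residual of psi is small against K grad phi.  The steady equation removes the
    pairing of K grad phi with grad p, and [G_diff] controls grad phi - grad psi. *)
Let KG_bound B e phi : (forall z, cell R z -> K z <= B) -> 0 < e -> near_min e phi ->
  ip (fun z => K z * D1 phi z) (D1 phi) + ip (fun z =>
    K z * D2 phi z) (D2 phi) <= 4 * B * e.
Proof.
move=> KB e0 nm; have tp := nm.1; have t1 := test_D1 tp; have t2 := test_D2 tp.
have B0 : 0 <= B.
  have cw : cell R (0, 0) by apply/cellP => /=; rewrite lexx mulr_ge0// pi_ge0.
  exact: (le_trans (ltW (K0 cw)) (KB _ cw)).
have q1 psi (ts : test psi) := Kquad (L1 tp) (L1 ts) KB.
have q2 psi (ts : test psi) := Kquad (L2 tp) (L2 ts) KB.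
have kx1 := LK (L1 tp); have kx2 := LK (L2 tp).
have W : ip (fun z => K z * D1 phi z) w1 + ip (fun z => K z * D2 phi z) w2 = 0.
  by rewrite -[RHS](Kw tp); congr (_ + _); apply: eq_tint => z _; ring.
set N := ip _ _ + ip _ _; rewrite leNgt; apply/negP => lt.
pose eta := (N - 4 * B * e) / 8; have eta0 : 0 < eta by rewrite divr_gt0// subr_gt0.
have [a a0 Ha] := small_cont (CK t1) (PK t1) eta0.
have [b b0 Hb] := small_cont (CK t2) (PK t2) eta0.
have [psi [ts Js]] : exists psi, near_min (Num.min e (Num.min a b)) psi.
  by apply: near_minP; rewrite !lt_min e0 a0.
have nme : near_min e psi by split => //; apply: (le_trans Js);
  rewrite lerD2l ge_min lexx.
have nma : near_min a psi by split => //; apply: (le_trans Js);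
  rewrite lerD2l !ge_min lexx orbT.
have nmb : near_min b psi by split => //; apply: (le_trans Js);
  rewrite lerD2l !ge_min lexx !orbT.
have [+ _] := Ha _ nma; have [_ +] := Hb _ nmb.
rewrite (ipC (v2 psi)) (ipC (v1 psi)).
rewrite (ip_axpyr _ w12 (L1 ts) kx1) (ip_axpyr _ w22 (L2 ts) kx2) !ler_norml.
move=> /andP[s1 s2] /andP[s3 s4].
have gd := ler_wpM2l B0 (G_diff nm nme).
have := q1 _ ts; have := q2 _ ts.
move: gd; rewrite /G (D1_axpy _ tp ts) (D2_axpy _ tp ts) mulrDr.
move: s1 s2 s3 s4 lt W; rewrite /eta /N; lra.
Qed.

Lemma continuous_cell_lb f : continuous f -> (forall z, cell R z -> 0 < f z) ->
  exists2 c : R, 0 < c & forall z, cell R z -> c <= f z.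
Proof.
move=> cf f0.
have C0 : (cell R : set (R * R)) !=set0.
  by exists (0, 0); apply/cellP => /=; rewrite lexx mulr_ge0// pi_ge0.
have [w cw wm] := compact_EVT_min C0 (@compact_cell R) (continuous_subspaceT cf).
exists (f w); first by apply: f0; rewrite inE in cw.
by move=> z cz; apply: wm; rewrite inE.
Qed.

(** If K grad p is weakly divergence free then grad p vanishes weakly: it is the sum of
    the residual, which tends weakly to 0, and of grad phi, which tends to 0 in L^2 by
    [KG_bound]. *)
Lemma grad_orthogonal h : continuous h -> periodic2 h -> ip w1 h = 0 /\ ip w2 h = 0.
Proof.
move=> ch ph; have h2 := L2T_continuous ch ph.
have [B B0 KB'] := continuous_cell_bounded cK.
have KB z : cell R z -> K z <= B by move=> /KB'; apply: le_trans; exact: ler_norm.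
have [c c0 Kc] := continuous_cell_lb cK K0.
have cX X : L2T X -> c * ip X X <= ip (fun z => K z * X z) X.
  move=> x2; rewrite /ip -tintZ; last exact: L2T_tintegrableM.
  apply: le_tint; [apply: tintegrableZ;
    exact: L2T_tintegrableM|apply: L2T_tintegrableM => //; exact: LK|].
  by move=> z cz; rewrite mulrA -mulrA -[leRHS]mulrA ler_wpM2r ?Kc// -expr2 sqr_ge0.
have H0 := ip_ge0 h.
have main eta : 0 < eta -> `|ip w1 h| <= eta * 2 /\ `|ip w2 h| <= eta * 2.
  move=> eta0; have [a a0 Ha] := small_cont ch ph eta0.
  (* The second bound makes the L^2 norm of grad phi times that of h at most eta. *)
  pose e := Num.min a (eta ^+ 2 * c / (4 * B * (ip h h + 1))).
  have D0 : 0 < 4 * B * (ip h h + 1) by rewrite !mulr_gt0//; lra.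
  have e0 : 0 < e by rewrite lt_min a0 divr_gt0// mulr_gt0// exprn_gt0.
  have [phi nm] := near_minP e0; have tp := nm.1.
  have nma : near_min a phi by split => //; apply: (le_trans nm.2);
    rewrite lerD2l ge_min lexx.
  have GB := KG_bound KB e0 nm.
  have c1 := cX _ (L1 tp); have c2 := cX _ (L2 tp).
  have eB : 4 * B * e * (ip h h + 1) <= eta ^+ 2 * c.
    have : e <= eta ^+ 2 * c / (4 * B * (ip h h + 1)) by rewrite ge_min lexx orbT.
    by rewrite ler_pdivlMr//; lra.
  have XH X : L2T X -> c * ip X X <= 4 * B * e -> `|ip X h| <= eta.
    move=> x2 xb; rewrite -ler_sqr ?nnegrE ?(ltW eta0)// real_normK ?num_real//.
    apply: (le_trans (ip_CS x2 h2)); rewrite -(ler_pM2l c0) mulrA.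
    apply: (@le_trans _ _ (4 * B * e * ip h h)); first by rewrite ler_wpM2r.
    rewrite [leRHS]mulrC; apply: le_trans eB; rewrite ler_wpM2l ?lerDl//.
    by rewrite !mulr_ge0// ltW.
  have g1 := ip_ge0 (D1 phi); have g2 := ip_ge0 (D2 phi).
  have x1 : `|ip (D1 phi) h| <= eta.
    by apply: XH (L1 tp) _; have := mulr_ge0 (ltW c0) g2; lra.
  have x2 : `|ip (D2 phi) h| <= eta.
    by apply: XH (L2 tp) _; have := mulr_ge0 (ltW c0) g1; lra.
  have [] := Ha _ nma; rewrite (ip_axpyl _ w12 (L1 tp) h2) (ip_axpyl _ w22 (L2 tp) h2).
  move: x1 x2; rewrite !ler_norml => /andP[? ?] /andP[? ?] /andP[? ?] /andP[? ?].
  by split; apply/andP; lra.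
by split; apply: (@eq0_small _ _ 2) => e /main[].
Qed.

End Energy.

(** * Fourier modes of a steady state *)

Section Classification.
Variable R : realType.
Implicit Types (f g h phi psi H : R * R -> R).

Lemma is_wD_even i j f g phi : ~~ odd (i + j) -> is_wD i j f g -> test phi ->
  ip f (iter i (@dtheta R) (iter j (@dzeta R) phi)) = ip g phi.
Proof.
move=> ij [_ H] /H; rewrite -/(ip f _) -/(ip g _) => ->.
by rewrite -signr_odd (negbTE ij) expr0 mul1r.
Qed.
Lemma is_wD_odd i j f g phi : odd (i + j) -> is_wD i j f g -> test phi ->
  ip f (iter i (@dtheta R) (iter j (@dzeta R) phi)) = - ip g phi.
Proof.
move=> ij [_ H] /H; rewrite -/(ip f _) -/(ip g _) => ->.
by rewrite -signr_odd ij expr1 mulN1r.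
Qed.

Lemma orth_test_continuous f : L2T f -> (forall phi, test phi -> ip f phi = 0) ->
  forall h, continuous h -> periodic2 h -> ip f h = 0.
Proof. by move=> f2 H h; apply: orth_trigmon_continuous => // j k s t; apply: H;
  exact: test_trigmon. Qed.

Lemma ipDl f g h : L2T f -> L2T g -> L2T h ->
  ip (fun z => f z + g z) h = ip f h + ip g h.
Proof.
move=> f2 g2 h2; rewrite -[ip g h]mul1r -ip_axpyl//; congr ip; apply/funext => z.
by rewrite /axpy mul1r.
Qed.
Lemma dtheta2_trigmon j k s t :
  dtheta (dtheta (@trigmon R j k s t)) = fun z => - j%:R ^+ 2 * trigmon j k s t z.
Proof.
rewrite dtheta_trigmon dthetaZ => [|z];
  last exact: test_derivable_theta (test_trigmon _ _ _ _).
rewrite dtheta_trigmon; apply/funext => z; rewrite /trigmon.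
have -> : j%:R * z.1 + (s + pi / 2 + pi / 2) = j%:R * z.1 + s + pi by field.
have -> : cos (j%:R * z.1 + s + pi) = - cos (j%:R * z.1 + s) by exact: cosDpi.
by ring.
Qed.
Lemma dzeta2_trigmon j k s t :
  dzeta (dzeta (@trigmon R j k s t)) = fun z => - k%:R ^+ 2 * trigmon j k s t z.
Proof.
rewrite dzeta_trigmon dzetaZ => [|z];
  last exact: test_derivable_zeta (test_trigmon _ _ _ _).
rewrite dzeta_trigmon; apply/funext => z; rewrite /trigmon.
have -> : k%:R * z.2 + (t + pi / 2 + pi / 2) = k%:R * z.2 + t + pi by field.
have -> : cos (k%:R * z.2 + t + pi) = - cos (k%:R * z.2 + t) by exact: cosDpi.
by ring.
Qed.

Lemma ip_laplace_trigmon j k s t (c : R) f : L2T f ->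
  ip f (dtheta (dtheta (fun z => c * trigmon j k s t z))) +
  ip f (dzeta (dzeta (fun z => c * trigmon j k s t z))) =
  - (j%:R ^+ 2 + k%:R ^+ 2) * c * ip f (trigmon j k s t).
Proof.
move=> f2; have tM := test_trigmon j k s t; have lM := L2T_test tM.
have X : dtheta (dtheta (fun z => c * trigmon j k s t z)) = fun z =>
  (c * - j%:R ^+ 2) * trigmon j k s t z.
  rewrite dthetaZ => [|z]; last exact: test_derivable_theta.
  rewrite dthetaZ => [|z]; last exact: test_derivable_theta (test_dtheta tM).
  by rewrite dtheta2_trigmon; apply/funext => z; rewrite mulrA.
have Y : dzeta (dzeta (fun z => c * trigmon j k s t z)) = fun z =>
  (c * - k%:R ^+ 2) * trigmon j k s t z.
  rewrite dzetaZ => [|z]; last exact: test_derivable_zeta.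
  rewrite dzetaZ => [|z]; last exact: test_derivable_zeta (test_dzeta tM).
  by rewrite dzeta2_trigmon; apply/funext => z; rewrite mulrA.
by rewrite X Y !ipZr//; ring.
Qed.

Section H4.
Variable H : R * R -> R.
Hypothesis H4 : H4T H.

Lemma H4_wD i j : (i + j <= 4)%N -> is_wD i j H (wD i j H).
Proof. by move=> ij; apply: wD_spec; case: H4 => _ _; apply. Qed.
Lemma H4T_L2T : L2T H.
Proof. by case: H4 => cH pH _; exact: L2T_continuous. Qed.

Let p z := laplace H z + H z.

Lemma L2T_p : L2T p.
Proof.
apply: L2TD; last exact: H4T_L2T.
by apply: L2TD; [exact: (@H4_wD 2 0 isT).1|exact: (@H4_wD 0 2 isT).1].
Qed.

Lemma ip_p f : L2T f -> ip p f = ip (wD 2 0 H) f + ip (wD 0 2 H) f + ip H f.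
Proof.
have [l1 l2] := ((@H4_wD 2 0 isT).1, (@H4_wD 0 2 isT).1); have l3 := H4T_L2T.
by move=> f2; rewrite /p ipDl//; [rewrite /laplace ipDl|exact: L2TD].
Qed.

Lemma ip_p_test phi : test phi ->
  ip p phi = ip H (dtheta (dtheta phi)) + ip H (dzeta (dzeta phi)) + ip H phi.
Proof.
move=> tp; rewrite ip_p; last exact: L2T_test.
have E1 := @is_wD_even 2 0 _ _ _ isT (@H4_wD 2 0 isT) tp;
  have E2 := @is_wD_even 0 2 _ _ _ isT (@H4_wD 0 2 isT) tp.
exact: esym (congr2 (fun a b => a + b + ip H phi) E1 E2).
Qed.

(** The derivative of p is assembled from third derivatives of H; the mixed one needs
    the symmetry of derivatives of the test function. *)
Lemma p_wD_dtheta : exists g, is_wD 1 0 p g.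
Proof.
have wa := @H4_wD 3 0 isT; have wb := @H4_wD 1 2 isT; have wc := @H4_wD 1 0 isT.
exists (fun z => wD 3 0 H z + wD 1 2 H z + wD 1 0 H z); split.
  by apply: L2TD; [apply: L2TD|]; [exact: wa.1|exact: wb.1|exact: wc.1].
move=> phi tp; rewrite -/(ip p (dtheta phi)) -/(ip _ phi).
have l2 := L2T_test tp.
rewrite ipDl//; [|by apply: L2TD; [exact: wa.1|exact: wb.1]|exact: wc.1].
rewrite (ipDl wa.1 wb.1 l2) ip_p_test; last exact: test_dtheta.
have E1 := @is_wD_odd 3 0 _ _ _ isT wa tp; have E2 := @is_wD_odd 1 2 _ _ _ isT wb tp;
  have E3 := @is_wD_odd 1 0 _ _ _ isT wc tp.
have C : dzeta (dzeta (dtheta phi)) = dtheta (dzeta (dzeta phi)).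
  by rewrite -(dtheta_dzeta tp) -(dtheta_dzeta (test_dzeta tp)).
apply: etrans (congr2 (fun a b => a + b) (congr2 (fun a b =>
  a + b) E1 (etrans (congr1 (ip H) C) E2)) E3) _.
by rewrite addn0 expr1 mulN1r !opprD.
Qed.

Lemma p_wD_dzeta : exists g, is_wD 0 1 p g.
Proof.
have wa := @H4_wD 2 1 isT; have wb := @H4_wD 0 3 isT; have wc := @H4_wD 0 1 isT.
exists (fun z => wD 2 1 H z + wD 0 3 H z + wD 0 1 H z); split.
  by apply: L2TD; [apply: L2TD|]; [exact: wa.1|exact: wb.1|exact: wc.1].
move=> phi tp; rewrite -/(ip p (dzeta phi)) -/(ip _ phi).
have l2 := L2T_test tp.
rewrite ipDl//; [|by apply: L2TD; [exact: wa.1|exact: wb.1]|exact: wc.1].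
rewrite (ipDl wa.1 wb.1 l2) ip_p_test; last exact: test_dzeta.
have E1 := @is_wD_odd 2 1 _ _ _ isT wa tp; have E2 := @is_wD_odd 0 3 _ _ _ isT wb tp;
  have E3 := @is_wD_odd 0 1 _ _ _ isT wc tp.
apply: etrans (congr2 (fun a b => a + b) (congr2 (fun a b => a + b) E1 E2) E3) _.
by rewrite add0n expr1 mulN1r !opprD.
Qed.

(** [grad_orthogonal] with weight H^3: the divergence g vanishes almost everywhere, so
    that H^3 grad p is orthogonal to gradients of test functions. *)
Lemma steady_grad0 gamma : 0 < gamma -> (forall z, 0 < H z) -> steady gamma H ->
  forall phi, test phi -> ip p (dtheta phi) = 0 /\ ip p (dzeta phi) = 0.
Proof.
move=> gamma0 H0 [g [g2 Hg] gae] phi tphi.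
have [cH pH _] := H4.
have s1 := wD_spec p_wD_dtheta; have s2 := wD_spec p_wD_dzeta.
have cK : continuous (fun z => H z ^+ 3).
  by apply: continuousM2 => //; exact: continuousM2.
have pK : periodic2 (fun z => H z ^+ 3) by move=> x y; rewrite (pH x y).1 (pH x y).2.
have e1 psi : test psi -> ip p (dtheta psi) = - ip (wD 1 0 p) psi.
  by move=> tp; exact: @is_wD_odd 1 0 _ _ _ isT s1 tp.
have e2 psi : test psi -> ip p (dzeta psi) = - ip (wD 0 1 p) psi.
  by move=> tp; exact: @is_wD_odd 0 1 _ _ _ isT s2 tp.
have gz psi : test psi -> ip g psi = 0.
  move=> tp; rewrite /ip /tint /Rintegral (@ae_eq_integral _ _ _ (leb2 R) (cell R)
    (cst 0%E)).
  - by rewrite integral_cst ?mul0e//; exact: measurable_cell.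
  - exact: measurable_cell.
  - apply/measurable_EFinP; apply: tintegrable_measurable;
    apply: L2T_tintegrableM => //; exact: L2T_test.
  - exact: measurable_cst.
  - apply: filterS gae => z gz cz; have := gz cz => /eqP.
    by rewrite mulf_eq0 gt_eqF//= => /eqP ->; rewrite mul0r.
have Kw psi : test psi -> ip (fun z => H z ^+ 3 * wD 1 0 p z) (dtheta psi) +
    ip (fun z => H z ^+ 3 * wD 0 1 p z) (dzeta psi) = 0.
  move=> tp; have := Hg _ tp; rewrite -/(ip g psi) gz// oppr0 tintD//.
    by apply: L2T_tintegrableM; [exact: L2T_continuousM s1.1|exact: L2T_test
      (test_dtheta tp)].
  by apply: L2T_tintegrableM; [exact: L2T_continuousM s2.1|exact: L2T_test
    (test_dzeta tp)].
have K0 z : cell R z -> 0 < H z ^+ 3 by move=> _; rewrite exprn_gt0.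
have [z1 z2] := grad_orthogonal erefl erefl cK pK K0 L2T_p s1.1 s2.1 e1 e2 Kw
  (test_continuous tphi) tphi.1.
by split; [exact: etrans (e1 _ tphi) (etrans (congr1 -%R z1) (oppr0 _))|
           exact: etrans (e2 _ tphi) (etrans (congr1 -%R z2) (oppr0 _))].
Qed.

(** p is orthogonal to j M and k M, where M is the monomial, since these are derivatives
    of phase-shifted monomials; and pairing p with M multiplies the coefficient of H
    by 1 - j^2 - k^2. *)
Lemma ip_H_trigmon j k s t :
  (forall phi, test phi -> ip p (dtheta phi) = 0 /\ ip p (dzeta phi) = 0) ->
  (j ^ 2 + k ^ 2 != 0)%N -> (j ^ 2 + k ^ 2 != 1)%N -> ip H (trigmon j k s t) = 0.
Proof.
move=> Hp n0 n1; have l2 := H4T_L2T.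
have key (c : R) : ip p (fun z => c * trigmon j k s t z) = 0 ->
    c * (1 - (j ^ 2 + k ^ 2)%:R) * ip H (trigmon j k s t) = 0.
  have tM := test_trigmon j k s t; have tcM := testZ c tM.
  rewrite ip_p_test// (ip_laplace_trigmon j k s t c l2) ipZr//; last exact: L2T_test.
  by move=> <-; rewrite natrD !natrX; ring.
have j0 : j%:R * (1 - (j ^ 2 + k ^ 2)%:R) * ip H (trigmon j k s t) = 0.
  apply: key; have := (Hp _ (test_trigmon j k (s - pi / 2) t)).1.
  by rewrite dtheta_trigmon subrK.
have k0 : k%:R * (1 - (j ^ 2 + k ^ 2)%:R) * ip H (trigmon j k s t) = 0.
  apply: key; have := (Hp _ (test_trigmon j k s (t - pi / 2))).2.
  by rewrite dzeta_trigmon subrK.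
have d0 : 1 - (j ^ 2 + k ^ 2)%:R != 0 :> R.
  by rewrite subr_eq0 eq_sym -[1]/(1%:R) eqr_nat.
have [jz|jn] := eqVneq j 0%N.
  have kn : (k%:R : R) != 0 by move: n0; rewrite jz pnatr_eq0; apply: contra => /eqP ->.
  by move/eqP: k0; rewrite !mulf_eq0 (negbTE kn) (negbTE d0) => /eqP.
have jn' : (j%:R : R) != 0 by rewrite pnatr_eq0.
by move/eqP: j0; rewrite !mulf_eq0 (negbTE jn') (negbTE d0) => /eqP.
Qed.

End H4.

(** The monomials are eigenfunctions of the symmetric operator dtheta^2, for distinct
    eigenvalues. *)
Lemma ip_trigmon_theta j k s t j' k' s' t' : j != j' ->
  ip (@trigmon R j k s t) (trigmon j' k' s' t') = 0.
Proof.
move=> jj; have tM := test_trigmon j k s t; have tM' := test_trigmon j' k' s' t'.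
have E' := etrans (ip_dtheta (test_dtheta tM) tM') (etrans (congr1 -%R (ip_dtheta tM
  (test_dtheta tM'))) (opprK _)).
have lM := L2T_test tM; have lM' := L2T_test tM'.
have E1 := etrans (congr1 (fun f =>
  ip f (trigmon j' k' s' t')) (dtheta2_trigmon j k s t)) (ipZl _ lM lM').
have E2 := etrans (congr1 (ip (trigmon j k s t)) (dtheta2_trigmon j' k' s' t')) (ipZr
  _ lM' lM).
have := etrans (esym E1) (etrans E' E2).
move=> /eqP; rewrite -subr_eq0 -mulrBl mulf_eq0 => /orP[|/eqP//].
rewrite opprK addrC subr_eq0 -!natrX eqr_nat eqn_exp2r// => /eqP e.
by rewrite e eqxx in jj.
Qed.

Lemma ip_trigmon_zeta j k s t j' k' s' t' : k != k' ->
  ip (@trigmon R j k s t) (trigmon j' k' s' t') = 0.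
Proof.
move=> kk; have tM := test_trigmon j k s t; have tM' := test_trigmon j' k' s' t'.
have E' := etrans (ip_dzeta (test_dzeta tM) tM') (etrans (congr1 -%R (ip_dzeta tM
  (test_dzeta tM'))) (opprK _)).
have lM := L2T_test tM; have lM' := L2T_test tM'.
have E1 := etrans (congr1 (fun f =>
  ip f (trigmon j' k' s' t')) (dzeta2_trigmon j k s t)) (ipZl _ lM lM').
have E2 := etrans (congr1 (ip (trigmon j k s t)) (dzeta2_trigmon j' k' s' t')) (ipZr
  _ lM' lM).
have := etrans (esym E1) (etrans E' E2).
move=> /eqP; rewrite -subr_eq0 -mulrBl mulf_eq0 => /orP[|/eqP//].
rewrite opprK addrC subr_eq0 -!natrX eqr_nat eqn_exp2r// => /eqP e.
by rewrite e eqxx in kk.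
Qed.

End Classification.

(** * Steady states are trigonometric polynomials of degree one *)

Section Family.
Variable R : realType.
Implicit Types (f g h phi psi H : R * R -> R).

Definition wave (m al be b : R) : R * R -> R :=
  fun z => m + al * cos z.1 + be * sin z.1 + b * cos z.2.

Notation one := (@trigmon R 0 0 0 0).
Notation mc := (@trigmon R 1 0 0 0).
Notation ms := (@trigmon R 1 0 (- (pi / 2)) 0).
Notation nc := (@trigmon R 0 1 0 0).
Notation ns := (@trigmon R 0 1 0 (- (pi / 2))).

Lemma trigmon_theta1 s z : @trigmon R 1 0 s 0 z = cos (z.1 + s).
Proof. by rewrite /trigmon mul1r mul0r addr0 cos0 mulr1. Qed.
Lemma trigmon_zeta1 t z : @trigmon R 0 1 0 t z = cos (z.2 + t).
Proof. by rewrite /trigmon mul1r mul0r addr0 cos0 mul1r. Qed.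
Lemma trigmon_00 s t z : @trigmon R 0 0 s t z = cos s * cos t.
Proof. by rewrite /trigmon !mul0r !add0r. Qed.
Lemma mcE z : mc z = cos z.1. Proof. by rewrite trigmon_theta1 addr0. Qed.
Lemma msE z : ms z = sin z.1. Proof. by rewrite trigmon_theta1 cosBpihalf. Qed.
Lemma ncE z : nc z = cos z.2. Proof. by rewrite trigmon_zeta1 addr0. Qed.
Lemma nsE z : ns z = sin z.2. Proof. by rewrite trigmon_zeta1 cosBpihalf. Qed.
Lemma oneE z : one z = 1. Proof. by rewrite trigmon_00 cos0 mulr1. Qed.

Let T j k s t : test (@trigmon R j k s t). Proof. exact: test_trigmon. Qed.
Let L j k s t : L2T (@trigmon R j k s t). Proof. exact: L2T_test. Qed.

Lemma ip_trigmon_neq j k s t j' k' s' t' : (j, k) != (j', k') ->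
  ip (@trigmon R j k s t) (trigmon j' k' s' t') = 0.
Proof.
rewrite -pair_eqE negb_and => /orP[]; [exact: ip_trigmon_theta|exact: ip_trigmon_zeta].
Qed.

Lemma tint_trigmon j k s t : (j, k) != (0, 0)%N -> tint (@trigmon R j k s t) = 0.
Proof.
move=> jk; rewrite -(@ip_trigmon_neq j k s t 0 0 0 0 jk); apply: eq_tint => z _.
by rewrite oneE mulr1.
Qed.

Lemma ip_theta1 s s' : ip (@trigmon R 1 0 s 0) (trigmon 1 0 s' 0) = 2 * pi ^+ 2 * cos
  (s - s').
Proof.
rewrite /ip (@eq_tint _ _ (fun z =>
  2^-1 * trigmon 2 0 (s + s') 0 z + 2^-1 * cos (s - s'))).
  rewrite tintD; [|exact: tintegrableZ (L2T_tintegrable (L _ _ _ _))|exact: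
    L2T_tintegrable (L2T_test (test_cst _))].
  rewrite tintZ; last exact: L2T_tintegrable.
  by rewrite tint_trigmon// tint_cst; field.
move=> z _; rewrite !trigmon_theta1 /trigmon mul0r addr0 cos0 mulr1.
have -> : 2 * z.1 + (s + s') = (z.1 + s) + (z.1 + s') by ring.
have -> : s - s' = (z.1 + s) - (z.1 + s') by ring.
by rewrite (cosD (z.1 + s)) (cosB (z.1 + s)); field.
Qed.

Lemma ip_zeta1 s s' : ip (@trigmon R 0 1 0 s) (trigmon 0 1 0 s') = 2 * pi ^+ 2 * cos
  (s - s').
Proof.
rewrite /ip (@eq_tint _ _ (fun z =>
  2^-1 * trigmon 0 2 0 (s + s') z + 2^-1 * cos (s - s'))).
  rewrite tintD; [|exact: tintegrableZ (L2T_tintegrable (L _ _ _ _))|exact: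
    L2T_tintegrable (L2T_test (test_cst _))].
  rewrite tintZ; last exact: L2T_tintegrable.
  by rewrite tint_trigmon// tint_cst; field.
move=> z _; rewrite !trigmon_zeta1 /trigmon mul0r addr0 cos0 mul1r.
have -> : 2 * z.2 + (s + s') = (z.2 + s) + (z.2 + s') by ring.
have -> : s - s' = (z.2 + s) - (z.2 + s') by ring.
by rewrite (cosD (z.2 + s)) (cosB (z.2 + s)); field.
Qed.

Definition trig5 (a al be b e : R) : R * R ->
  R := axpy (axpy (axpy (axpy (fun z => a * one z) al mc) be ms) b nc) e ns.

Lemma test_trig5 a al be b e : test (trig5 a al be b e).
Proof. by do 4 (apply: test_axpy => //); exact: testZ. Qed.

Lemma ip_trig5 a al be b e M : L2T M ->
  ip (trig5 a al be b e) M = a * ip one M + al * ip mc M + be * ip ms M + b * ip nc M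
    + e * ip ns M.
Proof.
move=> l2; have l0 : L2T (fun z => a * one z) by exact: L2TZ.
have l1 := L2T_axpy al l0 (L 1 0 0 0); have l3 := L2T_axpy be l1 (L 1 0 (-(pi/2)) 0).
have l4 := L2T_axpy b l3 (L 0 1 0 0).
by rewrite /trig5 !ip_axpyl// ipZl.
Qed.

Lemma trig5E a al be b : trig5 a al be b 0 = wave a al be b.
Proof.
by apply/funext => z; rewrite /trig5 /axpy /wave oneE mcE msE ncE mul0r addr0 mulr1.
Qed.

Lemma test_wave m al be b : test (wave m al be b).
Proof. by rewrite -trig5E; exact: test_trig5. Qed.

Lemma ip_one_one : ip one one = 4 * pi ^+ 2.
Proof.
rewrite /ip (@eq_tint _ _ (fun=> 1)) ?tint_cst; first by ring.
by move=> z _; rewrite oneE mulr1.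
Qed.

(** The difference of H and its projection to frequencies at most 1 is orthogonal to
    every monomial. *)
Lemma steady_is_wave H m gamma : H4ev H -> 0 < gamma -> (forall z, 0 < H z) ->
  mean H = m ->
  steady gamma H -> exists al be b, H = wave m al be b.
Proof.
move=> [H4 Hev] gamma0 H0 mH st; have Hp := steady_grad0 H4 gamma0 H0 st.
have l2 := H4T_L2T H4; have [cH pH _] := H4.
have p0 : (pi : R) != 0 by rewrite gt_eqF// pi_gt0.
(* 2 pi^2 is the squared norm of cos theta, and of the other three functions of
   frequency 1. *)
pose q : R := (2 * pi ^+ 2)^-1.
pose al := ip H mc * q; pose be := ip H ms * q; pose b := ip H nc * q;
  pose e := ip H ns * q.
have H1 : ip H one = 4 * pi ^+ 2 * m.
  rewrite -mH /mean mulrA divff ?mul1r; last by rewrite mulf_neq0// expf_neq0.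
  by apply: eq_tint => z _; rewrite oneE mulr1.
have tT := test_trig5 m al be b e; have lT := L2T_test tT.
have D0 : axpy H (-1) (trig5 m al be b e) = fun=> 0.
  apply: orth_trigmon_eq0 => [||j k s t].
  - apply: continuousD2 => //; apply: continuousM2; [by move=> ?;
    exact: cvg_cst|exact: test_continuous].
  - by apply: periodic2D => //; apply: periodic2Z; exact: tT.1.
  rewrite ip_axpyl// ip_trig5//.
  have c00 : cos (0 - 0 : R) = 1 by rewrite subr0 cos0.
  have cmp : cos (- (pi / 2) - 0 : R) = 0 by rewrite subr0 cosN cos_pihalf.
  have cpm : cos (0 - - (pi / 2) : R) = 0 by rewrite sub0r opprK cos_pihalf.
  have cpp : cos (- (pi / 2) - - (pi / 2) : R) = 1 by rewrite subrr cos0.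
  have [/eqP|n0] := eqVneq (j ^ 2 + k ^ 2)%N 0%N.
    rewrite addn_eq0 !expn_eq0/= !andbT => /andP[/eqP -> /eqP ->].
    have -> : trigmon 0 0 s t = fun z => (cos s * cos t) * one z.
      by apply/funext => z; rewrite oneE trigmon_00 mulr1.
    rewrite !ipZr// H1 ip_one_one !ip_trigmon_neq//; ring.
  have [jk1|n1] := eqVneq (j ^ 2 + k ^ 2)%N 1%N.
    have [[-> ->]|[-> ->]] : (j = 1 /\ k = 0)%N \/ (j = 0 /\ k = 1)%N.
      by move: jk1; case: j n0 => [|[|j]]; case: k => [|[|k]] //=; auto;
        rewrite ?expnS; lia.
    - have -> : trigmon 1 0 s t = axpy (fun z =>
      (cos t * cos s) * mc z) (- (cos t * sin s)) ms.
        apply/funext => z; rewrite /axpy mcE msE /trigmon mul1r mul0r add0r cosD; ring.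
      have lc : L2T (fun z => (cos t * cos s) * mc z) by exact: L2TZ.
      rewrite !ip_axpyr// !ipZr// !ip_theta1 !c00 cmp cpm cpp.
      rewrite (@ip_trigmon_neq 0 0)// (@ip_trigmon_neq 0 0)// !(@ip_trigmon_neq 0 1)//.
      rewrite /al /be /q; move: p0; generalize (pi : R) => P P0; by field.
    - have -> : trigmon 0 1 s t = axpy (fun z =>
      (cos s * cos t) * nc z) (- (cos s * sin t)) ns.
        apply/funext => z; rewrite /axpy ncE nsE /trigmon mul1r mul0r add0r cosD; ring.
      have lc : L2T (fun z => (cos s * cos t) * nc z) by exact: L2TZ.
      rewrite !ip_axpyr// !ipZr// !ip_zeta1 !c00 cmp cpm cpp.
      rewrite (@ip_trigmon_neq 0 0)// (@ip_trigmon_neq 0 0)// !(@ip_trigmon_neq 1 0)//.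
      rewrite /b /e /q; move: p0; generalize (pi : R) => P P0; by field.
  rewrite (ip_H_trigmon H4 s t Hp n0 n1).
  have jk00 : (0, 0)%N != (j, k) by apply: contra n0 => /eqP[<- <-].
  have jk10 : (1, 0)%N != (j, k) by apply: contra n1 => /eqP[<- <-].
  have jk01 : (0, 1)%N != (j, k) by apply: contra n1 => /eqP[<- <-].
  by rewrite !ip_trigmon_neq//; ring.
have HT z : H z = trig5 m al be b e z.
  by have := congr1 (@^~ z) D0; rewrite /axpy mulN1r => /eqP; rewrite subr_eq0 => /eqP.
(* Evenness at (0, pi / 2), where sin zeta = 1. *)
have e0 : e = 0.
  have := Hev 0 (pi / 2); rewrite !HT /trig5 /axpy !nsE !ncE/= sinN cosN sin_pihalf.
  have -> : forall u : R * R, one u = 1 by exact: oneE.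
  by rewrite !mcE !msE/= !oneE; lra.
by exists al, be, b; apply/funext => z; rewrite HT e0 trig5E.
Qed.

End Family.

(** * The set of steady states *)

Section Equality.
Variable R : realType.
Implicit Types (f g h phi psi H : R * R -> R).

Lemma test_H4T f : test f -> H4T f.
Proof.
move=> tf; split; [exact: test_continuous|exact: tf.1|].
by move=> i j _; exists (strongD i j f); exact: test_is_wD.
Qed.

Lemma wave_even m al be b (x y : R) : wave m al be b (x, - y) = wave m al be b (x, y).
Proof. by rewrite /wave/= cosN. Qed.

Lemma wave_H4ev m al be b : H4ev (@wave R m al be b).
Proof. by split; [exact/test_H4T/test_wave|move=> x y; exact: wave_even]. Qed.

Lemma mean_wave m al be b : mean (@wave R m al be b) = m.
Proof.
have p0 : (pi : R) != 0 by rewrite gt_eqF// pi_gt0.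
have -> : mean (wave m al be b) = (4 * pi ^+ 2)^-1 * ip (wave m al be b) (trigmon 0 0
  0 0).
  by rewrite /mean; congr (_ * _); apply: eq_tint => z _; rewrite oneE mulr1.
rewrite -trig5E ip_trig5; last exact: L2T_test (test_trigmon _ _ _ _).
rewrite ip_one_one !ip_trigmon_neq//; move: p0; generalize (pi : R) => P P0; by field.
Qed.

Lemma ip_trigmon_dtheta2 j k s t psi : test psi ->
  ip (@trigmon R j k s t) (dtheta (dtheta psi)) = - j%:R ^+ 2 * ip (trigmon j k s t)
    psi.
Proof.
move=> tp; have tM := test_trigmon j k s t : test (@trigmon R j k s t).
have t1 := test_dtheta tM; have t2 := test_dtheta tp.
have E1 := etrans (congr1 -%R (ip_dtheta tM t2)) (opprK _).
have E2 := ip_dtheta t1 tp.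
apply: etrans (esym E1) (etrans (esym E2) _).
apply: etrans (congr1 (fun f => ip f psi) (dtheta2_trigmon j k s t)) _.
by apply: ipZl; exact: L2T_test.
Qed.
Lemma ip_trigmon_dzeta2 j k s t psi : test psi ->
  ip (@trigmon R j k s t) (dzeta (dzeta psi)) = - k%:R ^+ 2 * ip (trigmon j k s t) psi.
Proof.
move=> tp; have tM := test_trigmon j k s t : test (@trigmon R j k s t).
have t1 := test_dzeta tM; have t2 := test_dzeta tp.
have E1 := etrans (congr1 -%R (ip_dzeta tM t2)) (opprK _).
have E2 := ip_dzeta t1 tp.
apply: etrans (esym E1) (etrans (esym E2) _).
apply: etrans (congr1 (fun f => ip f psi) (dzeta2_trigmon j k s t)) _.
by apply: ipZl; exact: L2T_test.
Qed.

Lemma wave_laplace m al be b psi : test psi ->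
  ip (wave m al be b) (dtheta (dtheta psi)) + ip (wave m al be b) (dzeta (dzeta psi)) +
  ip (wave m al be b) psi = m * tint psi.
Proof.
move=> tp; rewrite -trig5E.
have F1 := ip_trig5 m al be b 0 (L2T_test (test_dtheta (test_dtheta tp))).
have F2 := ip_trig5 m al be b 0 (L2T_test (test_dzeta (test_dzeta tp))).
have F3 := ip_trig5 m al be b 0 (L2T_test tp).
apply: etrans (congr2 (fun a b => a + b) (congr2 (fun a b => a + b) F1 F2) F3) _.
have G1 j k s t := @ip_trigmon_dtheta2 j k s t psi tp.
have G2 j k s t := @ip_trigmon_dzeta2 j k s t psi tp.
have -> : tint psi = ip (trigmon 0 0 0 0) psi.
  by apply: eq_tint => z _; rewrite oneE mul1r.
move: G1 G2; generalize (dtheta (dtheta psi)) (dzeta (dzeta psi)) => P P' G1 G2.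
by rewrite !G1 !G2; ring.
Qed.

Lemma tint_dtheta_test psi : test psi -> tint (dtheta psi) = 0.
Proof.
move=> tp; have t1 := test_dtheta tp.
apply: (tint_dtheta tp.1 (test_continuous t1) t1.1) => z.
by apply: derivableP; exact: test_derivable_theta.
Qed.
Lemma tint_dzeta_test psi : test psi -> tint (dzeta psi) = 0.
Proof.
move=> tp; have t1 := test_dzeta tp.
apply: (tint_dzeta tp.1 (test_continuous t1) t1.1) => z.
by apply: derivableP; exact: test_derivable_zeta.
Qed.

(** Here p is weakly constant, so the selected derivatives of p are orthogonal to test
    functions, hence to the continuous functions H^3 dtheta phi and H^3 dzeta phi. *)
Lemma wave_steady (gamma m al be b : R) : steady gamma (wave m al be b).
Proof.
set H := wave m al be b; have tH : test H by exact: test_wave.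
have H4 := test_H4T tH.
exists (fun=> 0); last by apply/aeW => z _; rewrite mulr0.
split; first exact: L2T_test (test_cst _).
move=> phi tphi; have [cH pH _] := H4.
have cK : continuous (fun z => H z ^+ 3) by apply: continuousM2 => //;
  exact: continuousM2.
have pK : periodic2 (fun z => H z ^+ 3) by move=> x y; rewrite (pH x y).1 (pH x y).2.
pose p := fun z => laplace H z + H z.
have Ep psi : test psi -> ip p psi = m * tint psi.
  by move=> tp; rewrite (ip_p_test H4 tp); exact: wave_laplace.
clearbody H.
have s1 := wD_spec (p_wD_dtheta H4); have s2 := wD_spec (p_wD_dzeta H4).
have z1 psi : test psi -> ip (wD 1 0 p) psi = 0.
  move=> tp; apply/eqP; rewrite -oppr_eq0; apply/eqP.
  apply: etrans (esym (@is_wD_odd _ 1 0 _ _ _ isT s1 tp)) _.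
  apply: etrans (Ep _ (test_dtheta tp)) _.
  by rewrite tint_dtheta_test ?mulr0.
have z2 psi : test psi -> ip (wD 0 1 p) psi = 0.
  move=> tp; apply/eqP; rewrite -oppr_eq0; apply/eqP.
  apply: etrans (esym (@is_wD_odd _ 0 1 _ _ _ isT s2 tp)) _.
  apply: etrans (Ep _ (test_dzeta tp)) _.
  by rewrite tint_dzeta_test ?mulr0.
have t1 := test_dtheta tphi; have t2 := test_dzeta tphi.
have c1 := continuousM2 cK (test_continuous t1);
  have c2 := continuousM2 cK (test_continuous t2).
have p1 := periodic2M pK t1.1; have p2 := periodic2M pK t2.1.
have arith (k u v w x : R) : k * u * v + k * w * x = u * (k * v) + w * (k * x) by ring.
rewrite (@eq_tint R (fun z => 0 * phi z) (fun=> 0)) => [|z _]; last by rewrite mul0r.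
rewrite tint_cst mul0r oppr0.
rewrite (@eq_tint _ _ (fun z => wD 1 0 p z * (H z ^+ 3 * dtheta phi z) +
   wD 0 1 p z * (H z ^+ 3 * dzeta phi z))) => [|z _]; last first.
  exact: arith.
rewrite tintD; [|exact: L2T_tintegrableM s1.1 (L2T_continuous c1 p1)|exact:
  L2T_tintegrableM s2.1 (L2T_continuous c2 p2)].
exact: etrans (congr2 (fun a b =>
  a + b) (orth_test_continuous s1.1 z1 c1 p1) (orth_test_continuous s2.1 z2 c2 p2))
  (addr0 _).
Qed.

(** Polar coordinates, with t = acos (x / r) or its opposite according to the sign
    of y. *)
Lemma polar_exists (x y : R) : exists2 t, x = Num.sqrt (x ^+ 2 + y ^+ 2) * cos t &
   y = Num.sqrt (x ^+ 2 + y ^+ 2) * sin t.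
Proof.
set r := Num.sqrt _.
have r2 : r ^+ 2 = x ^+ 2 + y ^+ 2 by rewrite sqr_sqrtr// addr_ge0 ?sqr_ge0.
have [r0|rn] := eqVneq r 0.
  exists 0; rewrite r0 mul0r; move: r2; rewrite r0 expr0n/= => /esym/eqP;
    by rewrite paddr_eq0 ?sqr_ge0// !sqrf_eq0 => /andP[/eqP ? /eqP ?].
have rp : 0 < r by rewrite lt_neqAle eq_sym rn sqrtr_ge0.
have xr : -1 <= x / r <= 1.
  rewrite -ler_norml normrM normfV (gtr0_norm rp) ler_pdivrMr// mul1r.
  rewrite -ler_sqr ?nnegrE ?(ltW rp)// real_normK ?num_real// r2 lerDl sqr_ge0 //.
have s2 : sin (acos (x / r)) = `|y| / r.
  rewrite sin_acos// (_ : 1 - _ = (y / r) ^+ 2); last first.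
    by rewrite !expr_div_n r2; field; rewrite -r2 expf_neq0.
  by rewrite sqrtr_sqr normrM normfV (gtr0_norm rp).
have c2 : cos (acos (x / r)) = x / r by rewrite acosK// in_itv/=.
have [y0|y0] := leP 0 y.
  exists (acos (x / r)); first by rewrite c2 mulrCA divff// mulr1.
  by rewrite s2 ger0_norm// mulrCA divff// mulr1.
exists (- acos (x / r)); first by rewrite cosN c2 mulrCA divff// mulr1.
by rewrite sinN s2 ltr0_norm// mulNr opprK mulrCA divff// mulr1.
Qed.

Lemma cos_sin_ge (al be t : R) : - Num.sqrt (al ^+ 2 + be ^+ 2) <= al * cos t + be *
  sin t.
Proof.
rewrite lerNl; apply: le_trans (ler_norm _) _; rewrite normrN.
rewrite -ler_sqr ?nnegrE ?sqrtr_ge0// real_normK ?num_real// sqr_sqrtr ?addr_ge0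
  ?sqr_ge0//.
have ct := cos2Dsin2 t; have := sqr_ge0 (al * sin t - be * cos t).
have -> : al ^+ 2 + be ^+ 2 = (al ^+ 2 + be ^+ 2) * (cos t ^+ 2 + sin t ^+ 2) by
  rewrite ct mulr1.
by move=> H; rewrite -subr_ge0; apply: le_trans H _; rewrite le_eqVlt; apply/orP;
  left; apply/eqP; ring.
Qed.

(** The minimum of al cos theta + be sin theta is - sqrt (al^2 + be^2), and that of
    b cos zeta is - |b|. *)
Lemma wave_pos m al be b : (forall z, 0 < @wave R m al be b z) <->
  Num.sqrt (al ^+ 2 + be ^+ 2) + `|b| < m.
Proof.
split => [H0|lt z].
  have [t tx ty] := polar_exists al be; set r := Num.sqrt _ in tx ty *.
  have [s cs] : exists s, b * cos s = - `|b|.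
    have [b0|b0] := leP 0 b; first by exists pi; rewrite cospi mulrN1 ger0_norm.
    by exists 0; rewrite cos0 mulr1 ltr0_norm// opprK.
  (* (t + pi, s) is a point where the minimum is attained. *)
  have := H0 (t + pi, s); rewrite /wave/= cs.
  have -> : cos (t + pi) = - cos t by exact: cosDpi.
  have -> : sin (t + pi) = - sin t by exact: sinDpi.
  have -> : m + al * - cos t + be * - sin t = m - r * (cos t ^+ 2 + sin t ^+ 2).
    by rewrite {1}tx {1}ty; ring.
  by rewrite cos2Dsin2 mulr1; lra.
have := cos_sin_ge al be z.1.
have : - `|b| <= b * cos z.2.
  rewrite lerNl; apply: le_trans (ler_norm _) _; rewrite normrN normrM ler_piMr//.
  exact: cos_max.
by rewrite /wave; lra.
Qed.

(** a_1 = (al - i be) / 2 and a_{-1} is its conjugate. *)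
Lemma MsetP m H : Mset m H <-> exists al be b, H = wave m al be b /\
  Num.sqrt (al ^+ 2 + be ^+ 2) + `|b| < m.
Proof.
have nrm (c d : R) : Num.sqrt (c ^+ 2 + d ^+ 2) + Num.sqrt (c ^+ 2 + d ^+ 2) =
    Num.sqrt ((2 * c) ^+ 2 + (2 * d) ^+ 2).
  have -> : (2 * c) ^+ 2 + (2 * d) ^+ 2 = (c ^+ 2 + d ^+ 2) * 2 ^+ 2 by ring.
  rewrite sqrtrM ?addr_ge0 ?sqr_ge0// sqrtr_sqr ger0_norm//; ring.
split.
  move=> [am [[c d] [b [-> nb HE]]]]; exists (2 * c), (- (2 * d)), b; split.
    apply/funext => -[x y]; have := HE x y.
    rewrite /expi cosN sinN /wave => /(congr1 (@complex.Re R)) /= ->; ring.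
  by move: nb; rewrite /Normc.normc/= sqrrN nrm sqrrN.
move=> [al [be [b [-> lt]]]]; exists (al / 2 +i* (be / 2))%C,
  (al / 2 -i* (be / 2))%C, b; split.
- by apply/eqP; rewrite eq_complex/= opprK !eqxx.
- rewrite /Normc.normc/= sqrrN nrm.
  have -> : 2 * (al / 2) = al by field.
  by have -> : 2 * (be / 2) = be by field.
- move=> x y; apply/eqP; rewrite eq_complex /expi cosN sinN /wave/=.
  by apply/andP; split; apply/eqP; field.
Qed.

Lemma steady_states_Mset gamma m : 0 < gamma ->
  positive_steady_states gamma m = @Mset R m.
Proof.
move=> gamma0; apply/seteqP; split => H.
  move=> [H4 H0 mH st]; have [al [be [b HE]]] := steady_is_wave H4 gamma0 H0 mH st.
  apply/MsetP; exists al, be, b; split => //; apply/wave_pos => z; rewrite -HE;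
    exact: H0.
move=> /MsetP[al [be [b [-> lt]]]]; split.
- exact: wave_H4ev.
- by apply/wave_pos.
- exact: mean_wave.
- exact: wave_steady.
Qed.

End Equality.

(** * The manifold structure *)

Section Manifold.
Variable R : realType.
Implicit Types (f g h phi psi H : R * R -> R).

Lemma iter_dtheta_axpy i f c g : test f -> test g ->
  iter i (@dtheta R) (axpy f c g) = axpy (iter i (@dtheta R) f) c (iter i (@dtheta R)
    g).
Proof.
move=> tf tg; elim: i => [//|i IH]; rewrite iterS IH.
exact: dtheta_axpy (test_iter_dzeta_dtheta i 0 tf) (test_iter_dzeta_dtheta i 0 tg).
Qed.
Lemma iter_dzeta_axpy i f c g : test f -> test g ->
  iter i (@dzeta R) (axpy f c g) = axpy (iter i (@dzeta R) f) c (iter i (@dzeta R) g).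
Proof.
move=> tf tg; elim: i => [//|i IH]; rewrite iterS IH.
exact: dzeta_axpy (test_iter_dzeta_dtheta 0 i tf) (test_iter_dzeta_dtheta 0 i tg).
Qed.
Lemma strongD_axpy i j f c g : test f -> test g ->
  strongD i j (axpy f c g) = axpy (strongD i j f) c (strongD i j g).
Proof.
move=> tf tg; rewrite /strongD iter_dtheta_axpy//.
exact: iter_dzeta_axpy (test_iter_dzeta_dtheta i 0 tf) (test_iter_dzeta_dtheta i 0 tg).
Qed.

(** The square of [H4norm], for test functions. *)
Definition H4sq f : R := \sum_(i < 5) \sum_(j < 5 | (i + j <= 4)%N) ip (strongD i j
  f) (strongD i j f).

Lemma H4norm_test f : test f -> H4norm f = Num.sqrt (H4sq f).
Proof.
move=> tf; congr Num.sqrt; apply: eq_bigr => i _; apply: eq_bigr => j _.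
exact: tint_wD_sq (test_is_wD i j tf).
Qed.

Lemma H4sq_ge0 f : 0 <= H4sq f.
Proof. by apply: sumr_ge0 => i _; apply: sumr_ge0 => j _; exact: ip_ge0. Qed.

(** From |f + c g|^2 <= 2 |f|^2 + 2 c^2 |g|^2. *)
Lemma H4sq_axpy f c g : test f -> test g ->
  H4sq (axpy f c g) <= 2 * H4sq f + 2 * c ^+ 2 * H4sq g.
Proof.
move=> tf tg; rewrite /H4sq !mulr_sumr -big_split/=; apply: ler_sum => i _.
rewrite !mulr_sumr -big_split/=; apply: ler_sum => j _.
have l1 := L2T_test (test_strongD i j tf); have l2 := L2T_test (test_strongD i j tg).
rewrite strongD_axpy//; have := ip_ge0 (axpy (strongD i j f) (- c) (strongD i j g)).
rewrite !ip_axpy2//; lra.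
Qed.

Lemma H4sq0 : H4sq (fun=> 0) = 0.
Proof.
have D1 k : iter k (@dtheta R) (fun=> 0) = fun=> 0.
  by elim: k => [//|k IH]; rewrite iterS IH dtheta_cst.
have D2 k : iter k (@dzeta R) (fun=> 0) = fun=> 0.
  by elim: k => [//|k IH]; rewrite iterS IH dzeta_cst.
rewrite /H4sq big1// => i _; rewrite big1// => j _.
by rewrite /strongD D1 D2; exact: ip0r.
Qed.

Lemma H4sq_scale c f : test f -> H4sq (fun z => c * f z) <= 2 * c ^+ 2 * H4sq f.
Proof.
move=> tf; have t0 := @test_cst R 0.
have -> : (fun z => c * f z) = axpy (fun=> 0) c f by apply/funext => z;
  rewrite /axpy add0r.
by apply: (le_trans (H4sq_axpy c t0 tf)); rewrite H4sq0 mulr0 add0r.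
Qed.

Lemma H4norm0 : H4norm (fun _ : R * R => 0 : R) = 0.
Proof.
have t0 := @test_cst R 0; rewrite H4norm_test//.
by rewrite H4sq0 sqrtr0.
Qed.

(** The term of order (0, 0) in the norm. *)
Lemma ip_le_H4norm f : continuous f -> periodic2 f -> ip f f <= H4norm f ^+ 2.
Proof.
move=> cf pf; have l2 := L2T_continuous cf pf.
have w0 : is_wD 0 0 f f.
  by split => // phi _; rewrite expr0 mul1r.
have pos i j : 0 <= tint (fun z => wD i j f z ^+ 2).
  by apply: tint_ge0 => z _; exact: sqr_ge0.
rewrite /H4norm sqr_sqrtr; last by apply: sumr_ge0 => i _; apply: sumr_ge0 => j _;
  exact: pos.
rewrite (bigD1 ord0)//= (bigD1 ord0)//= (tint_wD_sq w0) -addrA lerDl addr_ge0//.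
  by apply: sumr_ge0 => j _; exact: pos.
by apply: sumr_ge0 => i _; apply: sumr_ge0 => j _; exact: pos.
Qed.

Lemma H4norm_eq0 f : continuous f -> periodic2 f -> H4norm f = 0 -> f = fun=> 0.
Proof.
move=> cf pf f0; apply: (periodic2_eq0 pf); apply: (continuous_sqr0 cf pf).
apply/eqP; rewrite eq_le tint_ge0 ?andbT => [|z _]; last exact: sqr_ge0.
by have := ip_le_H4norm cf pf; rewrite f0 expr0n.
Qed.

Definition i0 : 'I_3 := @Ordinal 3 0 isT.
Definition i1 : 'I_3 := @Ordinal 3 1 isT.
Definition i2 : 'I_3 := @Ordinal 3 2 isT.

Definition pick3 (T : Type) (a b c : T) (i : 'I_3) : T :=
  match val i with 0%N => a | 1%N => b | _ => c end.

Definition affine3 f0 f1 f2 f3 (u : 'rV[R]_3) : R * R -> R :=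
  fun z => f0 z + u 0 i0 * f1 z + u 0 i1 * f2 z + u 0 i2 * f3 z.

Definition even_test f := test f /\ forall x y : R, f (x, - y) = f (x, y).

Lemma even_test0 : even_test (fun=> 0). Proof. by split => //; exact: test_cst. Qed.

Lemma test_affine3 f0 f1 f2 f3 u : test f0 -> test f1 -> test f2 -> test f3 ->
  test (affine3 f0 f1 f2 f3 u).
Proof.
move=> t0 t1 t2 t3; exact: (test_axpy (u 0 i2) (test_axpy (u 0 i1) (test_axpy (u 0
  i0) t0 t1) t2) t3).
Qed.

Lemma H4norm_affine3 f1 f2 f3 : test f1 -> test f2 -> test f3 ->
  exists2 B, 0 <= B & forall w, H4norm (affine3 (fun=> 0) f1 f2 f3 w) <=
    Num.sqrt (B * (w 0 i0 ^+ 2 + w 0 i1 ^+ 2 + w 0 i2 ^+ 2)).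
Proof.
move=> t1 t2 t3; have t0 := @test_cst R 0.
pose B := 8 * H4sq f1 + 4 * H4sq f2 + 2 * H4sq f3.
have q1 := H4sq_ge0 f1; have q2 := H4sq_ge0 f2; have q3 := H4sq_ge0 f3.
have B0 : 0 <= B by rewrite /B; lra.
exists B => // w.
rewrite H4norm_test; last exact: test_affine3.
have s0 := sqr_ge0 (w 0 i0); have s1 := sqr_ge0 (w 0 i1); have s2 := sqr_ge0 (w 0 i2).
rewrite ler_sqrt; last by rewrite mulr_ge0// !addr_ge0.
have E : affine3 (fun=> 0) f1 f2 f3 w = axpy (axpy (fun z =>
  w 0 i0 * f1 z) (w 0 i1) f2) (w 0 i2) f3.
  by apply/funext => z; rewrite /affine3 /axpy add0r.
have ta := testZ (w 0 i0) t1; have tb := test_axpy (w 0 i1) ta t2.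
have Z1 := H4sq_scale (w 0 i0) t1; have Z2 := H4sq_axpy (w 0 i1) ta t2;
  have Z3 := H4sq_axpy (w 0 i2) tb t3.
rewrite E; apply: (le_trans Z3); move: Z1 Z2; rewrite /B.
move: (H4sq (axpy _ _ _)) (H4sq (fun z =>
  _)) (H4sq f1) (H4sq f2) (H4sq f3) q1 q2 q3 => a b c d e q1 q2 q3.
move: (w 0 i0 ^+ 2) (w 0 i1 ^+ 2) (w 0 i2 ^+ 2) s0 s1 s2 => x y z x0 y0 z0 Z1 Z2.
have := mulr_ge0 q1 y0; have := mulr_ge0 q1 z0; have := mulr_ge0 q2 x0;
  have := mulr_ge0 q2 z0.
have := mulr_ge0 q3 x0; have := mulr_ge0 q3 y0; have := mulr_ge0 q1 x0;
  have := mulr_ge0 q2 y0.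
by have := mulr_ge0 q3 z0; lra.
Qed.

Lemma is_partial_affine3 f0 f1 f2 f3 i u : is_partial (affine3 f0 f1 f2 f3) i u
  (pick3 f1 f2 f3 i).
Proof.
rewrite /is_partial; apply: cvg_near_cst; near=> s.
have s0 : s != 0 by near: s; exact: nbhs_dnbhs_neq.
rewrite [X in H4norm X](_ : _ = fun=> 0); first exact: H4norm0.
apply/funext => z; rewrite /affine3 !mxE eqxx/= /pick3.
by case: i => [[|[|[|//]]] Hi]/=; field.
Unshelve. all: by end_near. Qed.

Lemma affine3_continuous f0 f1 f2 f3 u : test f1 -> test f2 -> test f3 ->
  H4norm (fun z => affine3 f0 f1 f2 f3 v z - affine3 f0 f1 f2 f3 u z) @[v --> u] -->
    (0 : R).
Proof.
move=> t1 t2 t3; have [B B0 HB] := H4norm_affine3 t1 t2 t3.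
pose K (v : 'rV[R]_3) : R := Num.sqrt (B * ((v 0 i0 - u 0 i0) ^+ 2 + (v 0 i1 - u 0
  i1) ^+ 2 + (v 0 i2 - u 0 i2) ^+ 2)).
have Ku : K u = 0 by rewrite /K !subrr expr0n/= !addr0 mulr0 sqrtr0.
have sq i : (v 0 i - u 0 i) ^+ 2 @[v --> u] --> (u 0 i - u 0 i) ^+ 2.
  have c : (v 0 i - u 0 i) @[v --> u] --> u 0 i - u 0 i.
    by apply: cvgB; [exact: coord_continuous|exact: cvg_cst].
  by rewrite expr2; under eq_fun do rewrite expr2; apply: cvgM.
have cK : K v @[v --> u] --> K u.
  apply: (@continuous_comp _ _ _ (fun v : 'rV[R]_3 => B * ((v 0 i0 - u 0 i0) ^+ 2 +
    (v 0 i1 - u 0 i1) ^+ 2 + (v 0 i2 - u 0 i2) ^+ 2)) (@Num.sqrt R) u);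
      last exact: sqrt_continuous.
  exact: (cvgM (@cvg_cst _ B _ _ _) (cvgD (cvgD (sq i0) (sq i1)) (sq i2))).
have bd v : 0 <= H4norm (fun z =>
  affine3 f0 f1 f2 f3 v z - affine3 f0 f1 f2 f3 u z) <= K v.
  apply/andP; split; first exact: sqrtr_ge0.
  have -> : (fun z => affine3 f0 f1 f2 f3 v z - affine3 f0 f1 f2 f3 u z) = affine3
    (fun=> 0) f1 f2 f3 (v - u).
    by apply/funext => z; rewrite /affine3 !mxE; ring.
  by apply: (le_trans (HB _)); rewrite /K !mxE.
apply: (@squeeze_cvgr _ (nbhs u) _ _ (cst 0) K _ (filterE _ bd)).
  exact: cvg_cst.
by rewrite -Ku.
Qed.

Lemma even_test_H4ev f : even_test f -> H4ev f.
Proof. by move=> [tf ef]; split => //; exact: test_H4T. Qed.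

(** The partial derivatives of an affine map are constant, hence again affine. *)
Lemma CkH4_affine3 k U f0 f1 f2 f3 : even_test f0 -> even_test f1 -> even_test f2 ->
  even_test f3 ->
  CkH4 k U (affine3 f0 f1 f2 f3).
Proof.
elim: k f0 f1 f2 f3 => [|k IH] f0 f1 f2 f3 e0 e1 e2 e3 /=; split => //.
1,3: move=> u _; apply: even_test_H4ev; split; [apply: test_affine3;
  by [case: e0|case: e1|case: e2|case: e3]|
  by move=> x y; rewrite /affine3 e0.2 e1.2 e2.2 e3.2].
1,2: by move=> u _; apply: affine3_continuous; [case: e1|case: e2|case: e3].
move=> i; exists (affine3 (pick3 f1 f2 f3 i) (fun=> 0) (fun=> 0) (fun=> 0));
  split => [u _|].
  rewrite (_ : affine3 _ _ _ _ u = pick3 f1 f2 f3 i); first exact: is_partial_affine3.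
  by apply/funext => z; rewrite /affine3 !mulr0 !addr0.
apply: IH; try exact: even_test0.
by case: i => [[|[|[|//]]] Hi].
Qed.

Definition cosx : R * R -> R := fun z => cos z.1.
Definition sinx : R * R -> R := fun z => sin z.1.
Definition cosy : R * R -> R := fun z => cos z.2.

Lemma even_test_cosx : even_test cosx.
Proof.
split => //; have := test_trigmon 1 0 0 0 : test (@trigmon R _ _ _ _).
by congr test; apply/funext => z; rewrite mcE.
Qed.
Lemma even_test_sinx : even_test sinx.
Proof.
split => //; have := test_trigmon 1 0 (- (pi / 2)) 0 : test (@trigmon R _ _ _ _).
by congr test; apply/funext => z; rewrite msE.
Qed.
Lemma even_test_cosy : even_test cosy.
Proof.
split; last by move=> x y; rewrite /cosy/= cosN.
have := test_trigmon 0 1 0 0 : test (@trigmon R _ _ _ _).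
by congr test; apply/funext => z; rewrite ncE.
Qed.
Lemma even_test_cst (c : R) : even_test (fun=> c).
Proof. by split => //; exact: test_cst. Qed.

Definition chart (m : R) := affine3 (fun=> m) cosx sinx cosy.

Lemma chartE m u : chart m u = wave m (u 0 i0) (u 0 i1) (u 0 i2).
Proof. by []. Qed.

Definition row3 (a b c : R) : 'rV[R]_3 := \row_i pick3 a b c i.

Lemma chart_row3 m a b c : chart m (row3 a b c) = wave m a b c.
Proof. by rewrite chartE !mxE. Qed.

Definition chart_dom (m : R) : set 'rV[R]_3 :=
  [set u | Num.sqrt (u 0 i0 ^+ 2 + u 0 i1 ^+ 2) + `|u 0 i2| < m].

Lemma open_chart_dom m : open (chart_dom m).
Proof.
have sq i : continuous (fun u : 'rV[R]_3 => u 0 i ^+ 2).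
  move=> u; have c : (fun v : 'rV[R]_3 =>
    v 0 i) @ u --> u 0 i by exact: coord_continuous.
  by rewrite /continuous_at expr2; under eq_fun do rewrite expr2; exact: (cvgM c c).
apply: (@open_comp _ _ (fun u : 'rV[R]_3 =>
  Num.sqrt (u 0 i0 ^+ 2 + u 0 i1 ^+ 2) + `|u 0 i2|) [set x | x < m]);
  last exact: open_lt.
move=> u _.
have c2 : (fun v : 'rV[R]_3 => v 0 i2) @ u --> u 0 i2 by exact: coord_continuous.
have s1 : (fun v : 'rV[R]_3 => v 0 i0 ^+ 2 + v 0 i1 ^+ 2) @ u --> u 0 i0 ^+ 2 + u 0
  i1 ^+ 2.
  exact: (cvgD (@sq i0 u) (@sq i1 u)).
exact: (cvgD (cvg_comp _ _ s1 (@sqrt_continuous R _)) (cvg_norm c2)).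
Qed.

(** Evaluate at (0, 0), (pi, 0), (pi / 2, 0) and (0, pi). *)
Lemma wave_coef m al be b m' al' be' b' : wave m al be b = @wave R m' al' be' b' ->
  [/\ m = m', al = al', be = be' & b = b'].
Proof.
move=> /funeqP E.
have := E (0, 0); have := E (pi, 0); have := E (pi / 2, 0); have := E (0, pi).
rewrite /wave/= !cos0 !sin0 !cospi !sinpi !cos_pihalf !sin_pihalf => *.
by split; lra.
Qed.

Lemma ip_wave (al be b : R) : ip (wave 0 al be b) (wave 0 al be b) = 2 * pi ^+ 2 *
  (al ^+ 2 + be ^+ 2 + b ^+ 2).
Proof.
have L j k s t : L2T (@trigmon R j k s t) by exact: L2T_test (test_trigmon _ _ _ _).
rewrite -trig5E ip_trig5; last exact: L2T_test (test_trig5 _ _ _ _ _).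
have c00 : cos (0 - 0 : R) = 1 by rewrite subr0 cos0.
have cmp : cos (- (pi / 2) - 0 : R) = 0 by rewrite subr0 cosN cos_pihalf.
have cpp : cos (- (pi / 2) - - (pi / 2) : R) = 1 by rewrite subrr cos0.
have I j k s t := ipC (@trigmon R j k s t) (trig5 0 al be b 0).
have cpm : cos (0 - - (pi / 2) : R) = 0 by rewrite sub0r opprK cos_pihalf.
rewrite !I !ip_trig5// !ip_theta1 !ip_zeta1 c00 cmp cpm cpp.
rewrite ip_one_one !ip_trigmon_neq//; ring.
Qed.

(** [chart m] is a global chart.  For the immersion property, difference quotients of an
    affine map are constant, so that a partial derivative is determined by
    [H4norm_eq0]. *)
Lemma Mset_submanifold m : H4submanifold 3 (@Mset R m).
Proof.
split => [H /MsetP[al [be [b [-> _]]]]|H MH]; first exact: wave_H4ev.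
exists (chart_dom m), (chart m); split.
- split; first exact: open_chart_dom.
  have /MsetP[al [be [b [HE lt]]]] := MH.
  by exists (row3 al be b); [rewrite /chart_dom/= !mxE|rewrite chart_row3 HE].
- by move=> u du; apply/MsetP; exists (u 0 i0), (u 0 i1), (u 0 i2).
- move=> u v _ _; rewrite !chartE => /wave_coef[_ E0 E1 E2].
  by apply/rowP => -[[|[|[|//]]] Hi];
    [rewrite (_ : Ordinal Hi = i0)|rewrite (_ : Ordinal Hi = i1)|
    rewrite (_ : Ordinal Hi = i2)] => //; exact: val_inj.
- by move=> k; apply: CkH4_affine3;
  [exact: even_test_cst|exact: even_test_cosx|exact: even_test_sinx|exact:
  even_test_cosy].
split.
- move=> u _ psi Hpsi c c0.
  pose F := pick3 cosx sinx cosy.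
  have eF i : even_test (F i) by case: i => [[|[|[|//]]] Hi];
    [exact: even_test_cosx|exact: even_test_sinx|exact: even_test_cosy].
  have psiF i : psi i = F i.
    have [[[cp pp _] _] Pi] := Hpsi i; have [tF _] := eF i.
    have cF := test_continuous tF; have pF := tF.1.
    have cd : continuous (axpy (F i) (-1) (psi i)).
      by apply: continuousD2 => //; apply: continuousM2 => // z; exact: cvg_cst.
    have pd : periodic2 (axpy (F i) (-1) (psi i)) by apply: periodic2D => //;
      exact: periodic2Z.
    suff /(H4norm_eq0 cd pd)/funeqP E : H4norm (axpy (F i) (-1) (psi i)) = 0.
      by apply/funext => z; have := E z; rewrite /axpy mulN1r => /eqP;
        rewrite subr_eq0 => /eqP.
    have lim1 : H4norm (axpy (F i) (-1) (psi i)) @[s --> (0 : R)^'] --> (0 : R).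
      apply: cvg_trans Pi; apply: near_eq_cvg; near=> s.
      have s0 : s != 0 by near: s; exact: nbhs_dnbhs_neq.
      congr H4norm; apply/funext => z; rewrite /axpy mulN1r; congr (_ - _).
      rewrite /chart /affine3 !mxE eqxx/= /F /pick3.
      by case: (i) => [[|[|[|//]]] Hi]/=; field.
    exact: (cvg_unique (@norm_hausdorff _ R) (@cvg_cst _ _ _ _ _) lim1).
  have S z : c i0 * cos z.1 + c i1 * sin z.1 + c i2 * cos z.2 = 0.
    rewrite -[RHS](c0 z) !big_ord_recl big_ord0 addr0 addrA !psiF.
    by congr (_ * _ + _ * _ + _ * _); congr c; exact: val_inj.
  have S0 := S (0, pi / 2); have S1 := S (pi / 2, pi / 2); have S2 := S (0, 0).
  move: S0 S1 S2; rewrite /= !cos0 !sin0 !cos_pihalf !sin_pihalf => S0 S1 S2.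
  by case=> [[|[|[|//]]] Hi]; [rewrite (_ : Ordinal Hi = i0)|rewrite (_ : Ordinal Hi
    = i1)|
    rewrite (_ : Ordinal Hi = i2)]; try exact: val_inj; lra.
- (* Radius e suffices, because the squared L^2 norm of a difference of waves is
     2 pi^2 >= 1 times the squared Euclidean distance of the parameters. *)
  move=> u _ e e0; exists e => // G /MsetP[al [be [b [-> lt]]]] Hn.
  exists (row3 al be b); split; [by rewrite /chart_dom/= !mxE| |by rewrite chart_row3].
  set x := al - u 0 i0; set y := be - u 0 i1; set w := b - u 0 i2.
  have D : (fun z => wave m al be b z - chart m u z) = wave 0 x y w.
    by apply/funext => z; rewrite chartE /wave /x /y /w; ring.
  have tD := test_wave 0 x y w.
  have bound : x ^+ 2 + y ^+ 2 + w ^+ 2 < e ^+ 2.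
    have : ip (wave 0 x y w) (wave 0 x y w) < e ^+ 2.
      apply: le_lt_trans (ip_le_H4norm (test_continuous tD) tD.1) _.
      by rewrite -D ltr_sqr ?nnegrE ?sqrtr_ge0 ?(ltW e0).
    rewrite ip_wave; apply: le_lt_trans.
    have p4 : (2 : R) ^+ 2 <= pi ^+ 2 by rewrite ler_sqr ?nnegrE ?pi_ge0 ?pi_ge2.
    by rewrite ler_peMl ?addr_ge0 ?sqr_ge0//; lra.
  have sx := sqr_ge0 x; have sy := sqr_ge0 y; have sw := sqr_ge0 w.
  have nb (a : R) : a ^+ 2 < e ^+ 2 -> `|a| < e.
    by move=> H1; rewrite -ltr_sqr ?nnegrE ?(ltW e0)// real_normK ?num_real.
  split => // i j; rewrite (ord1 i) !mxE -ball_normE/= distrC.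
  case: j => [[|[|[|//]]] Hj]; rewrite /pick3/=;
   [rewrite (_ : Ordinal Hj = i0)|rewrite (_ : Ordinal Hj = i1)|
    rewrite (_ : Ordinal Hj = i2)]; try exact: val_inj; apply: nb;
    rewrite -/x -/y -/w; lra.
Unshelve. all: by end_near. Qed.

End Manifold.

Theorem lemma6p1 (R : realType) (gamma m : R) (hgamma : 0 < gamma)
    (hm : 0 < m) :
  positive_steady_states gamma m = Mset m /\ H4submanifold 3 (Mset m).
Proof. by split; [exact: steady_states_Mset|exact: Mset_submanifold]. Qed.
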